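(* Let $\alpha\in\mathbb{R}$, $\omega>\omega_\alpha$, $\tilde\omega>0$ and $\beta \ge 0$. Then the following are equivalent: (i) $c_\beta < c_\beta^0$; (ii) $d(\omega) < d^0(\tilde{\omega})$ or $\beta > \beta^*$.
   Context: Functions are complex-valued on $\mathbb{R}^2$ and $\|\cdot\|_p$ is the $L^p(\mathbb{R}^2)$ norm. For $\lambda>0$, $\mathcal{G}_\lambda$ is the Green's function of $-\Delta+\lambda$ on $\mathbb{R}^2$, i.e. the $L^2$ solution of $(-\Delta+\lambda)\mathcal{G}_\lambda=\delta_0$. Put $\theta_\lambda:=\frac{\log(\sqrt{\lambda}/2)+\gamma}{2\pi}$ ($\gamma$ the Euler–Mascheroni constant) and $\omega_\alpha:=4e^{-4\pi\alpha-2\gamma}$, so $\alpha+\theta_\lambda>0$ for $\lambda>\omega_\alpha$. Let $$H^1_\alpha(\mathbb{R}^2):=\{u\in L^2(\mathbb{R}^2): \exists\, q\in\mathbb{C},\ \lambda>0 \text{ with } \phi_\lambda:=u-q\mathcal{G}_\lambda\in H^1(\mathbb{R}^2)\};$$ the charge $q=q(u)$ is uniquely determined by $u$ and independent of $\lambda$. For $\omega>\omega_\alpha$ and $u=\phi_\lambda+q\mathcal{G}_\lambda\in H^1_\alpha(\mathbb{R}^2)$, $$\langle(-\Delta_\alpha+\omega)u,u\rangle:=\|\nabla\phi_\lambda\|_2^2+\lambda\|\phi_\lambda\|_2^2+(\omega-\lambda)\|u\|_2^2+(\alpha+\theta_\lambda)|q|^2,$$ which does not depend on $\lambda$ (one fixes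 $\omega_\alpha<\lambda\le\omega$). Let $\mathbb{H}_\alpha:=H^1_\alpha(\mathbb{R}^2)\times H^1(\mathbb{R}^2)$ and, for $(u,v)\in\mathbb{H}_\alpha$, $$I_\beta(u,v):=\tfrac12\big(\langle(-\Delta_\alpha+\omega)u,u\rangle+\|\nabla v\|_2^2+\tilde\omega\|v\|_2^2\big)-\tfrac14(\|u\|_4^4+\|v\|_4^4)-\tfrac\beta2\int_{\mathbb{R}^2}|uv|^2,$$ $$G_\beta(u,v):=\langle(-\Delta_\alpha+\omega)u,u\rangle+\|\nabla v\|_2^2+\tilde\omega\|v\|_2^2-(\|u\|_4^4+\|v\|_4^4)-2\beta\int_{\mathbb{R}^2}|uv|^2,$$ $\mathcal{N}_\beta:=\{(u,v)\in\mathbb{H}_\alpha\setminus\{(0,0)\}: G_\beta(u,v)=0\}$, $c_\beta:=\inf_{\mathcal{N}_\beta}I_\beta$. Without point interaction: on $\mathbb{H}:=H^1(\mathbb{R}^2)\times H^1(\mathbb{R}^2)$ let $I^0_\beta$ and $G^0_\beta$ be given by the same formulas with $\langle(-\Delta_\alpha+\omega)u,u\rangle$ replaced by $\|\nabla u\|_2^2+\omega\|u\|_2^2$; $\mathcal{N}^0_\beta:=\{(u,v)\in\mathbb{H}\setminus\{(0,0)\}:G^0_\beta(u,v)=0\}$ and $c^0_\beta:=\inf_{\mathcal{N}^0_\beta}I^0_\beta$. Put $\beta^*:=\max\{\beta\ge0:c_\beta=c_0\}$ (the maximum exists). Single-equation levels: $S_\omega(u):=\frac12\langle(-\Delta_\alpha+\omega)u,u\rangle-\frac14\|u\|_4^4$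 on $H^1_\alpha(\mathbb{R}^2)$, $\mathcal{M}_\omega:=\{u\in H^1_\alpha(\mathbb{R}^2)\setminus\{0\}:\langle(-\Delta_\alpha+\omega)u,u\rangle=\|u\|_4^4\}$, $d(\omega):=\inf_{\mathcal{M}_\omega}S_\omega$; and $S^0_{\tilde\omega}(v):=\frac12(\|\nabla v\|_2^2+\tilde\omega\|v\|_2^2)-\frac14\|v\|_4^4$ on $H^1(\mathbb{R}^2)$, $\mathcal{M}^0_{\tilde\omega}:=\{v\in H^1(\mathbb{R}^2)\setminus\{0\}:\|\nabla v\|_2^2+\tilde\omega\|v\|_2^2=\|v\|_4^4\}$, $d^0(\tilde\omega):=\inf_{\mathcal{M}^0_{\tilde\omega}}S^0_{\tilde\omega}$. *)

(* Defs.v *)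
From HB Require Import structures.
From mathcomp Require Import all_boot all_order all_algebra.
From mathcomp Require Import all_classical all_reals all_analysis.
From mathcomp Require Import complex.

Set Implicit Arguments.
Unset Strict Implicit.
Unset Printing Implicit Defensive.

Import Order.TTheory GRing.Theory Num.Theory.
Import numFieldNormedType.Exports.

Local Open Scope classical_set_scope.
Local Open Scope complex_scope.
Local Open Scope ring_scope.

Section Plane.
Variable R : realType.
Local Notation plane := (R * R)%type.
Local Notation cfun := (R * R -> R[i]).
Implicit Types (u v f g : R * R -> R[i]).

Definition leb2 : {measure set (measurableTypeR R * measurableTypeR R) -> \bar R} :=
  (@lebesgue_measure R \x @lebesgue_measure R)%E.

Definition cmod (z : R[i]) : R := ComplexField.Normc.normc z.

Definition cint f : R[i] :=
  (\int[leb2]_x complex.Re (f x)) +i* (\int[leb2]_x complex.Im (f x)).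

(* Elements of function spaces are represented by functions; equality in L^2
   is equality almost everywhere.  Measurability is Borel measurability, which
   loses no almost everywhere classes. *)
Definition L2 : set cfun :=
  [set u : cfun | (@complex.Re R \o u) \in Lfun leb2 2%:E
    /\ (@complex.Im R \o u) \in Lfun leb2 2%:E].

Definition aezero u := u = (fun=> 0) %[ae leb2].

Definition Lpnorm (p : R) u : R :=
  fine (Lnorm leb2 p%:E (fun x => (cmod (u x))%:E)).

Definition basis_dir (i : 'I_2) : plane := if i == 0 then (1, 0) else (0, 1).

Definition partial (i : 'I_2) (phi : plane -> R) : plane -> R :=
  fun x => 'D_(basis_dir i) phi x.

Definition laplacian (phi : plane -> R) : plane -> R :=
  fun x => \sum_(i < 2) partial i (partial i phi) x.

(* C^oo: all iterated partial derivatives exist and are continuous. *)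
Definition smooth (phi : plane -> R) := forall w : seq 'I_2,
  let g := foldr partial phi w in
  continuous g /\ forall i x, derivable g x (basis_dir i).

(* Real-valued test functions suffice: by linearity, the distributional
   identities below extend to complex-valued ones. *)
Definition test_function : set (plane -> R) :=
  [set phi : plane -> R | smooth phi /\
    exists2 K : set plane, compact K & forall x, ~ K x -> phi x = 0].

Definition is_weak_partial (i : 'I_2) u g := forall phi, test_function phi ->
  cint (fun x => u x * (partial i phi x)%:C) =
  - cint (fun x => g x * (phi x)%:C).

Definition H1 : set cfun := [set u : cfun | L2 u /\
  forall i, exists2 g, L2 g & is_weak_partial i u g].

(* The chosen g is unique up to a.e. equality when u is in H1. *)
Definition weak_partial (i : 'I_2) u : cfun :=
  xget (fun=> 0) [set g : cfun | L2 g /\ is_weak_partial i u g].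

(* ||nabla u||_2^2 *)
Definition dirichlet u : R := \sum_(i < 2) Lpnorm 2 (weak_partial i u) ^+ 2.

(* g is in L^2 and (- Delta + lambda) g = delta_0 in distributions. *)
Definition is_green (lambda : R) g := L2 g /\ forall phi, test_function phi ->
  cint (fun x => g x * (- laplacian phi x + lambda * phi x)%:C) = (phi 0)%:C.

Definition green (lambda : R) : cfun :=
  xget (fun=> 0) [set g : cfun | is_green lambda g].

Definition euler_gamma : R :=
  limn (fun n => series harmonic n - ln n%:R).

Definition theta (lambda : R) : R :=
  (ln (Num.sqrt lambda / 2) + euler_gamma) / (2 * pi).

Definition omega_min (alpha : R) : R :=
  4 * expR (- (4 * pi * alpha) - 2 * euler_gamma).

Definition regular_part (lambda : R) (q : R[i]) u : cfun :=
  fun x => u x - q * green lambda x.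

(* As a set it does not depend on alpha. *)
Definition H1alpha : set cfun := [set u : cfun | L2 u /\
  exists (q : R[i]) (lambda : R), 0 < lambda /\ H1 (regular_part lambda q u)].

Definition point_charge u : R[i] :=
  xget 0 [set q | exists2 lambda : R, 0 < lambda & H1 (regular_part lambda q u)].

(* <(- Delta_alpha + omega) u, u> with u = phi_lambda + q G_lambda.  The value
   is the same for all lambda with omega_alpha < lambda <= omega, and the
   definitions below carry the chosen lambda as a parameter. *)
Definition point_form (alpha lambda omega : R) u : R :=
  let phi := regular_part lambda (point_charge u) u in
  dirichlet phi + lambda * Lpnorm 2 phi ^+ 2
  + (omega - lambda) * Lpnorm 2 u ^+ 2
  + (alpha + theta lambda) * cmod (point_charge u) ^+ 2.

(* <(- Delta + omega) u, u> *)
Definition free_form (omega : R) u : R :=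
  dirichlet u + omega * Lpnorm 2 u ^+ 2.

Definition coupling u v : R := \int[leb2]_x (cmod (u x * v x) ^+ 2).

Definition energy (Q1 Q2 : cfun -> R) (beta : R) u v : R :=
  2^-1 * (Q1 u + Q2 v) - 4^-1 * (Lpnorm 4 u ^+ 4 + Lpnorm 4 v ^+ 4)
  - beta / 2 * coupling u v.

Definition nehari_fun (Q1 Q2 : cfun -> R) (beta : R) u v : R :=
  Q1 u + Q2 v - (Lpnorm 4 u ^+ 4 + Lpnorm 4 v ^+ 4) - 2 * beta * coupling u v.

Definition nehari (X : set cfun) (Q1 Q2 : cfun -> R) (beta : R)
    : set (cfun * cfun) :=
  [set p : cfun * cfun | [/\ X p.1, H1 p.2, ~ (aezero p.1 /\ aezero p.2) &
               nehari_fun Q1 Q2 beta p.1 p.2 = 0]].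

(* The infima are of nonempty sets bounded below by 0, so inf is the real
   infimum. *)
Definition level (X : set cfun) (Q1 Q2 : cfun -> R) (beta : R) : R :=
  inf [set energy Q1 Q2 beta p.1 p.2 | p in nehari X Q1 Q2 beta].

(* c_beta *)
Definition c_point (alpha lambda omega tomega beta : R) : R :=
  level H1alpha (point_form alpha lambda omega) (free_form tomega) beta.

(* c^0_beta *)
Definition c_free (omega tomega beta : R) : R :=
  level H1 (free_form omega) (free_form tomega) beta.

Definition set_max (A : set R) : R := xget 0 [set b | A b /\ ubound A b].

(* beta^* *)
Definition beta_star (alpha lambda omega tomega : R) : R :=
  set_max [set b | 0 <= b /\
    c_point alpha lambda omega tomega b = c_point alpha lambda omega tomega 0].

Definition energy1 (Q : cfun -> R) u : R :=
  2^-1 * Q u - 4^-1 * Lpnorm 4 u ^+ 4.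

Definition nehari1 (X : set cfun) (Q : cfun -> R) : set cfun :=
  [set u : cfun | [/\ X u, ~ aezero u & Q u = Lpnorm 4 u ^+ 4]].

Definition level1 (X : set cfun) (Q : cfun -> R) : R :=
  inf [set energy1 Q u | u in nehari1 X Q].

(* d(omega) *)
Definition d_point (alpha lambda omega : R) : R :=
  level1 H1alpha (point_form alpha lambda omega).

(* d^0(tomega) *)
Definition d_free (tomega : R) : R := level1 H1 (free_form tomega).

End Plane.

(* Main.v *)
(* Every level is the infimum of a quotient Q^2 / (4 N), with Q the quadratic part
   and N the quartic part of the energy.  Since c_beta <= c^0_beta <= d^0 and
   c_beta <= c_0, while c_0 >= min(d, d^0), everything reduces to one claim: if
   c^0_beta < d^0 then c_beta < c^0_beta.

   Suppose c_beta = c^0_beta = c.  Then 4 c N <= Q^2 also holds after adding t G,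
   with G the Green function, to a free pair (u, v); as N is convex in u, a near
   optimizer (u, v) of the free quotient almost satisfies the Euler-Lagrange
   equation tested against G, and by translation invariance against every
   translate of G.  With k the right-hand side of the equation for Re u (and then,
   by symmetry, Im u), this says that the convolution of k with G is uniformly
   small.  That convolution solves (- Delta + lambda) W = k, so Re u is small up to
   an H^1-small error, and u tends to 0 in L^4.  Hence v alone is almost optimal
   and c >= d^0, a contradiction.

   The definition of the levels requires G in L^4, obtained by comparing G with
   its dilation G(4 .), and G not in H^1, which makes the charge unique. *)
From HB Require Import structures.
Require Import Defs.
From mathcomp Require Import all_boot all_order all_algebra.
From mathcomp Require Import all_classical all_reals all_analysis.
From mathcomp Require Import measurable_realfun complex ring lra.

Set Implicit Arguments.
Unset Strict Implicit.
Unset Printing Implicit Defensive.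

Import Order.TTheory GRing.Theory Num.Theory.
Import numFieldNormedType.Exports.

Local Open Scope classical_set_scope.
Local Open Scope ring_scope.

(** * Integrable and square-integrable functions *)

(** The point form has no cross term between the regular part and the charge. Near optimality along
    u + t G, with t of either sign, therefore makes the integral of k G small, whereas the equation
    (- Delta + lambda) u = k would make this integral equal to u(0); after translation, u is small
    everywhere. No minimizer is used, since its existence would need a compactness argument. For Q =
    1 and 4 c N >= 1 - tau^2, a step t of size tau turns the defect tau^2 into an error of size tau
    in the equation, and the integral of u^4 becomes O(tau^2). H^1 and G are known only through
    distributions. Two tools replace Fourier analysis and mollification: a maximum principle giving
    uniqueness for (- Delta + lambda) w = 0, and the Riesz theorem for the energy on test functions.
    Riesz yields a weak solution in H^1 together with test functions approximating it, and
    uniqueness identifies it with the given function. Density of test functions, the regularity of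
    differences of Green functions and that of the convolution minus u all arise in this way. *)

Section Integral.
Context d (T : measurableType d) (R : realType).
Variable mu : {measure set T -> \bar R}.
Implicit Types f g h u : T -> R.

Definition intble f := mu.-integrable setT (EFin \o f).
Definition sqint f := measurable_fun setT f /\ intble (fun x => f x ^+ 2).
Local Notation I f := (\int[mu]_x f x).

Lemma intble_meas f : intble f -> measurable_fun setT f.
Proof. by move=> /(measurable_int mu) /measurable_EFinP. Qed.

Lemma intbleD f g : intble f -> intble g -> intble (fun x => f x + g x).
Proof. by move=> fi gi; exact: (integrableD measurableT fi gi). Qed.

Lemma intbleZ (c : R) f : intble f -> intble (fun x => c * f x).
Proof. by move=> fi; exact: (integrableZl measurableT c fi). Qed.

Lemma intbleN f : intble f -> intble (fun x => - f x).
Proof. by move=> fi; exact: (integrableN fi). Qed.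

Lemma intbleB f g : intble f -> intble g -> intble (fun x => f x - g x).
Proof. by move=> fi gi; exact: (integrableB measurableT fi gi). Qed.

Lemma intble0 : intble (fun=> 0).
Proof. exact: integrable0. Qed.

Lemma intble_le f g : measurable_fun setT f -> intble g ->
  (forall x, `|f x| <= g x) -> intble f.
Proof.
move=> mf gi fg; apply: (le_integrable measurableT _ _ gi).
  exact/measurable_EFinP.
by move=> x _ /=; rewrite lee_fin (le_trans (fg x))// ler_norm.
Qed.

Lemma intble_norm f : intble f -> intble (fun x => `|f x|).
Proof. by move=> fi; exact: (integrable_norm fi). Qed.

Lemma RintD f g : intble f -> intble g -> I (fun x => f x + g x) = I f + I g.
Proof. exact: RintegralD. Qed.

Lemma RintB f g : intble f -> intble g -> I (fun x => f x - g x) = I f - I g.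
Proof. exact: RintegralB. Qed.

Lemma RintZ (c : R) f : intble f -> I (fun x => c * f x) = c * I f.
Proof. exact: RintegralZl. Qed.

Lemma RintN f : intble f -> I (fun x => - f x) = - I f.
Proof.
move=> fi; rewrite -mulN1r -(RintZ _ fi).
by apply: eq_Rintegral => x _; rewrite mulN1r.
Qed.

Lemma Rint_cst0 : I (fun=> 0) = 0 :> R.
Proof. by rewrite /Rintegral integral0. Qed.

Lemma Rint_ge0 f : (forall x, 0 <= f x) -> 0 <= I f.
Proof. by move=> f0; exact: Rintegral_ge0. Qed.

Lemma Rint_le f g : intble f -> intble g -> (forall x, f x <= g x) -> I f <= I g.
Proof. by move=> fi gi fg; exact: le_Rintegral. Qed.

Lemma Rint_norm f : intble f -> `|I f| <= I (fun x => `|f x|).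
Proof. exact: le_normr_Rintegral. Qed.

Lemma Rint_norm_le f g : intble f -> intble g -> (forall x, `|f x| <= g x) ->
  `|I f| <= I g.
Proof.
move=> fi gi fg; apply: (le_trans (Rint_norm fi)).
by apply: Rint_le => //; exact: intble_norm.
Qed.

Lemma EFin_Rint f : intble f -> (I f)%:E = (\int[mu]_x (f x)%:E)%E.
Proof. by move=> fi; rewrite /Rintegral fineK// integrable_fin_num. Qed.

Lemma Rint_eq0 f : intble f -> (forall x, 0 <= f x) -> I f = 0 ->
  {ae mu, forall x, f x = 0}.
Proof.
move=> fi f0 If; have : (\int[mu]_x `|(EFin \o f) x| = 0)%E.
  transitivity (\int[mu]_x (f x)%:E)%E; last by rewrite -EFin_Rint// If.
  by apply: eq_integral => x _; rewrite /= ger0_norm.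
move/(ae_eq_integral_abs mu measurableT (measurable_int mu fi)).
by apply: filterS => x /= /(_ Logic.I) [].
Qed.

Lemma ae_Rint f g : intble f -> measurable_fun setT g ->
  {ae mu, forall x, f x = g x} -> intble g /\ I f = I g.
Proof.
move=> fi mg fg; have mg' : measurable_fun setT (EFin \o g) by exact/measurable_EFinP.
have mf' := measurable_int mu fi.
split; last first.
  rewrite /Rintegral; congr fine; apply: ae_eq_integral => //.
  by apply: filterS fg => x /= -> _.
apply/integrableP; split => //; move/integrableP: fi => [_]; apply: le_lt_trans.
rewrite le_eqVlt; apply/orP; left; apply/eqP.
apply: ae_eq_integral => //; first exact: measurableT_comp.
  exact: measurableT_comp.
by apply: filterS fg => x /= -> _.
Qed.

Lemma sqint_intbleM f g : sqint f -> sqint g -> intble (fun x => f x * g x).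
Proof.
move=> [mf fi] [mg gi]; apply: (@intble_le _ (fun x => f x ^+ 2 + g x ^+ 2)).
- exact: measurable_funM.
- exact: intbleD.
move=> x; rewrite normrM -(real_normK (num_real (f x))) -(real_normK (num_real (g x))).
by have := sqr_ge0 (`|f x| - `|g x|); have := sqr_ge0 (`|f x| + `|g x|); nra.
Qed.

Lemma sqintZ (c : R) f : sqint f -> sqint (fun x => c * f x).
Proof.
move=> [mf fi]; split; first exact: measurable_funM.
by under eq_fun do rewrite exprMn; exact: intbleZ.
Qed.

Lemma sqintD f g : sqint f -> sqint g -> sqint (fun x => f x + g x).
Proof.
move=> f2 g2; have [[mf fi] [mg gi]] := (f2, g2).
split; first exact: measurable_funD.
have -> : (fun x => (f x + g x) ^+ 2) =
    (fun x => (f x ^+ 2 + g x ^+ 2) + 2 * (f x * g x)).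
  by apply/funext => x; ring.
by apply: intbleD; [exact: intbleD|apply: intbleZ; exact: sqint_intbleM].
Qed.

Lemma sqintN f : sqint f -> sqint (fun x => - f x).
Proof.
by move=> /(sqintZ (-1)); under eq_fun do rewrite mulN1r.
Qed.

Lemma sqintB f g : sqint f -> sqint g -> sqint (fun x => f x - g x).
Proof. by move=> f2 g2; apply: sqintD => //; exact: sqintN. Qed.

Lemma sqint0 : sqint (fun=> 0).
Proof.
by split; [exact: measurable_cst|rewrite expr0n/=; exact: intble0].
Qed.

Lemma Rint_sqrD f g : sqint f -> sqint g ->
  I (fun x => (f x + g x) ^+ 2) =
  I (fun x => f x ^+ 2) + 2 * I (fun x => f x * g x) + I (fun x => g x ^+ 2).
Proof.
move=> f2 g2; have [[mf fi] [mg gi]] := (f2, g2).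
have fg := sqint_intbleM f2 g2.
rewrite -RintZ// -RintD//; last exact: intbleZ.
rewrite -RintD//; last by apply: intbleD => //; exact: intbleZ.
by apply: eq_Rintegral => x _; ring.
Qed.

Lemma RintZ2 (c : R) f g : sqint f -> sqint g ->
  I (fun x => (c * f x) * g x) = c * I (fun x => f x * g x).
Proof.
move=> f2 g2; rewrite -RintZ; last exact: sqint_intbleM.
by apply: eq_Rintegral => x _; rewrite mulrA.
Qed.

Lemma Cauchy_Schwarz f g : sqint f -> sqint g ->
  I (fun x => f x * g x) ^+ 2 <= I (fun x => f x ^+ 2) * I (fun x => g x ^+ 2).
Proof.
move=> f2 g2; have [[mf fi] [mg gi]] := (f2, g2).
set A := I (fun x => f x ^+ 2); set B := I (fun x => g x ^+ 2).
set C := I (fun x => f x * g x).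
have q (t : R) : 0 <= t ^+ 2 * A + 2 * (t * C) + B.
  have := @Rint_ge0 (fun x => (t * f x + g x) ^+ 2) (fun=> sqr_ge0 _).
  rewrite (Rint_sqrD (sqintZ t f2) g2) RintZ2//.
  by under eq_Rintegral do rewrite exprMn; rewrite RintZ.
have A0 : 0 <= A by apply: Rint_ge0 => x; exact: sqr_ge0.
have B0 : 0 <= B by apply: Rint_ge0 => x; exact: sqr_ge0.
have [A0'|Apos] := leP A 0.
  have AE : A = 0 by apply/eqP; rewrite eq_le A0' A0.
  rewrite AE mul0r; have [->|C0] := eqVneq C 0; first by rewrite expr0n.
  (* With A = 0 the polynomial is affine in t, and this t gives it the value -1. *)
  have := q (- (B + 1) / (2 * C)); rewrite AE mulr0 add0r.
  have -> : 2 * (- (B + 1) / (2 * C) * C) = - (B + 1) by field.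
  by lra.
have := q (- C / A).
have -> : (- C / A) ^+ 2 * A + 2 * (- C / A * C) + B = (A * B - C ^+ 2) / A.
  by field; rewrite gt_eqF.
by rewrite pmulr_lge0 ?invr_gt0// subr_ge0.
Qed.

Lemma sqint_ae f g : sqint f -> measurable_fun setT g ->
  {ae mu, forall x, f x = g x} -> sqint g.
Proof.
move=> [mf fi] mg fg; split => //; have [||//] := ae_Rint fi (g := fun x => g x ^+ 2).
  exact: measurable_funX.
by apply: filterS fg => x /= ->.
Qed.

(** An infinite integral becomes 0 in [I f], so a bound on [I f] is informative only together with
    integrability. Monotone convergence along the exhaustion [A n] gives both at once. *)
Lemma mono_intble f (A : nat -> set T) (C : R) :
  measurable_fun setT f -> (forall x, 0 <= f x) ->
  (forall n, measurable (A n)) -> (forall n, A n `<=` A n.+1) ->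
  (forall x, exists n, A n x) ->
  (forall n, intble (fun x => f x * \1_(A n) x)) ->
  (forall n, I (fun x => f x * \1_(A n) x) <= C) ->
  intble f /\ I f <= C.
Proof.
move=> mf f0 mA ndA covA fAi fAC.
have le_ind x : nondecreasing_seq (fun n => \1_(A n) x : R).
  apply/nondecreasing_seqP => n; rewrite !indicE ler_nat.
  case: (boolP (x \in A n)) => // /set_mem/ndA xA.
  by rewrite mem_set.
pose g n x := (f x * \1_(A n) x)%:E.
have mg n : measurable_fun setT (g n).
  by apply/measurable_EFinP; apply: measurable_funM.
have g0 n x : setT x -> (0 <= g n x)%E by move=> _; rewrite lee_fin mulr_ge0.
have ndg x : setT x -> nondecreasing_seq (g ^~ x).
  by move=> _ n m nm; rewrite lee_fin ler_wpM2l// le_ind.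
have gf x : limn (g ^~ x) = (f x)%:E.
  apply/cvg_lim => //; apply: cvg_EFin; first exact: nearW.
  have [n An] := covA x.
  have Anm m : (n <= m)%N -> A m x.
    elim: m => [|m IH]; first by rewrite leqn0 => /eqP <-.
    by rewrite leq_eqVlt => /predU1P[<-//|/IH]; exact: ndA.
  apply: cvg_near_cst; exists n => // m /= nm.
  by rewrite indicE mem_set ?mulr1//; exact: Anm.
have le1 : (\int[mu]_x (f x)%:E <= C%:E)%E.
  under eq_integral do rewrite -gf.
  rewrite (monotone_convergence mu measurableT mg g0 ndg).
  apply: lime_le.
    apply: ereal_nondecreasing_is_cvgn => m n mn.
    by apply: ge0_le_integral => // x _; [exact: g0|exact: ndg].
  by apply: nearW => n; rewrite -EFin_Rint// lee_fin.
have fi : intble f.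
  apply/integrableP; split; first exact/measurable_EFinP.
  apply: (@le_lt_trans _ _ C%:E); last exact: ltry.
  by under eq_integral do rewrite /= ger0_norm//.
by split => //; rewrite -lee_fin EFin_Rint.
Qed.

Lemma fatou_Rint (f : nat -> T -> R) g (C : R) :
  (forall n, intble (f n)) -> (forall n x, 0 <= f n x) ->
  measurable_fun setT g ->
  {ae mu, forall x, f n x @[n --> \oo] --> g x} ->
  (forall n, I (f n) <= C) -> intble g /\ I g <= C.
Proof.
move=> fi f0 mg fg fC.
have mf n : measurable_fun setT (EFin \o f n) := measurable_int mu (fi n).
have g0 : {ae mu, forall x, 0 <= g x}.
  apply: filterS fg => x fgx; rewrite -(cvg_lim _ fgx)//.
  by apply: limr_ge; [exact: cvgP fgx|apply: nearW => n; exact: f0].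
have gE : {ae mu, forall x, (limn_einf (fun n => (f n x)%:E) = `|(g x)%:E|)%E}.
  apply: filterS2 fg g0 => x fgx gx0.
  have fgx' : (fun n => (f n x)%:E) @ \oo --> (g x)%:E.
    by apply: cvg_EFin => //; exact: nearW.
  by rewrite is_cvg_limn_einfE ?(cvg_lim _ fgx')//= ?ger0_norm//; exact: cvgP fgx'.
have le1 : (\int[mu]_x `|(g x)%:E| <= C%:E)%E.
  rewrite [leLHS](_ : _ = \int[mu]_x limn_einf (fun n => (f n x)%:E))%E; last first.
    apply: ae_eq_integral => //.
    - by apply: measurableT_comp => //; exact/measurable_EFinP.
    - apply: measurableT_comp => //; apply: measurable_fun_limn_esup => n.
      exact: (measurableT_comp _ (mf n)).
    - by apply: filterS gE => x -> _.
  apply: (le_trans (fatou mu measurableT mf _)); first by move=> n x _; rewrite lee_fin.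
  rewrite limn_einf_lim; apply: lime_le; first exact: is_cvg_einfs.
  apply: nearW => n; apply: le_trans (_ : (I (f n))%:E <= _)%E; last by rewrite lee_fin.
  by apply: ereal_inf_lbound; exists n => //=; rewrite EFin_Rint.
have gi : intble g.
  apply/integrableP; split; first exact/measurable_EFinP.
  exact: le_lt_trans le1 (ltry _).
split => //; rewrite -lee_fin EFin_Rint//; apply: le_trans le1.
rewrite le_eqVlt; apply/orP; left; apply/eqP; apply: ae_eq_integral => //.
- exact/measurable_EFinP.
- by apply: measurableT_comp => //; exact/measurable_EFinP.
- by apply: filterS g0 => x gx0 _; rewrite /= ger0_norm.
Qed.

(** Riesz-Fischer. Along a subsequence the increments [dd k] have squared norm at most 8^-k, so the
    sum of 4^k dd_k^2 is integrable. Where it is finite the increments are O(2^-k) and the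
    subsequence converges. Fatou's lemma then carries the Cauchy bounds of the whole sequence to the
    limit. *)
Lemma sqint_complete (f : nat -> T -> R) : (forall n, sqint (f n)) ->
  (forall e, 0 < e -> exists N, forall n m, (N <= n)%N -> (N <= m)%N ->
     I (fun x => (f n x - f m x) ^+ 2) <= e) ->
  exists2 g, sqint g & forall e, 0 < e -> exists N, forall n, (N <= n)%N ->
     I (fun x => (f n x - g x) ^+ 2) <= e.
Proof.
move=> f2 cf.
have /choice[N HN] k : exists N, forall n m, (N <= n)%N -> (N <= m)%N ->
    I (fun x => (f n x - f m x) ^+ 2) <= (8^-1) ^+ k.
  by apply: cf; rewrite exprn_gt0.
(* Summing the [(N j).+1] makes [s] strictly increasing while keeping [N k <= s k]. *)
pose s k := (\sum_(j < k.+1) (N j).+1)%N.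
have sN k : (N k <= s k)%N by rewrite /s big_ord_recr/= addnS ltnW// ltnS leq_addl.
have sS k : (s k < s k.+1)%N.
  by rewrite /s [ltnRHS]big_ord_recr/= addnS ltnS leq_addr.
have sk k : (k <= s k)%N by elim: k => // k IH; exact: leq_ltn_trans IH (sS k).
have snd : {homo s : i j / (i <= j)%N}.
  move=> i j; elim: j => [|j IH]; first by rewrite leqn0 => /eqP ->.
  rewrite leq_eqVlt => /predU1P[->//|/IH/leq_trans]; apply; exact/ltnW/sS.
pose dd k x := f (s k.+1) x - f (s k) x.
have dd2 k : sqint (dd k) by apply: sqintB; exact: f2.
have ddi k : I (fun x => dd k x ^+ 2) <= 8^-1 ^+ k.
  by apply: HN => //; apply: leq_trans (sN k) _; rewrite ltnW.
pose H x := (\sum_(k <oo) (4 ^+ k * dd k x ^+ 2)%:E)%E.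
have Hi : mu.-integrable setT H.
  have m1 k : measurable_fun setT (fun x => (4 ^+ k * dd k x ^+ 2)%:E).
    by apply/measurable_EFinP; apply: measurable_funM => //; exact: measurable_funX (dd2 k).1.
  have p1 k x : setT x -> (0 <= (4 ^+ k * dd k x ^+ 2)%:E)%E.
    by move=> _; rewrite lee_fin; apply: mulr_ge0; [exact: exprn_ge0|exact: sqr_ge0].
  apply/integrableP; split.
    apply: ge0_emeasurable_sum => // k x _ _; exact: p1.
  have H0 x : (0 <= H x)%E by apply: nneseries_ge0 => n _ _; exact: p1.
  rewrite (eq_integral H); last by move=> x _; rewrite gee0_abs.
  rewrite integral_nneseries//.
  apply: (@le_lt_trans _ _ 2%:E); last exact: ltry.
  apply: lime_le; first by apply: is_cvg_nneseries => n _ _; apply: integral_ge0 => x; exact: p1.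
  apply: nearW => n; rewrite (eq_bigr (fun k => (I (fun x => 4 ^+ k * dd k x ^+ 2))%:E)); last first.
    by move=> k _; rewrite EFin_Rint//; apply: intbleZ; exact: (dd2 k).2.
  rewrite sumEFin lee_fin.
  have : \sum_(0 <= k < n) (2^-1) ^+ k + 2 * (2^-1) ^+ n = 2 :> R.
    elim: n => [|n IH]; first by rewrite big_geq// add0r expr0 mulr1.
    by rewrite big_nat_recr//= -[RHS]IH exprS; field.
  have p2 : 0 <= 2 * 2^-1 ^+ n :> R by rewrite mulr_ge0// exprn_ge0.
  move=> <-; rewrite -[leLHS]addr0 lerD//.
  apply: ler_sum => k _; rewrite RintZ; last exact: (dd2 k).2.
  apply: (le_trans (ler_wpM2l _ (ddi k))); first exact: exprn_ge0.
  by rewrite -exprMn; apply: lerXn2r; rewrite ?nnegrE//; lra.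
have aeH : {ae mu, forall x, H x \is a fin_num}.
  by apply: filterS (integrable_ae measurableT Hi) => x; exact.
(* The upper limit is measurable on the whole space and is the limit wherever the subsequence
   converges. *)
pose F x := limn_esup (fun k => (f (s k) x)%:E).
pose g x := fine (F x).
have mg : measurable_fun setT g.
  apply: (measurableT_comp (fine_measurable measurableT)).
  by apply: measurable_fun_limn_esup => k; apply/measurable_EFinP; exact: (f2 _).1.
have cvgf : {ae mu, forall x, f (s k) x @[k --> \oo] --> g x}.
  apply: filterS aeH => x Hx.
  suff : cvgn (fun k => f (s k) x).
    move=> /cvg_ex[/= l fl]; suff -> : g x = l by [].
    have fl' : (fun k => (f (s k) x)%:E) @ \oo --> l%:E by apply: cvg_EFin => //; exact: nearW.
    by rewrite /g /F is_cvg_limn_esupE ?(cvg_lim _ fl')//; exact: cvgP fl'.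
  have -> : (fun k => f (s k) x) = (fun k => f (s 0%N) x + series (telescope (fun k => f (s k) x)) k).
    by apply/funext => k; exact: eq_sum_telescope.
  apply: is_cvgD; first exact: is_cvg_cst.
  apply: normed_cvg.
  set h := fine (H x).
  have hk k : 4 ^+ k * dd k x ^+ 2 <= h.
    rewrite -lee_fin fineK//; have := @nneseries_lim_ge R (fun k => (4 ^+ k * dd k x ^+ 2)%:E) xpredT 0 k.+1.
    move=> /(_ _)/(le_trans _); apply; last first.
      by move=> n _ _; rewrite lee_fin; apply: mulr_ge0; [exact: exprn_ge0|exact: sqr_ge0].
    rewrite sumEFin lee_fin big_nat_recr//= lerDr sumr_ge0// => i _.
    by apply: mulr_ge0; [exact: exprn_ge0|exact: sqr_ge0].
  have h0 : 0 <= h by apply: le_trans (hk 0%N); apply: mulr_ge0; [exact: exprn_ge0|exact: sqr_ge0].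
  apply: (@series_le_cvg _ _ (geometric (Num.sqrt h) 2^-1)).
  - by move=> n; exact: normr_ge0.
  - by move=> n; rewrite /geometric/= mulr_ge0// ?sqrtr_ge0// exprn_ge0.
  - move=> n; rewrite /telescope/= /geometric/= -/(dd n x) -sqrtr_sqr.
    rewrite -[2^-1 ^+ n]ger0_norm ?exprn_ge0// -sqrtr_sqr -sqrtrM// ler_wsqrtr//.
    have -> : (2^-1 : R) ^+ n ^+ 2 = (4 ^+ n)^-1.
      by rewrite -exprM mulnC exprM -exprVn; congr (_ ^+ _); field.
    by rewrite ler_pdivlMr ?exprn_gt0// mulrC.
  by apply: is_cvg_geometric_series; rewrite ger0_norm//; lra.
have fg2 e n M : (forall m, (M <= m)%N -> I (fun x => (f n x - f m x) ^+ 2) <= e) ->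
    sqint (fun x => f n x - g x) /\ I (fun x => (f n x - g x) ^+ 2) <= e.
  move=> He; have mfg : measurable_fun setT (fun x => f n x - g x).
    by apply: measurable_funB => //; exact: (f2 n).1.
  have [|||||gi Ig] := @fatou_Rint (fun k x => (f n x - f (s (k + M)%N) x) ^+ 2)
      (fun x => (f n x - g x) ^+ 2) e.
  - by move=> k; exact: (sqintB (f2 _) (f2 _)).2.
  - by move=> k x; exact: sqr_ge0.
  - exact: measurable_funX.
  - apply: filterS cvgf => x fx.
    apply: (@cvgM _ _ _ _ (fun k => f n x - f (s (k + M)%N) x) (fun k => f n x - f (s (k + M)%N) x)).
      by apply: cvgB; [exact: cvg_cst|rewrite (cvg_shiftn M (fun k => f (s k) x))].
    by apply: cvgB; [exact: cvg_cst|rewrite (cvg_shiftn M (fun k => f (s k) x))].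
  - by move=> k; apply: He; rewrite (leq_trans _ (sk _))// leq_addl.
  by split.
exists g.
  have [N0 HN0] := cf 1 ltr01.
  have [h _] := @fg2 1 N0 N0 (fun m => HN0 _ _ (leqnn _)).
  have := sqintB (f2 N0) h; under eq_fun do rewrite opprB addrC subrK; exact.
move=> e e0; have [N0 HN0] := cf e e0; exists N0 => n nN.
by have [] := @fg2 e n N0 (fun m => HN0 _ _ nN).
Qed.

End Integral.

(** * Smooth functions on the plane *)

Section Smooth1.
Variable R : realType.
Implicit Types (f g p : R -> R) (x : R).

Lemma scaleRE (a b : R) : a *: (b : R^o) = a * b. Proof. by []. Qed.

Definition flat (k : nat) (x : R) : R :=
  if 0 < x then x ^- k * expR (- x^-1) else 0.

(* Closed under differentiation, since [flat k] has derivative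
   [- k flat k.+1 + flat k.+2]. *)
Inductive smooth1 : (R -> R) -> Prop :=
| smooth1_flat k : smooth1 (flat k)
| smooth1_cst c : smooth1 (fun=> c)
| smooth1D f g : smooth1 f -> smooth1 g -> smooth1 (fun x => f x + g x)
| smooth1M f g : smooth1 f -> smooth1 g -> smooth1 (fun x => f x * g x)
| smooth1_affine a b f : smooth1 f -> smooth1 (fun x => f (a * x + b)).

(** As e^(1/x) dominates x^-(k+2) / (k+2)!, [flat k] is quadratically small at 0, which gives it the
    derivative 0 there. *)
Lemma flat_le (k : nat) : exists2 C, 0 <= C & forall x, 0 < x -> flat k x <= C * x ^+ 2.
Proof.
exists (k.+2)`!%:R; first exact: ler0n.
move=> x x0; rewrite /flat x0.
have xi : 0 <= x^-1 by rewrite invr_ge0 ltW.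
have h : x ^- k.+2 / (k.+2)`!%:R <= expR x^-1.
  by apply: le_trans (expR_ge1Dxn k.+1 xi); rewrite exprVn lerDr.
move: h; rewrite ler_pdivrMr ?ltr0n ?fact_gt0// => h.
rewrite expRN ler_pdivrMr ?expR_gt0//.
have -> : x ^- k = x ^- k.+2 * x ^+ 2.
  by rewrite -addn2 exprD invfM mulfVK// expf_neq0// gt_eqF.
apply: (le_trans (ler_wpM2r (sqr_ge0 x) h)).
by rewrite le_eqVlt; apply/orP; left; apply/eqP; ring.
Qed.

(** Reads a derivative off a Taylor remainder. It serves at the origin for [flat], and for
    differentiation under the integral sign without a limit theorem. *)
Lemma is_derive_quadratic (V : normedModType R) (f : V -> R) (x v : V) (l C : R) :
  (forall h : R, `|h| <= 1 -> `|f (h *: v + x) - f x - h * l| <= C * h ^+ 2) ->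
  is_derive x v f l.
Proof.
move=> H; have C0 : 0 <= C.
  have := H 1; rewrite normr1 lexx => /(_ isT); rewrite expr1n mulr1.
  exact: le_trans (normr_ge0 _).
suff L : h^-1 *: ((f \o shift x) (h *: v) - f x) @[h --> 0^'] --> l.
  by apply: DeriveDef; [exact: cvgP L|exact: cvg_lim L].
apply/cvgrPdist_le => e e0.
have d0 : 0 < Num.min 1 (e / (C + 1)) by rewrite lt_min ltr01 divr_gt0//; lra.
near=> h.
have h0 : h != 0 by near: h; exact: nbhs_dnbhs_neq.
have hd : `|h| < Num.min 1 (e / (C + 1)) by near: h; exact: dnbhs0_lt.
move: hd; rewrite lt_min => /andP[h1 he].
have -> : l - h^-1 *: ((f \o shift x) (h *: v) - f x) =
    - (h^-1 * (f (h *: v + x) - f x - h * l)).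
  by rewrite /= scaleRE; field.
rewrite normrN normrM normfV ler_pdivrMl ?normr_gt0//.
apply: le_trans (H h (ltW h1)) _.
rewrite -(real_normK (num_real h)) expr2 mulrA [leRHS]mulrC ler_wpM2r//.
by move: he; rewrite ltr_pdivlMr; [nra|lra].
Unshelve. all: by end_near. Qed.

Lemma is_derive_flat k x :
  is_derive x 1 (flat k) (- k%:R * flat k.+1 x + flat k.+2 x).
Proof.
have [x0|x0|->] := ltgtP x 0.
- have -> : - k%:R * flat k.+1 x + flat k.+2 x = 0.
    by rewrite /flat lt_gtF// mulr0 addr0.
  apply: (@near_eq_is_derive _ _ _ (cst 0 : R -> R)).
  near=> y; have y0 : y < 0 by near: y; exact: lt_nbhsl.
  by rewrite /flat lt_gtF.
- apply: (@near_eq_is_derive _ _ _ ((fun y => y^-1 ^+ k * expR (- y^-1)) : R -> R)).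
    near=> y; have y0 : 0 < y by near: y; exact: lt_nbhsr.
    by rewrite /flat y0 exprVn.
  have dV : is_derive x 1 (fun y : R => y^-1) (- x ^- 2).
    apply: is_derive_eq; first by apply: is_deriveV; rewrite gt_eqF.
    by rewrite scaler1.
  have dE : is_derive x 1 (fun y : R => expR (- y^-1)) (expR (- x^-1) * x ^- 2).
    apply: (@is_derive1_comp _ expR (fun y => - y^-1)).
    by rewrite -[X in is_derive _ _ _ X]opprK; exact: is_deriveN.
  have dX : is_derive x 1 ((fun y : R => y^-1) ^+ k) (- k%:R * x ^- k.+1).
    apply: is_derive_eq.
    case: k => [|k]; first by rewrite !mul0r oppr0 mul0r scale0r.
    rewrite /= scaleRE exprVn !exprS; field.
    by rewrite expf_neq0 gt_eqF.
  have := is_deriveM dX dE.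
  rewrite (_ : (fun y : R => y^-1) ^+ k * _ = (fun y => y^-1 ^+ k * expR (- y^-1))); last first.
    by rewrite exprfctE.
  move/is_derive_eq; apply.
  rewrite /flat x0 !scaleRE exprfctE !exprS exprVn; field.
  by rewrite expf_neq0 gt_eqF.
- have -> : - k%:R * flat k.+1 0 + flat k.+2 0 = 0 by rewrite /flat ltxx mulr0 addr0.
  have [C C0 HC] := flat_le k.
  apply: (@is_derive_quadratic _ _ _ _ _ C) => h _.
  rewrite addr0 [flat k 0]/flat ltxx !subr0 mulr0 subr0 scaleRE mulr1.
  have [h0|h0] := ltP 0 h; last by rewrite /flat ltNge h0 normr0 mulr_ge0// sqr_ge0.
  rewrite ger0_norm ?HC// /flat h0 mulr_ge0 ?expR_ge0// invr_ge0 exprn_ge0// ltW.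
Unshelve. all: by end_near. Qed.

Lemma smooth1_derive f : smooth1 f ->
  exists2 f', smooth1 f' & forall x, is_derive x 1 f (f' x).
Proof.
elim=> {f} [k|c|f g _ [f' sf' df] _ [g' sg' dg]|f g sf [f' sf' df] sg [g' sg' dg]|a b f sf [f' sf' df]].
- exists (fun x => - k%:R * flat k.+1 x + flat k.+2 x); last exact: is_derive_flat.
  by apply: smooth1D; [apply: smooth1M; [exact: smooth1_cst|]|]; exact: smooth1_flat.
- by exists (fun=> 0); [exact: smooth1_cst|move=> x; exact: is_derive_cst].
- by exists (fun x => f' x + g' x); [exact: smooth1D|move=> x; exact: is_deriveD].
- exists (fun x => f x * g' x + g x * f' x).
    by apply: smooth1D; exact: smooth1M.
  by move=> x; exact: is_deriveM.
- exists (fun x => f' (a * x + b) * a).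
    by apply: smooth1M; [exact: smooth1_affine|exact: smooth1_cst].
  move=> x; apply: (@is_derive1_comp _ f (fun x => a * x + b)).
  rewrite -[X in is_derive _ _ _ X]addr0 -[X in is_derive _ _ _ (X + _)]mulr1.
  apply: is_deriveD.
Qed.

End Smooth1.

Section Smooth2.
Variable R : realType.
Local Notation plane := (R * R)%type.
Local Notation e := (basis_dir R).
Implicit Types (f g : plane -> R) (x v : plane).

Lemma basis_dirE (i : 'I_2) : e i = ((i == 0)%:R, (i != 0)%:R).
Proof. by rewrite /basis_dir; case: (i == 0). Qed.

Lemma is_derive_slice f x v (t l : R) : is_derive (x + t *: v) v f l ->
  is_derive t 1 (fun s => f (x + s *: v)) l.
Proof.
have E : (fun h => h^-1 *: (((fun s => f (x + s *: v)) \o shift t) (h *: 1) - f (x + t *: v)))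
    = (fun h => h^-1 *: ((f \o shift (x + t *: v)) (h *: v) - f (x + t *: v))).
  apply/funext => h /=; congr (_ *: (f _ - _)).
  by rewrite scaleRE mulr1 scalerDl addrCA.
move=> [h1 h2]; apply: DeriveDef; first by rewrite /derivable E.
by rewrite /derive E.
Qed.

Lemma slice_is_derive f x v (l : R) : is_derive (0 : R) 1 (fun s : R => f (x + s *: v)) l ->
  is_derive x v f l.
Proof.
have E : (fun h => h^-1 *: (((fun s => f (x + s *: v)) \o shift 0) (h *: 1) - f (x + 0 *: v)))
    = (fun h => h^-1 *: ((f \o shift x) (h *: v) - f x)).
  apply/funext => h /=; rewrite scale0r !addr0 scaler1.
  by rewrite (addrC x).
move=> [h1 h2]; apply: DeriveDef; first by move: h1; rewrite /derivable E.
by move: h2; rewrite /derive E.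
Qed.

(** [smooth] quantifies over all iterated partial derivatives, so its stability under products or
    affine maps would need a Leibniz formula for words. This class has the closure properties built
    in and is stable under one partial derivative, hence under all of them; [smooth2P] shows that it
    is the same class. *)
Inductive smooth2 : (plane -> R) -> Prop :=
| smooth2_tensor p q : smooth1 p -> smooth1 q -> smooth2 (fun x => p x.1 * q x.2)
| smooth2_base f : smooth f -> smooth2 f
| smooth2D f g : smooth2 f -> smooth2 g -> smooth2 (fun x => f x + g x)
| smooth2M f g : smooth2 f -> smooth2 g -> smooth2 (fun x => f x * g x)
| smooth2_affine a b f : smooth2 f -> smooth2 (fun x => f (a *: x + b)).

Lemma smooth2_cst c : smooth2 (fun=> c).
Proof.
by have /= := smooth2_tensor (smooth1_cst c) (smooth1_cst 1); rewrite mulr1.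
Qed.

Lemma smooth1_continuous p : smooth1 p -> continuous (p : R -> R).
Proof.
move=> /smooth1_derive[p' _ dp] x; apply/differentiable_continuous.
by apply/derivable1_diffP; have [] := dp x.
Qed.

Lemma smooth2_continuous f : smooth2 f -> continuous f.
Proof.
elim=> {f} [p q sp sq|f sf|f g _ cf _ cg|f g _ cf _ cg|a b f _ cf] x.
- apply: cvgM.
    by apply: (@cvg_comp _ _ _ _ p); [exact: cvg_fst|exact: smooth1_continuous].
  by apply: (@cvg_comp _ _ _ _ q); [exact: cvg_snd|exact: smooth1_continuous].
- by have [] := sf [::].
- by apply: cvgD; [exact: cf|exact: cg].
- by apply: cvgM; [exact: cf|exact: cg].
- apply: (@cvg_comp _ _ _ (fun x : plane => a *: x + b) f); last exact: cf.
  by apply: cvgD; [apply: cvgZr; exact: cvg_id|exact: cvg_cst].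
Qed.

Lemma smooth_partial f i : smooth f -> smooth (partial i f).
Proof.
move=> sf w; have := sf (rcons w i); rewrite -cats1 foldr_cat/=; exact.
Qed.

Lemma smooth2_derive i f : smooth2 f ->
  exists2 f', smooth2 f' & forall x, is_derive x (e i) f (f' x).
Proof.
elim=> {f} [p q sp sq|f sf|f g sf [f' sf' df] sg [g' sg' dg]
           |f g sf [f' sf' df] sg [g' sg' dg]|a b f sf [f' sf' df]].
- have [p' sp' dp] := smooth1_derive sp; have [q' sq' dq] := smooth1_derive sq.
  pose c : R := (i == 0)%:R; pose d : R := (i != 0)%:R.
  have comp1 (r r' : R -> R) (y a : R) : (forall z : R, is_derive z 1 r (r' z)) ->
      is_derive (0 : R) 1 (fun s => r (y + s * a)) (r' y * a).
    move=> dr; have -> : (fun s => r (y + s * a)) = r \o (fun s => a * s + y).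
      by apply/funext => s /=; rewrite addrC mulrC.
    apply: is_derive1_comp; first by rewrite mulr0 add0r.
    rewrite -[X in is_derive _ _ _ X]addr0 -[X in is_derive _ _ _ (X + _)]mulr1.
    exact: is_deriveD.
  exists (fun x => p x.1 * q' x.2 * (fun=> d) x + p' x.1 * q x.2 * (fun=> c) x).
    by apply: smooth2D; apply: smooth2M; (exact: smooth2_tensor || exact: smooth2_cst).
  move=> x; apply: slice_is_derive; rewrite basis_dirE -/c -/d.
  have := is_deriveM (comp1 _ _ x.1 c dp) (comp1 _ _ x.2 d dq).
  move/is_derive_eq; apply; rewrite !scaleRE !mul0r !addr0; ring.
- exists (partial i f); first exact/smooth2_base/smooth_partial.
  by move=> x; apply: derivableP; have [_] := sf [::]; exact.
- by exists (fun x => f' x + g' x); [exact: smooth2D|move=> x; exact: is_deriveD].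
- exists (fun x => f x * g' x + g x * f' x).
    by apply: smooth2D; exact: smooth2M.
  by move=> x; exact: is_deriveM.
- exists (fun x => f' (a *: x + b) * a).
    by apply: smooth2M; [exact: smooth2_affine|exact: smooth2_cst].
  move=> x; apply: slice_is_derive.
  have -> : (fun s : R => f (a *: (x + s *: e i) + b)) =
      (fun s => f ((a *: x + b) + s *: e i)) \o (fun s => a * s + 0).
    apply/funext => s /=; congr f.
    by rewrite addr0 scalerDr scalerA addrAC.
  apply: is_derive1_comp.
    by apply: is_derive_slice; rewrite mulr0 addr0 scale0r addr0.
  rewrite -[X in is_derive _ _ _ X]addr0 -[X in is_derive _ _ _ (X + _)]mulr1.
  exact: is_deriveD.
Qed.

Lemma smooth2P f : smooth2 f <-> smooth f.
Proof.
split; last exact: smooth2_base.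
move=> sf w /=; suff sw : smooth2 (foldr (@partial R) f w).
  split; first exact: smooth2_continuous.
  by move=> i x; have [f' _ /(_ x) []] := smooth2_derive i sw.
elim: w => //= i w /(smooth2_derive i)[f' sf' df].
rewrite (_ : partial i _ = f')//; apply/funext => x.
by have [_ <-] := df x.
Qed.

End Smooth2.

(** * Test functions *)

Section ContinuousMeasurable.
Variable R : realType.
Local Notation plane := (measurableTypeR R * measurableTypeR R)%type.

(** The sigma-algebra of the plane is the product one, not generated by open sets by definition. An
    open set is the countable union of the boxes with rational centre and radius 1/(n+1) that it
    contains. *)
Lemma open_plane_measurable (A : set (R * R)) : open A -> measurable (A : set plane).
Proof.
move=> oA.
pose box (q1 q2 : rat) (n : nat) : set (R * R) :=
  [set z | `|z.1 - ratr q1| < n.+1%:R^-1] `&` [set z | `|z.2 - ratr q2| < n.+1%:R^-1].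
pose B q1 q2 n : set (R * R) := if `[< box q1 q2 n `<=` A >] then box q1 q2 n else set0.
have -> : A = \bigcup_q1 \bigcup_q2 \bigcup_n B q1 q2 n.
  apply/seteqP; split; last first.
    by move=> z [q1 _] [q2 _] [n _]; rewrite /B; case: asboolP => // + /[dup] _; apply.
  move=> z Az; move: oA; rewrite openE => /(_ _ Az)/nbhs_ballP[e /= e0 eA].
  have [n ne] : exists n : nat, n.+1%:R^-1 < e / 2 :> R.
    have e2 : 0 < e / 2 by rewrite divr_gt0.
    by have [n _ /(_ n (leqnn _))] := near_infty_natSinv_lt (PosNum e2); exists n.
  have n0 : 0 < n.+1%:R^-1 :> R by rewrite invr_gt0.
  have app (t : R) : exists q : rat, `|t - ratr q| < n.+1%:R^-1.
    have /dense_rat : [set` `]t - n.+1%:R^-1, t + n.+1%:R^-1[] !=set0.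
      by exists t; rewrite /= in_itv/= ltrDl ltrBlDr ltrDl n0.
    move=> h.
    have /h : open [set` `]t - n.+1%:R^-1, t + n.+1%:R^-1[] by exact: interval_open.
    move=> [y [/= yI [q _ qy]]]; move: yI.
    by rewrite in_itv/= -qy => qt; exists q; rewrite distrC ltr_distl.
  have [q1 h1] := app z.1; have [q2 h2] := app z.2.
  exists q1 => //; exists q2 => //; exists n => //.
  rewrite /B; case: asboolP => //; case=> y [/= y1 y2]; apply: eA.
  move: ne h1 h2 y1 y2; move: (n.+1%:R^-1) => r ne; rewrite !ltr_norml => /andP[? ?] /andP[? ?] /andP[? ?] /andP[? ?].
  rewrite -ball_normE /= prod_normE/= gt_max !ltr_norml.
  by apply/and3P; split; [apply/andP; split| |]; lra.
apply: bigcupT_measurable_rat => q1; apply: bigcupT_measurable_rat => q2.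
apply: bigcupT_measurable => n; rewrite /B; case: asboolP => // _.
have mh (h : plane -> R) c : measurable_fun setT h -> measurable [set z | h z < c].
  move=> mh; rewrite (_ : [set _ | _] = setT `&` h @^-1` [set` `]-oo, c[]).
    by apply: mh.
  by rewrite setTI; apply/seteqP; split => z /=; rewrite in_itv.
apply: measurableI; apply: mh; apply: measurableT_comp => //; apply: measurable_funB => //.
Qed.

Lemma continuous_plane_measurable (f : R * R -> R) : continuous f ->
  measurable_fun setT (f : plane -> R).
Proof.
move=> cf; apply: (measurability _ (RGenOInfty.measurableE R)).
move=> /= _ [_ [a ->]] <-; apply: measurableI => //; apply: open_plane_measurable.
by apply: open_comp => [x _|]; [exact: cf|exact: interval_open].
Qed.

End ContinuousMeasurable.

Section TestFunctions.
Variable R : realType.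
Local Notation plane := (R * R)%type.
Local Notation e := (basis_dir R).
Implicit Types (f g : plane -> R) (x : plane).

Definition bsupp f := exists M : R, forall x, f x != 0 -> `|x| <= M.
Definition testf f := smooth2 f /\ bsupp f.

Lemma test_functionP f : test_function f <-> testf f.
Proof.
split=> [[sf [K cK fK]]|[/smooth2P sf [M fM]]].
  split; first exact/smooth2P.
  have [M [_ KM]] := compact_bounded cK; exists (M + 1) => x fx0.
  by apply: KM; [rewrite ltrDl|apply: contrapT => nKx; rewrite fK ?eqxx in fx0].
split => //; exists ([set` `[- M, M]] `*` [set` `[- M, M]]).
  by apply: compact_setX; exact: segment_compact.
move=> x nKx; apply/eqP; apply: contrapT => /negP /fM.
rewrite prod_normE ge_max => /andP[x1 x2]; apply: nKx.
by split; rewrite /= in_itv/= -ler_norml.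
Qed.

Lemma partial_derive i f x : smooth2 f -> is_derive x (e i) f (partial i f x).
Proof. by move=> /smooth2P /(_ [::])[_ df]; apply: derivableP; exact: df. Qed.

Lemma partial_val i f (g : plane -> R) : (forall x, is_derive x (e i) f (g x)) -> partial i f = g.
Proof. by move=> dfg; apply/funext => x; have [_ <-] := dfg x. Qed.

Lemma smooth2_partial i f : smooth2 f -> smooth2 (partial i f).
Proof. by move=> /smooth2P sf; apply/smooth2P/smooth_partial. Qed.

Lemma partialD i f g : smooth2 f -> smooth2 g ->
  partial i (fun x => f x + g x) = (fun x => partial i f x + partial i g x).
Proof.
by move=> sf sg; apply: partial_val => x; apply: is_deriveD; exact: partial_derive.
Qed.

Lemma partialM i f g : smooth2 f -> smooth2 g ->
  partial i (fun x => f x * g x) = (fun x => f x * partial i g x + g x * partial i f x).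
Proof.
by move=> sf sg; apply: partial_val => x; apply: is_deriveM; exact: partial_derive.
Qed.

Lemma partialZ i (c : R) f : smooth2 f ->
  partial i (fun x => c * f x) = (fun x => c * partial i f x).
Proof.
by move=> sf; apply: partial_val => x; apply: (is_deriveZ c (partial_derive i x sf)).
Qed.

Lemma partial_affine i (a : R) b f : smooth2 f ->
  partial i (fun x => f (a *: x + b)) = (fun x => a * partial i f (a *: x + b)).
Proof.
move=> sf; apply: partial_val => x; apply: slice_is_derive.
have -> : (fun s : R => f (a *: (x + s *: e i) + b)) =
    (fun s => f ((a *: x + b) + s *: e i)) \o (fun s => a * s + 0).
  apply/funext => s /=; congr f.
  by rewrite addr0 scalerDr scalerA addrAC.
rewrite mulrC; apply: is_derive1_comp.
  by apply: is_derive_slice; rewrite mulr0 addr0 scale0r addr0; exact: partial_derive.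
rewrite -[X in is_derive _ _ _ X]addr0 -[X in is_derive _ _ _ (X + _)]mulr1.
exact: is_deriveD.
Qed.

Lemma partial_bsupp i f (M : R) : (forall x, f x != 0 -> `|x| <= M) ->
  forall x, partial i f x != 0 -> `|x| <= M.
Proof.
move=> fM x; apply: contraNT; rewrite -ltNge => Mx.
have : is_derive x (e i) f 0.
  apply: (@near_eq_is_derive _ _ _ (cst 0 : plane -> R)).
  have : \forall y \near x, M < `|y|.
    by apply: (@cvgr_gt _ _ (nbhs x) _ (fun y : plane => `|y|) `|x|) => //; exact: norm_continuous.
  apply: filterS => y My; apply/esym/eqP; apply: contraTT My => /fM.
  by rewrite -leNgt.
by case=> _; rewrite /partial => ->.
Qed.

Lemma testfD f g : testf f -> testf g -> testf (fun x => f x + g x).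
Proof.
move=> [sf [M fM]] [sg [N gN]]; split; first exact: smooth2D.
exists (Num.max M N) => x fgx; rewrite le_max.
have [/fM -> //|/negPn/eqP f0] := boolP (f x != 0).
by rewrite gN ?orbT//; move: fgx; rewrite f0 add0r.
Qed.

Lemma testfMl f g : smooth2 f -> testf g -> testf (fun x => f x * g x).
Proof.
move=> sf [sg [N gN]]; split; first exact: smooth2M.
by exists N => x; rewrite mulf_eq0 negb_or => /andP[_ /gN].
Qed.

Lemma testfZ (c : R) f : testf f -> testf (fun x => c * f x).
Proof. by move=> tf; apply: (@testfMl (fun=> c)) => //; exact: smooth2_cst. Qed.

Lemma testfN f : testf f -> testf (fun x => - f x).
Proof. by move=> /(testfZ (-1)); under eq_fun do rewrite mulN1r. Qed.

Lemma testfB f g : testf f -> testf g -> testf (fun x => f x - g x).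
Proof. by move=> tf tg; apply: testfD => //; exact: testfN. Qed.

Lemma testf0 : testf (fun=> 0).
Proof. by split; [exact: smooth2_cst|exists 0 => x; rewrite eqxx]. Qed.

Lemma testf_partial i f : testf f -> testf (partial i f).
Proof.
move=> [sf [M fM]]; split; first exact: smooth2_partial.
by exists M; exact: partial_bsupp.
Qed.

Lemma testf_affine (a : R) b f : a != 0 -> testf f -> testf (fun x => f (a *: x + b)).
Proof.
move=> a0 [sf [M fM]]; split; first exact: smooth2_affine.
exists ((M + `|b|) / `|a|) => x /fM h; rewrite ler_pdivlMr ?normr_gt0// mulrC -normrZ.
rewrite -[X in `|X|](addrK b) (le_trans (ler_normB _ _))//.
by rewrite lerD2r.
Qed.

Lemma testf_shift b f : testf f -> testf (fun x => f (x + b)).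
Proof.
by move=> /(testf_affine b (oner_neq0 R)); under eq_fun do rewrite scale1r.
Qed.

Definition ccf f := continuous f /\ bsupp f.

Lemma testf_ccf f : testf f -> ccf f.
Proof. by move=> [sf bf]; split => //; exact: smooth2_continuous. Qed.

Lemma ccf_norm f : ccf f -> ccf (fun x => `|f x|).
Proof.
move=> [cf [M fM]]; split; last by exists M => x; rewrite normr_eq0; exact: fM.
by move=> x; apply: cvg_norm; exact: cf.
Qed.

Definition box (M : R) : set plane := [set` `[- M, M]%R] `*` [set` `[- M, M]%R].

Lemma boxP (M : R) x : box M x <-> `|x| <= M.
Proof.
rewrite prod_normE ge_max !ler_norml /box /= !in_itv/=.
by split => [[-> ->]|/andP].
Qed.

Lemma box_measurable (M : R) :
  measurable (box M : set (measurableTypeR R * measurableTypeR R)).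
Proof. by apply: measurableX; exact: measurable_itv. Qed.

Lemma intble_indic_box (M : R) : intble (leb2 R) \1_(box M).
Proof.
have mB := box_measurable M.
apply/integrableP; split; first by apply/measurable_EFinP; exact: measurable_indic.
under eq_integral do rewrite /= ger0_norm//.
rewrite integral_indic// setIT /leb2 [X in (X < _)%E]product_measure1E; try exact: measurable_itv.
rewrite [X in (X * _)%E]lebesgue_measure_itv [X in (_ * X)%E]lebesgue_measure_itv /=.
by case: ifP => _; rewrite ?mul0e ?ltry// -EFinD -EFinM ltry.
Qed.

Lemma ccf_bounded f : ccf f -> exists C M : R, 0 <= C /\ forall x, `|f x| <= C * \1_(box M) x.
Proof.
move=> [cf [M fM]].
have cK : compact (box M) by apply: compact_setX; exact: segment_compact.
have [N [_ KN]] := compact_bounded (continuous_compact (continuous_subspaceT cf) cK).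
exists (`|N| + 1), M; split; first by rewrite addr_ge0.
move=> x; have [/fM Mx|/negPn/eqP ->] := boolP (f x != 0); last first.
  by rewrite normr0 mulr_ge0// addr_ge0.
rewrite indicE mem_set ?mulr1//; last exact/boxP.
apply: KN; first by rewrite (le_lt_trans (ler_norm _))// ltrDl.
by exists x => //; exact/boxP.
Qed.

Lemma ccf_intble f : ccf f -> intble (leb2 R) f.
Proof.
move=> /[dup] /ccf_bounded [C [M [C0 fC]]] [cf _].
apply: (@intble_le _ _ R (leb2 R) f (fun x => C * \1_(box M) x)) => //.
- exact: continuous_plane_measurable.
- by apply: intbleZ; exact: intble_indic_box.
Qed.

Lemma testf_intble f : testf f -> intble (leb2 R) f.
Proof. by move=> /testf_ccf/ccf_intble. Qed.

Lemma testf_sqint f : testf f -> sqint (leb2 R) f.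
Proof.
move=> tf; split; first exact: intble_meas (testf_intble tf).
under eq_fun do rewrite expr2.
by apply: testf_intble; apply: testfMl => //; case: tf.
Qed.

Local Notation leb := (@lebesgue_measure R).

Lemma intble1_csupp (h : R -> R) (M : R) : continuous h ->
  (forall t, h t != 0 -> `|t| <= M) -> intble leb h.
Proof.
move=> ch hM; pose B := [set` `[- M, M]%R].
have mB : measurable (B : set (measurableTypeR R)) by exact: measurable_itv.
have [N [_ KN]] := compact_bounded (continuous_compact (continuous_subspaceT ch) (@segment_compact R (- M) M)).
apply: (@intble_le _ (measurableTypeR R) R leb h (fun x : R => (`|N| + 1) * \1_B x)).
- exact: continuous_measurable_fun.
- by apply: intbleZ; exact: integrable_indic_itv.
move=> t; have [/hM Mt|/negPn/eqP ->] := boolP (h t != 0); last first.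
  by rewrite normr0 mulr_ge0// addr_ge0.
have Bt : B t by rewrite /B/= in_itv/= -ler_norml.
rewrite indicE mem_set// mulr1.
by apply: KN; [rewrite (le_lt_trans (ler_norm _))// ltrDl|exists t].
Qed.

Section ftc_csupp.
Variables (h h' : R -> R) (M : R).
Hypothesis dh : forall t : R, is_derive t 1 h (h' t).
Hypothesis ch' : continuous h'.
Hypothesis hM : forall t, h t != 0 -> `|t| <= M.

Let ch : continuous h.
Proof.
move=> t; apply/differentiable_continuous.
by apply/derivable1_diffP; have [] := dh t.
Qed.

Lemma ftc_itv a b : a < b -> \int[leb]_(t in `[a, b]) h' t = h b - h a.
Proof.
move=> ab; rewrite /Rintegral (@continuous_FTC2 R h' h)//.
- exact: continuous_subspaceT.
- split; first by move=> t _; have [] := dh t.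
  + by apply: cvg_at_right_filter; exact: ch.
  + by apply: cvg_at_left_filter; exact: ch.
- by move=> t _; rewrite derive1E; have [_ ->] := dh t.
Qed.

Lemma derive_csupp t : h' t != 0 -> `|t| <= M.
Proof.
apply: contraNT; rewrite -ltNge => Mt.
have : is_derive t 1 h 0.
  apply: (@near_eq_is_derive _ _ _ (cst 0 : R -> R)).
  have : \forall y \near t, M < `|y|.
    by apply: (@cvgr_gt _ _ (nbhs t) _ (fun y : R => `|y|) `|t|) => //; exact: norm_continuous.
  apply: filterS => y My; apply/esym/eqP; apply: contraTT My => /hM.
  by rewrite -leNgt.
by case=> _; case: (dh t) => _ -> ->.
Qed.

Lemma derive_intble : intble leb h'.
Proof. by apply: (@intble1_csupp _ M) => // t; exact: derive_csupp. Qed.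

Lemma Rintegral_itvE (g : R -> R) a b : \int[leb]_(t in `[a, b]) g t = \int[leb]_t (g t * \1_([set` `[a, b]]) t).
Proof.
rewrite Rintegral_mkcond; apply: eq_Rintegral => t _.
by rewrite patchE indicE; case: ifP => _; rewrite ?mulr1 ?mulr0.
Qed.

Lemma Rint_derive_csupp : \int[leb]_t h' t = 0.
Proof.
pose N := `|M| + 1.
have MN : M < N by rewrite (le_lt_trans (ler_norm _))// ltrDl.
have N0 : 0 < N by rewrite ltr_pwDr.
transitivity (\int[leb]_(t in `[- N, N]) h' t).
  rewrite Rintegral_itvE; apply: eq_Rintegral => t _; rewrite indicE.
  have [/derive_csupp tM|/negPn/eqP ->] := boolP (h' t != 0); last by rewrite mul0r.
  by rewrite mem_set ?mulr1//= in_itv/= -ler_norml (le_trans tM)// ltW.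
rewrite ftc_itv; last lra.
have hN s : M < `|s| -> h s = 0.
  by move=> Ms; apply/eqP; apply: contraTT Ms => /hM; rewrite -leNgt.
by rewrite !hN ?subrr// ?normrN gtr0_norm.
Qed.

Lemma norm_le_Rint_derive t : `|h t| <= \int[leb]_s `|h' s|.
Proof.
pose N : R := `|M| + `|t| + 1.
have MN : M < `|- N|.
  have := normr_ge0 M; have := normr_ge0 t; have := ler_norm M.
  by move=> ? ? ?; rewrite normrN ger0_norm /N; lra.
have Nt : - N < t by have := normr_ge0 M; have := ler_norm (- t); rewrite normrN /N; lra.
have hN : h (- N) = 0 by apply/eqP; apply: contraTT MN => /hM; rewrite -leNgt.
have -> : h t = \int[leb]_(s in `[- N, t]) h' s by rewrite ftc_itv// hN subr0.
rewrite Rintegral_itvE; apply: Rint_norm_le.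
- apply: (@intble_le _ (measurableTypeR R) R leb _ (fun s : R => `|h' s|)).
  + apply: measurable_funM; first exact: intble_meas derive_intble.
    by apply: measurable_indic; exact: measurable_itv.
  + exact: intble_norm derive_intble.
  + by move=> s; rewrite normrM indicE; case: (_ \in _); rewrite ?normr1 ?mulr1 ?normr0 ?mulr0.
- exact: intble_norm derive_intble.
- by move=> s; rewrite normrM indicE; case: (_ \in _); rewrite ?normr1 ?mulr1 ?normr0 ?mulr0.
Qed.

End ftc_csupp.

End TestFunctions.

(** * Integration by parts *)

Section PlaneIntegral.
Variable R : realType.
Local Notation plane := (R * R)%type.
Local Notation e := (basis_dir R).
Local Notation leb := (@lebesgue_measure R).
Local Notation I f := (\int[leb2 R]_x f x).
Implicit Types (f g : plane -> R) (x : plane).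

Lemma continuous_pair1 (y : R) : continuous (fun t : R => (t, y) : plane).
Proof.
have -> : (fun t : R => (t, y)) = (fun t : R => t *: ((1, 0) : plane) + (0, y)).
  by apply/funext => t; congr pair; rewrite /= ?scaleRE ?mulr1 ?addr0 ?mulr0 ?add0r.
by move=> t; apply: cvgD; [apply: cvgZl; exact: cvg_id|exact: cvg_cst].
Qed.

Lemma continuous_pair2 (y : R) : continuous (fun t : R => (y, t) : plane).
Proof.
have -> : (fun t : R => (y, t)) = (fun t : R => t *: ((0, 1) : plane) + (y, 0)).
  by apply/funext => t; congr pair; rewrite /= ?scaleRE ?mulr1 ?addr0 ?mulr0 ?add0r.
by move=> t; apply: cvgD; [apply: cvgZl; exact: cvg_id|exact: cvg_cst].
Qed.

Lemma ccf_slice1 f y : ccf f -> intble leb (fun t : R => f (t, y)).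
Proof.
move=> [cf [M fM]]; apply: (@intble1_csupp _ _ M).
  move=> t; apply: (@cvg_comp _ _ _ (fun t : R => (t, y)) f (nbhs t) (nbhs (t, y))); [exact: continuous_pair1|exact: cf].
by move=> t /fM; rewrite prod_normE ge_max => /andP[].
Qed.

Lemma ccf_slice2 f y : ccf f -> intble leb (fun t : R => f (y, t)).
Proof.
move=> [cf [M fM]]; apply: (@intble1_csupp _ _ M).
  move=> t; apply: (@cvg_comp _ _ _ (fun t : R => (y, t)) f (nbhs t) (nbhs (y, t))); [exact: continuous_pair2|exact: cf].
by move=> t /fM; rewrite prod_normE ge_max => /andP[].
Qed.

Lemma ccf_fubini1 f : ccf f ->
  intble leb (fun y : R => \int[leb]_t f (t, y)) /\
  I f = \int[leb]_y (\int[leb]_t f (t, y)).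
Proof.
move=> cf; have fi := ccf_intble cf.
have E : fubini_G leb (EFin \o f) = EFin \o (fun y : R => \int[leb]_t f (t, y)).
  by apply/funext => y; rewrite /= EFin_Rint//; exact: ccf_slice1.
split.
  have mf : measurable_fun setT (EFin \o f) := measurable_int _ fi.
  apply/integrableP; rewrite -E; split; first exact: (measurable_fubini_G fi).
  apply: le_lt_trans ((integrable21ltyP leb leb mf).1 fi).
  apply: ge0_le_integral => //.
  - by apply: (measurableT_comp (f := abse)) => //; exact: (measurable_fubini_G fi).
  - by apply: (@measurable_fun_fubini_tonelli_G _ _ _ _ R leb (abse \o (EFin \o f))); [exact: (measurableT_comp (f := abse))|move=> x; exact: abse_ge0].
  - by move=> y _; apply: le_abse_integral => //; exact: (measurable_int _ (ccf_slice1 y cf)).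
transitivity (fine (\int[leb]_y fubini_G leb (EFin \o f) y)%E); last by rewrite E.
by rewrite integral21_prod_meas1.
Qed.

Lemma ccf_fubini2 f : ccf f ->
  intble leb (fun y : R => \int[leb]_t f (y, t)) /\
  I f = \int[leb]_y (\int[leb]_t f (y, t)).
Proof.
move=> cf; have fi := ccf_intble cf.
have E : fubini_F leb (EFin \o f) = EFin \o (fun y : R => \int[leb]_t f (y, t)).
  by apply/funext => y; rewrite /= EFin_Rint//; exact: ccf_slice2.
split; first by rewrite /intble -E; exact: integrable_fubini_F.
transitivity (fine (\int[leb]_y fubini_F leb (EFin \o f) y)%E); last by rewrite E.
by rewrite integral12_prod_meas1.
Qed.

Lemma ord2P (i : 'I_2) : i = 0 \/ i = 1.
Proof. by case: i => -[|[|//]] p; [left|right]; exact: val_inj. Qed.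

Lemma slice_derive1 f y (t : R) : smooth2 f ->
  is_derive t 1 (fun s : R => f (s, y)) (partial 0 f (t, y)).
Proof.
move=> sf; have E (s : R) : (s, y) = (0, y) + s *: e 0 :> plane.
  by rewrite basis_dirE eqxx; congr pair; rewrite /= ?scaleRE ?mulr1 ?add0r ?mulr0 ?addr0.
have -> : (fun s => f (s, y)) = (fun s => f ((0, y) + s *: e 0)).
  by apply/funext => s; rewrite -E.
by rewrite E; apply: is_derive_slice; exact: partial_derive.
Qed.

Lemma slice_derive2 f y (t : R) : smooth2 f ->
  is_derive t 1 (fun s : R => f (y, s)) (partial 1 f (y, t)).
Proof.
move=> sf; have E (s : R) : (y, s) = (y, 0) + s *: e 1 :> plane.
  by rewrite basis_dirE; congr pair; rewrite /= ?scaleRE ?mulr1 ?add0r ?mulr0 ?addr0.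
have -> : (fun s => f (y, s)) = (fun s => f ((y, 0) + s *: e 1)).
  by apply/funext => s; rewrite -E.
by rewrite E; apply: is_derive_slice; exact: partial_derive.
Qed.

Lemma Rint_partial f i : testf f -> I (partial i f) = 0.
Proof.
move=> tf; have [sf [M fM]] := tf; have cf := testf_ccf (testf_partial i tf).
have cp (i : 'I_2) := smooth2_continuous (smooth2_partial i sf).
have in1 (y : R) : \int[leb]_t partial 0 f (t, y) = 0.
  apply: (@Rint_derive_csupp R (fun s => f (s, y)) (fun s => partial 0 f (s, y)) M).
  - by move=> t; exact: slice_derive1.
  - by move=> t; apply: (@cvg_comp _ _ _ (fun t : R => (t, y)) (partial 0 f) (nbhs t) (nbhs (t, y))); [exact: continuous_pair1|exact: cp].
  - by move=> t /fM; rewrite prod_normE ge_max => /andP[].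
have in2 (y : R) : \int[leb]_t partial 1 f (y, t) = 0.
  apply: (@Rint_derive_csupp R (fun s => f (y, s)) (fun s => partial 1 f (y, s)) M).
  - by move=> t; exact: slice_derive2.
  - by move=> t; apply: (@cvg_comp _ _ _ (fun t : R => (y, t)) (partial 1 f) (nbhs t) (nbhs (y, t))); [exact: continuous_pair2|exact: cp].
  - by move=> t /fM; rewrite prod_normE ge_max => /andP[].
have [i0|i1] := ord2P i.
  have [_ ->] := ccf_fubini1 cf; rewrite i0 -[RHS](Rint_cst0 leb).
  by apply: eq_Rintegral => y _; exact: in1.
have [_ ->] := ccf_fubini2 cf; rewrite i1 -[RHS](Rint_cst0 leb).
by apply: eq_Rintegral => y _; exact: in2.
Qed.

Lemma Rint_by_parts i f g : smooth2 f -> testf g ->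
  I (fun x => f x * partial i g x) = - I (fun x => partial i f x * g x).
Proof.
move=> sf tg; have [sg _] := tg.
have := Rint_partial i (testfMl sf tg); rewrite partialM// RintD.
- move/eqP; rewrite addr_eq0 => /eqP ->; congr (- _).
  by apply: eq_Rintegral => x _; rewrite mulrC.
- by apply: testf_intble; apply: testfMl => //; exact: testf_partial.
- under eq_fun do rewrite mulrC.
  by apply: testf_intble; apply: testfMl => //; exact: smooth2_partial.
Qed.

(** At (t, y), |f| is bounded by the integral of the first partial derivative over the horizontal
    line through the point, and by that of the second over the vertical line. The first bound
    depends only on y and the second only on t, so their product integrates to the product of the
    integrals. *)
Lemma testf_ladyzhenskaya1 f : testf f ->
  I (fun x => f x ^+ 2) <= I (fun x => `|partial 0 f x|) * I (fun x => `|partial 1 f x|).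
Proof.
move=> tf; have [sf [M fM]] := tf.
have cp (i : 'I_2) := ccf_norm (testf_ccf (testf_partial i tf)).
have cpf (i : 'I_2) := smooth2_continuous (smooth2_partial i sf).
have cf2 : ccf (fun x => f x ^+ 2).
  apply: testf_ccf; under eq_fun do rewrite expr2; exact: testfMl.
pose a (y : R) := \int[leb]_t `|partial 0 f (t, y)|.
pose b (y : R) := \int[leb]_t `|partial 1 f (y, t)|.
have [iA AE] : intble leb a /\ I (fun x => `|partial 0 f x|) = \int[leb]_y a y.
  exact: ccf_fubini1 (cp 0).
have [iB BE] : intble leb b /\ I (fun x => `|partial 1 f x|) = \int[leb]_y b y.
  exact: ccf_fubini2 (cp 1).
have b0 : 0 <= \int[leb]_t b t by apply: Rint_ge0 => t; exact: Rint_ge0.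
have fa t y : `|f (t, y)| <= a y.
  apply: (@norm_le_Rint_derive _ (fun s => f (s, y)) (fun s => partial 0 f (s, y)) M).
  - by move=> s; exact: slice_derive1.
  - by move=> s; apply: (@cvg_comp _ _ _ (fun t : R => (t, y)) (partial 0 f) (nbhs s) (nbhs (s, y))); [exact: continuous_pair1|exact: cpf].
  - by move=> s /fM; rewrite prod_normE ge_max => /andP[].
have fb t y : `|f (t, y)| <= b t.
  apply: (@norm_le_Rint_derive _ (fun s => f (t, s)) (fun s => partial 1 f (t, s)) M).
  - by move=> s; exact: slice_derive2.
  - by move=> s; apply: (@cvg_comp _ _ _ (fun s : R => (t, s)) (partial 1 f) (nbhs s) (nbhs (t, s))); [exact: continuous_pair2|exact: cpf].
  - by move=> s /fM; rewrite prod_normE ge_max => /andP[].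
clearbody a b.
have fab (t y : R) : f (t, y) ^+ 2 <= b t * a y.
  rewrite -real_normK ?num_real// expr2 mulrC.
  by apply: ler_pM.
have aB (y : R) : \int[leb]_t f (t, y) ^+ 2 <= a y * \int[leb]_t b t.
  rewrite -(RintZ (mu := leb))//.
  apply: Rint_le; [exact: (ccf_slice1 y cf2)|exact: intbleZ|].
  by move=> t; rewrite mulrC; exact: fab.
have [i2 ->] := ccf_fubini1 cf2; rewrite AE BE mulrC -(RintZ (mu := leb))//.
apply: Rint_le => //; first exact: intbleZ.
by move=> y; rewrite mulrC; exact: aB.
Qed.

End PlaneIntegral.

(** * The du Bois-Reymond lemma *)

Section VanishingIntegral.
Context d d' (T : measurableType d) (T' : measurableType d') (R : realType).
Variable mu : {measure set T -> \bar R}.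
Variables (phi : T -> T') (h : T -> R).
Hypothesis mphi : measurable_fun setT phi.
Hypothesis hi : intble mu h.
Local Notation I f := (\int[mu]_x f x).

Let mpre A : measurable A -> measurable (phi @^-1` A).
Proof. by move=> mA; rewrite -[X in measurable X]setTI; exact: mphi. Qed.

Let hA A : measurable A -> intble mu (fun x => h x * \1_(phi @^-1` A) x).
Proof.
move=> mA; apply: (@intble_le _ _ _ mu _ (fun x => `|h x|)).
- apply: measurable_funM; first exact: intble_meas hi.
  by apply: measurable_indic; exact: mpre.
- exact: intble_norm.
- by move=> x; rewrite normrM indicE; case: (_ \in _); rewrite ?normr1 ?mulr1 ?normr0 ?mulr0.
Qed.

(** The sets on whose preimage h integrates to 0 form a Dynkin class; the total integral 0 is what
    closes it under complements. It will be used with [phi] a coordinate projection and with [phi]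
    the identity. *)
Lemma Rint_vanish_sigma (G : set (set T')) : @measurable _ T' = <<s G >> ->
  setI_closed G -> I h = 0 ->
  (forall A, G A -> I (fun x => h x * \1_(phi @^-1` A) x) = 0) ->
  forall A, measurable A -> I (fun x => h x * \1_(phi @^-1` A) x) = 0.
Proof.
move=> GE GI h0 hG A mA; rewrite GE in mA; move: A mA.
apply: (dynkin_induction GE GI) => //.
- by rewrite -[RHS]h0; apply: eq_Rintegral => x _; rewrite preimage_setT indicT mulr1.
- move=> A mA A0; transitivity (I h - I (fun x => h x * \1_(phi @^-1` A) x)); last by rewrite h0 A0 subrr.
  rewrite -RintB//; last exact: hA.
  apply: eq_Rintegral => x _; rewrite preimage_setC !indicE in_setC.
  by case: (_ \in _) => /=; rewrite ?mulr1 ?mulr0 ?subrr ?subr0.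
- move=> F mF tF F0.
  have mUF : measurable (\bigcup_k F k) by exact: bigcupT_measurable.
  have E (B : set T) : measurable B ->
      I (fun x => h x * \1_B x) = fine (\int[mu]_(x in B) (h x)%:E).
    move=> mB; rewrite [in RHS]integral_mkcond; congr fine; apply: eq_integral => x _.
    by rewrite patchE indicE; case: ifP; rewrite ?mulr1 ?mulr0.
  have hiB (B : set T) : measurable B -> mu.-integrable B (EFin \o h).
    by move=> mB; apply: integrableS hi.
  rewrite E; last exact: mpre.
  rewrite preimage_bigcup integral_bigcup; last 3 first.
  - by move=> i j _ _ [x [Fi Fj]]; apply: tF => //; exists (phi x).
  - by move=> k; exact: mpre.
  - by apply: hiB; apply: bigcupT_measurable => k; exact: mpre.
  rewrite eseries0// => k _ _.
  have mk := mpre (mF k); have := F0 k; rewrite E// => fk.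
  by rewrite -[LHS]fineK ?fk//; apply: integrable_fin_num => //; exact: hiB.
Qed.

End VanishingIntegral.

Section DuBoisReymond.
Variable R : realType.
Local Notation plane := (R * R)%type.
Local Notation mplane := (measurableTypeR R * measurableTypeR R)%type.
Local Notation I f := (\int[leb2 R]_x f x).

(** A smooth approximation from below of the indicator of ]a, b[: [flat 0] is e^(-1/x) for x > 0,
    and dilating its argument by n + 1 pushes its values to 1. *)
Definition step (n : nat) (a b x : R) : R :=
  flat 0 (n.+1%:R * x + (- (n.+1%:R * a))) * flat 0 (- n.+1%:R * x + n.+1%:R * b).

Lemma smooth1_step n a b : smooth1 (step n a b).
Proof. by apply: smooth1M; apply: smooth1_affine; exact: smooth1_flat. Qed.

Lemma flat0_bound (x : R) : 0 <= flat 0 x <= \1_[set y | 0 < y] x.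
Proof.
rewrite /flat indicE; case: ifP => x0; last first.
  by rewrite memNset ?lexx//= x0.
rewrite mem_set// expr0 invr1 mul1r expR_ge0/= -expR0 ler_expR oppr_le0 invr_ge0.
exact: ltW.
Qed.

Lemma step_bound n a b x : 0 <= step n a b x <= \1_(`]a, b[%classic) x.
Proof.
rewrite /step; have n0 : 0 < n.+1%:R :> R by [].
have /andP[p0 p1] := flat0_bound (n.+1%:R * x + (- (n.+1%:R * a))).
have /andP[q0 q1] := flat0_bound (- n.+1%:R * x + n.+1%:R * b).
rewrite mulr_ge0//= (le_trans (ler_pM p0 q0 p1 q1))//.
rewrite -mulrN -mulrDr mulNr -mulrN -mulrDr !indicE.
rewrite -natrM mulnb ler_nat; case: (boolP (_ && _)) => // /andP[].
rewrite !inE/= !pmulr_rgt0// subr_gt0 addrC subr_gt0 => ax xb.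
by rewrite mem_set//= in_itv/= ax.
Qed.

Lemma step_cvg a b x : step n a b x @[n --> \oo] --> (\1_(`]a, b[%classic) x : R).
Proof.
rewrite indicE; have [|nab] := boolP (x \in `]a, b[%classic); last first.
  apply: cvg_near_cst; apply: nearW => n; apply/eqP; rewrite eq_le.
  by have := step_bound n a b x; rewrite indicE (negPf nab) andbC.
rewrite inE/= in_itv/= => /andP[ax xb].
have cvgf (t : R) : 0 < t -> flat 0 (n.+1%:R * t) @[n --> \oo] --> (1 : R).
  move=> t0; have -> : (fun n => flat 0 (n.+1%:R * t)) = (fun n => expR (- (n.+1%:R^-1 * t^-1))).
    by apply/funext => n; rewrite /flat pmulr_rgt0// t0 expr0 invr1 mul1r invfM.
  rewrite -[X in _ --> X]expR0; apply: (@cvg_comp _ _ _ (fun n => - (n.+1%:R^-1 * t^-1)) expR); last first.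
    exact: continuous_expR.
  rewrite -oppr0; apply: cvgN; rewrite -[X in _ --> X](mul0r t^-1); apply: cvgMr_tmp.
  exact: cvg_harmonic.
rewrite -[X in _ --> X](mulr1 1) /step; apply: cvgM.
  under eq_fun do rewrite -mulrN -mulrDr.
  by apply: cvgf; rewrite subr_gt0.
under eq_fun do rewrite mulNr addrC -mulrBr.
by apply: cvgf; rewrite subr_gt0.
Qed.

Lemma testf_step n a b c d : testf (fun x : plane => step n a b x.1 * step n c d x.2).
Proof.
split; first by apply: smooth2_tensor; exact: smooth1_step.
exists (`|a| + `|b| + `|c| + `|d|) => x; rewrite mulf_eq0 negb_or => /andP[h1 h2].
have sn u v t : step n u v t != 0 -> `|t| <= `|u| + `|v|.
  move=> h; have := step_bound n u v t; rewrite indicE.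
  have [|_] := boolP (t \in _); last by rewrite -eq_le eq_sym (negPf h).
  rewrite inE/= in_itv/= => /andP[ut tv] _; rewrite ler_norml.
  have := ler_norm v; have := ler_norm (- u); rewrite normrN.
  by have := normr_ge0 u; have := normr_ge0 v; move=> *; apply/andP; split; lra.
rewrite prod_normE ge_max.
have := sn _ _ _ h1; have := sn _ _ _ h2.
have := normr_ge0 a; have := normr_ge0 b; have := normr_ge0 c; have := normr_ge0 d.
by move=> *; apply/andP; split; lra.
Qed.

Lemma measurable_indic_fst (A : set (measurableTypeR R)) : measurable A ->
  measurable_fun setT ((fun x => \1_A x.1) : mplane -> R).
Proof. by move=> mA; exact: (measurableT_comp (measurable_indic mA) measurable_fst). Qed.

Lemma measurable_indic_snd (A : set (measurableTypeR R)) : measurable A ->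
  measurable_fun setT ((fun x => \1_A x.2) : mplane -> R).
Proof. by move=> mA; exact: (measurableT_comp (measurable_indic mA) measurable_snd). Qed.

Variable g : plane -> R.
Hypothesis mg : measurable_fun setT (g : mplane -> R).
Hypothesis gi : forall psi, testf psi -> intble (leb2 R) (fun x => g x * psi x).

Lemma flat0_ge (x : R) : 1 <= x -> expR (-1) <= flat 0 x.
Proof.
move=> x1; have x0 : 0 < x by lra.
by rewrite /flat x0 expr0 invr1 mul1r ler_expR lerN2 invf_le1.
Qed.

(** A step function of a larger square is at least e^-4 on [box M], so integrability against test
    functions is local integrability. The margin 2 puts the argument of each of the four factors
    [flat 0] above 1. *)
Lemma intble_box M : intble (leb2 R) (fun x => g x * \1_(box M) x).
Proof.
pose a := - (M + 2); pose b := M + 2.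
pose psi (x : plane) := step 0 a b x.1 * step 0 a b x.2.
have psi1 x : \1_(box M) x <= expR 1 ^+ 4 * `|psi x|.
  rewrite indicE; have [|_] := boolP (x \in _); last first.
    by rewrite mulr_ge0// exprn_ge0// expR_ge0.
  rewrite inE => /boxP; rewrite prod_normE ge_max !ler_norml => /andP[/andP[x1 x2] /andP[x3 x4]].
  have e0 := expR_gt0 (-1 : R).
  have st t : - M <= t -> t <= M -> expR (-1) ^+ 2 <= step 0 a b t.
    move=> t1 t2; rewrite /step expr2 ler_pM ?expR_ge0//; apply: flat0_ge; rewrite /a /b; lra.
  have p1 : expR (-1) ^+ 4 <= psi x.
    rewrite (_ : 4%N = (2 + 2)%N)// exprD ler_pM ?exprn_ge0 ?expR_ge0//; exact: st.
  rewrite ger0_norm; last by rewrite (le_trans _ p1)// exprn_ge0// expR_ge0.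
  apply: le_trans (ler_wpM2l _ p1); last by rewrite exprn_ge0// expR_ge0.
  by rewrite -exprMn -expRD subrr expR0 expr1n.
apply: (@intble_le _ _ R (leb2 R) _ (fun x => expR 1 ^+ 4 * `|g x * psi x|)).
- by apply: measurable_funM => //; apply: measurable_indic; exact: box_measurable.
- by apply: intbleZ; apply: intble_norm; apply: gi; exact: testf_step.
- move=> x; rewrite normrM [`|g x * psi x|]normrM mulrCA ler_wpM2l//.
  by rewrite ger0_norm.
Qed.

Hypothesis g0 : forall n a b c d, I (fun x => g x * (step n a b x.1 * step n c d x.2)) = 0.

Lemma Rint_rect0 a b c d :
  I (fun x => g x * (\1_(`]a, b[%classic) x.1 * \1_(`]c, d[%classic) x.2)) = 0.
Proof.
pose M := `|a| + `|b| + `|c| + `|d|.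
pose f_ n (x : plane) := (g x * (step n a b x.1 * step n c d x.2))%:E.
pose f (x : plane) := (g x * (\1_(`]a, b[%classic) x.1 * \1_(`]c, d[%classic) x.2))%:E.
have mst n : measurable_fun setT ((fun x => step n a b x.1 * step n c d x.2) : mplane -> R).
  by apply: continuous_plane_measurable; apply: smooth2_continuous; case: (testf_step n a b c d).
have fi n : intble (leb2 R) (fun x => g x * (step n a b x.1 * step n c d x.2)).
  by apply: gi; exact: testf_step.
have stM n x : `|step n a b x.1 * step n c d x.2| <= \1_(box M) x.
  have /andP[p0 p1] := step_bound n a b x.1; have /andP[q0 q1] := step_bound n c d x.2.
  rewrite (ger0_norm (mulr_ge0 p0 q0)); apply: (le_trans (ler_pM p0 q0 p1 q1)).
  rewrite !indicE -natrM mulnb ler_nat; case: (boolP (_ && _)) => // /andP[].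
  rewrite !inE/= !in_itv/= => /andP[ax xb] /andP[cx xd]; rewrite mem_set//; apply/boxP.
  rewrite prod_normE ge_max !ler_norml /M.
  have := ler_norm b; have := ler_norm (- a); have := ler_norm d; have := ler_norm (- c).
  rewrite !normrN.
  have := normr_ge0 a; have := normr_ge0 b; have := normr_ge0 c; have := normr_ge0 d.
  by move=> *; apply/andP; split; apply/andP; split; lra.
have mf : measurable_fun setT (f : mplane -> \bar R).
  apply/measurable_EFinP; apply: measurable_funM => //; apply: measurable_funM.
    by apply: measurable_indic_fst; exact: measurable_itv.
  by apply: measurable_indic_snd; exact: measurable_itv.
have fcv : (fun n => \int[leb2 R]_x f_ n x)%E @ \oo --> (\int[leb2 R]_x f x)%E.
  have := @dominated_convergence _ mplane R (leb2 R) setT measurableT f_ f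
   (EFin \o (fun x => `|g x * \1_(box M) x|)) (fun n => measurable_int _ (fi n)) mf.
  case=> //.
  - apply: aeW => x _; apply: cvg_EFin; first exact: nearW.
    apply: cvgM; first exact: cvg_cst.
    by apply: cvgM; exact: step_cvg.
  - exact: (intble_norm (intble_box M)).
  - apply: aeW => x n _; rewrite lee_fin normrM [leRHS]normrM ler_wpM2l//.
    by apply: le_trans (stM n x) (ler_norm _).
have E n : (\int[leb2 R]_x f_ n x = 0)%E by rewrite -(EFin_Rint (fi n)) g0.
rewrite /Rintegral -(cvg_lim _ fcv)//; under eq_fun do rewrite E.
by rewrite lim_cst.
Qed.

Section in_box.
Variable N : R.
Let h (x : plane) : R := g x * (\1_(`]- N, N[%classic) x.1 * \1_(`]- N, N[%classic) x.2).

Let mQ : measurable (`]- N, N[%classic : set (measurableTypeR R)).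
Proof. exact: measurable_itv. Qed.

Lemma intble_mul_indic (f : plane -> R) (s : plane -> R) :
  intble (leb2 R) f -> measurable_fun setT (s : mplane -> R) ->
  (forall x, `|s x| <= 1) -> intble (leb2 R) (fun x => f x * s x).
Proof.
move=> fi ms s1; apply: (@intble_le _ mplane R (leb2 R) _ (fun x => `|f x|)).
- by apply: measurable_funM => //; exact: intble_meas fi.
- exact: intble_norm.
- by move=> x; rewrite normrM ler_piMr.
Qed.

Let ind1 (U : Type) (A : set U) (t : U) : `|\1_A t : R| <= 1.
Proof. by rewrite indicE; case: (_ \in _); rewrite ?normr1 ?normr0. Qed.

Let hi : intble (leb2 R) h.
Proof.
rewrite (_ : h = fun x => g x * \1_(box `|N|) x * (\1_(`]- N, N[%classic) x.1 * \1_(`]- N, N[%classic) x.2)).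
  apply: intble_mul_indic; first exact: intble_box.
    by apply: measurable_funM; [exact: measurable_indic_fst|exact: measurable_indic_snd].
  by move=> x; rewrite normrM mulr_ile1.
apply/funext => x; rewrite /h -mulrA; congr (_ * _); rewrite !indicE.
have [x1|_] := boolP (x.1 \in _); last by rewrite !mul0r mulr0.
have [x2|_] := boolP (x.2 \in _); last by rewrite !mulr0.
rewrite mem_set ?mulr1//; apply/boxP; rewrite prod_normE ge_max.
move: x1 x2; rewrite !inE/= !in_itv/= -!ltr_norml => x1 x2.
by rewrite !(le_trans (ltW _) (ler_norm N)).
Qed.

Let rect0 a c : I (fun x => h x * \1_(`]c, +oo[%classic) x.2 * \1_(`]a, +oo[%classic) x.1) = 0.
Proof.
rewrite -[RHS](Rint_rect0 (Num.max a (- N)) N (Num.max c (- N)) N).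
apply: eq_Rintegral => x _; rewrite /h -!mulrA; congr (_ * _).
have E u t : \1_(`]- N, N[%classic) t * \1_(`]u, +oo[%classic) t = \1_(`]Num.max u (- N), N[%classic) t :> R.
  rewrite !indicE -natrM mulnb; congr (_%:R); congr nat_of_bool.
  apply/andP/idP; rewrite !inE/= !in_itv/= ?andbT gt_max.
    by move=> [/andP[-> ->] ->].
  by move=> /andP[/andP[-> ->] ->].
by rewrite -!E; ring.
Qed.

Let raysI : setI_closed (@RGenOInfty.G R).
Proof.
move=> _ _ [x ->] [y ->]; exists (Num.max x y); apply/seteqP; split=> t /=; rewrite !in_itv/= !andbT gt_max.
  by move=> [-> ->].
by move=> /andP[-> ->].
Qed.

Let hout1 x : ~~ (- N < x.1) -> h x = 0.
Proof. by move=> /negPf x1; rewrite /h indicE memNset ?mul0r ?mulr0//= in_itv/= x1. Qed.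

Let hout2 x : ~~ (- N < x.2) -> h x = 0.
Proof. by move=> /negPf x1; rewrite /h [X in _ * (_ * X)]indicE memNset ?mulr0//= in_itv/= x1. Qed.

(** Rays starting at or below -N act as the whole line on the support of h. This turns the vanishing
    on rays into the vanishing of the total integral that [Rint_vanish_sigma] asks for. *)
Let ray1 c x : - c >= N -> h x * \1_(`]c, +oo[%classic) x.1 = h x.
Proof.
move=> cN; rewrite indicE; have [_|] := boolP (x.1 \in _); first by rewrite mulr1.
rewrite notin_setE/= in_itv/= andbT => /negP cx; rewrite mulr0 hout1//.
by apply: contraNN cx => xN; lra.
Qed.

Let ray2 c x : - c >= N -> h x * \1_(`]c, +oo[%classic) x.2 = h x.
Proof.
move=> cN; rewrite indicE; have [_|] := boolP (x.2 \in _); first by rewrite mulr1.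
rewrite notin_setE/= in_itv/= andbT => /negP cx; rewrite mulr0 hout2//.
by apply: contraNN cx => xN; lra.
Qed.

Let stage1 c (A : set (measurableTypeR R)) : measurable A ->
  I (fun x => h x * \1_(`]c, +oo[%classic) x.2 * \1_(fst @^-1` A) x) = 0.
Proof.
apply: (@Rint_vanish_sigma _ _ mplane (measurableTypeR R) R (leb2 R) fst
  (fun x => h x * \1_(`]c, +oo[%classic) x.2) _ _ _ (RGenOInfty.measurableE R) raysI) => //.
- apply: intble_mul_indic => //.
  by apply: measurable_indic_snd; exact: measurable_itv.
- rewrite -[RHS](rect0 (- N) c); apply: eq_Rintegral => x _.
  by rewrite [RHS]mulrAC ray1 ?opprK.
- by move=> _ [a ->]; exact: rect0.
Qed.

Let stage2 (A B : set (measurableTypeR R)) : measurable A -> measurable B ->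
  I (fun x => h x * \1_(fst @^-1` A) x * \1_(snd @^-1` B) x) = 0.
Proof.
move=> mA; move: B.
apply: (@Rint_vanish_sigma _ _ mplane (measurableTypeR R) R (leb2 R) snd
  (fun x => h x * \1_(fst @^-1` A) x) _ _ _ (RGenOInfty.measurableE R) raysI) => //.
- by apply: intble_mul_indic => //; exact: (measurable_indic_fst mA).
- rewrite -[RHS](stage1 (- N) mA); apply: eq_Rintegral => x _.
  by rewrite ray2 ?opprK.
- by move=> _ [a ->]; rewrite -[RHS](stage1 a mA); apply: eq_Rintegral => x _; rewrite mulrAC.
Qed.

(** [Rint_vanish_sigma] is applied three times: from rays to Borel sets in the first coordinate,
    then in the second, and from measurable rectangles to all measurable sets of the plane. *)
Lemma ae0_in_box : {ae leb2 R, forall x, h x = 0}.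
Proof.
have key (E : set mplane) : measurable E -> I (fun x => h x * \1_E x) = 0.
  apply: (@Rint_vanish_sigma _ _ mplane mplane R (leb2 R) id h _ hi
    [set A `*` B | A in measurable & B in measurable]).
  - exact: measurable_id.
  - exact: measurable_prod_measurableType.
  - move=> X Y [X1 mX1 [X2 mX2 <-{X}]] [Y1 mY1 [Y2 mY2 <-{Y}]].
    exists (X1 `&` Y1); first exact: measurableI.
    by exists (X2 `&` Y2); [exact: measurableI|rewrite setXI].
  - rewrite -[RHS](rect0 (- N) (- N)); apply: eq_Rintegral => x _.
    by rewrite ray2 ?opprK// ray1 ?opprK.
  - move=> _ [A mA [B mB <-]]; rewrite -[RHS](stage2 mA mB); apply: eq_Rintegral => x _.
    rewrite -mulrA; congr (_ * _); rewrite !indicE -natrM mulnb; congr (_%:R); congr nat_of_bool.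
    by apply/idP/andP; rewrite !inE.
have H : ae_eq (leb2 R) setT (EFin \o h) (cst 0%E).
  apply: integral_ae_eq => // E _ mE; rewrite integral0.
  transitivity (\int[leb2 R]_x (h x * \1_E x)%:E)%E.
    rewrite integral_mkcond; apply: eq_integral => x _.
    by rewrite patchE indicE; case: ifP; rewrite ?mulr1 ?mulr0.
  rewrite -EFin_Rint ?key//.
  by apply: intble_mul_indic => //; exact: measurable_indic.
by apply: filterS H => x /(_ Logic.I) [].
Qed.

End in_box.

Lemma du_Bois_Reymond_tensor : {ae leb2 R, forall x, g x = 0}.
Proof.
have h (N : nat) := @ae0_in_box N%:R.
apply: filterS (ae_foralln h) => x gx.
have [N xN] : exists N : nat, `|x| < N%:R.
  by exists (Num.bound `|x|); exact: archi_boundP.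
have := gx N; move: xN; rewrite prod_normE gt_max !ltr_norml => /andP[x1 x2].
by rewrite !indicE !mem_set ?mulr1//= in_itv.
Qed.

End DuBoisReymond.

(** * Affine changes of variables *)

Lemma ge0_integral_scaled_pushforward d d' (T : measurableType d) (T' : measurableType d')
    (R : realType) (mu : {measure set T -> \bar R}) (nu : {measure set T' -> \bar R})
    (phi : T -> T') (c : R) (f : T' -> \bar R) :
  0 <= c -> measurable_fun setT phi ->
  (forall A, measurable A -> nu A = (c%:E * mu (phi @^-1` A))%E) ->
  measurable_fun setT f -> (forall x, 0 <= f x)%E ->
  (\int[nu]_x f x = c%:E * \int[mu]_x f (phi x))%E.
Proof.
move=> c0 mphi nuE mf f0.
rewrite [LHS](@eq_measure_integral _ T' R setT (mscale (NngNum c0) (pushforward mu phi)))//.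
  rewrite ge0_integral_mscale//=; congr (_ * _)%E.
  by rewrite ge0_integral_pushforward// preimage_setT.
by move=> A mA _; exact: nuE.
Qed.

Section ChangeOfVariables.
Variable R : realType.
Local Notation plane := (R * R)%type.
Local Notation mR := (measurableTypeR R).
Local Notation mplane := (measurableTypeR R * measurableTypeR R)%type.
Local Notation leb := (@lebesgue_measure R).
Local Notation I f := (\int[leb2 R]_x f x).

Variables (a : R) (b : plane).
Hypothesis a0 : 0 < a.

Let ac : {nonneg R} := NngNum (ltW a0).

Definition affine1 (c : R) : mR -> mR := fun t => a * t + c.

Lemma measurable_affine1 c : measurable_fun setT (affine1 c).
Proof. by apply: measurable_funD => //; apply: measurable_funM. Qed.

Lemma lebesgue_affine c (A : set mR) : measurable A ->
  leb A = (a%:E * leb (affine1 c @^-1` A))%E.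
Proof.
move=> mA; rewrite [LHS](@lebesgue_measure_unique R (mscale ac (pushforward leb (affine1 c))))//; first exact: measurable_affine1.
move=> m1 _ [[u v] _ <-]; rewrite lebesgue_measure_itv/=.
transitivity (a%:E * leb (affine1 c @^-1` [set` `]u, v]]))%E; last by [].
rewrite (_ : affine1 c @^-1` [set` `]u, v]] = [set` `](u - c) / a, (v - c) / a]]); last first.
  apply/seteqP; split=> t /=; rewrite !in_itv/= /affine1.
    by rewrite ltr_pdivrMr// ler_pdivlMr// ltrBlDr lerBrDr mulrC.
  by rewrite ltr_pdivrMr// ler_pdivlMr// ltrBlDr lerBrDr mulrC.
rewrite lebesgue_measure_itv/= !lte_fin ltr_pM2r ?invr_gt0// ltrD2r.
case: ifP => _; last by rewrite mule0.
by rewrite -!EFinD -EFinM; congr EFin; field; rewrite gt_eqF.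
Qed.

Definition affine2 (x : mplane) : mplane := (affine1 b.1 x.1, affine1 b.2 x.2).

Lemma affine2E (x : plane) : affine2 x = a *: x + b.
Proof. by congr pair; rewrite /affine1 ?scaleRE. Qed.

Lemma measurable_affine2 : measurable_fun setT affine2.
Proof.
apply/measurable_fun_pair.
  exact: (measurableT_comp (measurable_affine1 b.1) measurable_fst).
exact: (measurableT_comp (measurable_affine1 b.2) measurable_snd).
Qed.

Let ac2 : {nonneg R} := NngNum (sqr_ge0 a).

Lemma leb2_affine (A : set mplane) : measurable A ->
  leb2 R A = ((a ^+ 2)%:E * leb2 R (affine2 @^-1` A))%E.
Proof.
move=> mA; rewrite [LHS](@product_measure_unique _ _ mR mR R leb leb
  (mscale ac2 (pushforward (leb2 R) affine2)))//; first exact: measurable_affine2.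
move=> m2 B C mB mC.
have pB c (D : set mR) : measurable D -> measurable (affine1 c @^-1` D).
  by move=> mD; rewrite -[X in measurable X]setTI; exact: measurable_affine1.
transitivity ((a ^+ 2)%:E * leb2 R ((affine1 b.1 @^-1` B) `*` (affine1 b.2 @^-1` C)))%E; first by [].
rewrite [X in (_ * X)%E = _](product_measure1E leb leb (pB _ _ mB) (pB _ _ mC)).
transitivity ((a%:E * leb (affine1 b.1 @^-1` B)) * (a%:E * leb (affine1 b.2 @^-1` C)))%E; last first.
  by congr (_ * _)%E; apply/esym; exact: lebesgue_affine.
by rewrite expr2 EFinM -!muleA; congr (_ * _)%E; rewrite muleCA.
Qed.

Lemma ge0_integral_affine (f : plane -> \bar R) : measurable_fun setT (f : mplane -> \bar R) ->
  (forall x, 0 <= f x)%E ->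
  (\int[leb2 R]_x f x = (a ^+ 2)%:E * \int[leb2 R]_x f (a *: x + b)%R)%E.
Proof.
move=> mf f0.
have /= -> := ge0_integral_scaled_pushforward (sqr_ge0 a) measurable_affine2 leb2_affine mf f0.
by congr (_ * _)%E; apply: eq_integral => x _; rewrite affine2E.
Qed.

Lemma measurable_affine_comp (f : plane -> R) : measurable_fun setT (f : mplane -> R) ->
  measurable_fun setT ((fun x => f (a *: x + b)) : mplane -> R).
Proof.
move=> mf; rewrite (_ : (fun x => _) = f \o affine2); last first.
  by apply/funext => x; rewrite /= affine2E.
exact: measurableT_comp mf measurable_affine2.
Qed.

Lemma intble_affine (f : plane -> R) : intble (leb2 R) f ->
  intble (leb2 R) (fun x => f (a *: x + b)).
Proof.
move=> fi; have mf := intble_meas fi.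
apply/integrableP; split; first by apply/measurable_EFinP; exact: measurable_affine_comp.
have := @ge0_integral_affine (fun x => `|f x|%:E) _ _.
move=> /(_ _ _)/esym h; move/integrableP: fi => [_ foo].
have a2 : (0 < (a ^+ 2)%:E :> \bar R)%E by rewrite lte_fin exprn_gt0.
rewrite -(@lte_pmul2l _ (a ^+ 2)%:E)// gt0_muley//.
rewrite [X in (X < _)%E]h //.
  by apply/measurable_EFinP; exact: measurableT_comp.
Qed.

Lemma Rint_affine_ge0 (f : plane -> R) : intble (leb2 R) f -> (forall x, 0 <= f x) ->
  I f = a ^+ 2 * I (fun x => f (a *: x + b)).
Proof.
move=> fi f0; apply: EFin_inj; rewrite EFin_Rint// EFinM EFin_Rint; last exact: intble_affine.
apply: ge0_integral_affine; last by move=> x; rewrite lee_fin.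
by apply/measurable_EFinP; exact: intble_meas fi.
Qed.

(** Reduction to the nonnegative functions |f| + f and |f|. *)
Lemma Rint_affine (f : plane -> R) : intble (leb2 R) f ->
  I f = a ^+ 2 * I (fun x => f (a *: x + b)).
Proof.
move=> fi; have ni := intble_norm fi.
have si : intble (leb2 R) (fun x => `|f x| + f x) by exact: intbleD.
have E2 : I f = I (fun x => `|f x| + f x) - I (fun x => `|f x|).
  by rewrite -RintB//; apply: eq_Rintegral => x _; rewrite addrAC subrr add0r.
rewrite E2 (Rint_affine_ge0 ni (fun=> normr_ge0 _)) (Rint_affine_ge0 si); last first.
  by move=> x; have := ler_norm (- f x); rewrite normrN; lra.
rewrite -mulrBr -RintB; [|exact: intble_affine si|exact: intble_affine ni].
by congr (_ * _); apply: eq_Rintegral => x _; rewrite addrAC subrr add0r.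
Qed.

End ChangeOfVariables.

(** * Uniqueness for the Helmholtz equation *)

Section OneDim.
Variable R : realType.

Lemma mean_value (f f' : R -> R) (h : R) : (forall t : R, is_derive t 1 f (f' t)) -> h != 0 ->
  exists2 k, 0 < k < 1 & f h - f 0 = h * f' (k * h).
Proof.
move=> df h0.
have cf : continuous f.
  by move=> t; apply/differentiable_continuous/derivable1_diffP; have [] := df t.
have [h_gt0|h_lt0|h_eq0] := ltgtP 0 h; last by rewrite -h_eq0 eqxx in h0.
  have [|c + ->] := @MVT _ f f' 0 h h_gt0 (fun t _ => df t).
    exact: continuous_subspaceT.
  rewrite in_itv/= => /andP[c0 ch]; exists (c / h).
    by rewrite divr_gt0//= ltr_pdivrMr// mul1r.
  by rewrite mulfVK// subr0 mulrC.
have [|c + E] := @MVT _ f f' h 0 h_lt0 (fun t _ => df t).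
  exact: continuous_subspaceT.
rewrite in_itv/= => /andP[ch c0]; exists (c / h).
  by rewrite ltr_ndivrMr// mul1r ch andbT -mulrNN mulr_gt0// oppr_gt0// invr_lt0.
rewrite mulfVK//; apply/eqP; rewrite -eqr_opp opprB E; apply/eqP; ring.
Qed.

Lemma taylor1_bound (f f' f'' : R -> R) (K h : R) :
  (forall t : R, is_derive t 1 f (f' t)) -> (forall t : R, is_derive t 1 f' (f'' t)) ->
  (forall t, `|f'' t| <= K) -> `|f h - f 0 - h * f' 0| <= K * h ^+ 2.
Proof.
move=> df df' fK; have K0 : 0 <= K := le_trans (normr_ge0 _) (fK 0).
have [->|h0] := eqVneq h 0; first by rewrite subrr mul0r subrr normr0 expr0n mulr0.
have [k /andP[k0 k1] ->] := mean_value df h0.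
have kh : k * h != 0 by apply: mulf_neq0 => //; rewrite gt_eqF.
have [l /andP[l0 l1]] := mean_value df' kh; rewrite -mulrBr => ->.
set x := f'' _; have -> : h * (k * h * x) = (k * h ^+ 2) * x by ring.
rewrite normrM [leRHS]mulrC; apply: ler_pM => //; last exact: fK.
by rewrite normrM gtr0_norm// normrX real_normK ?num_real// ler_piMl ?sqr_ge0// ltW.
Qed.

Lemma second_derivative_max (f f' f'' : R -> R) :
  (forall t : R, is_derive t 1 f (f' t)) -> (forall t : R, is_derive t 1 f' (f'' t)) ->
  {for 0, continuous f''} -> (forall t, f t <= f 0) -> f'' 0 <= 0.
Proof.
move=> df df' cf fmax; rewrite leNgt; apply/negP => f0.
have : \forall t \near (0 : R), 0 < f'' t by exact: (cvgr_gt _ cf).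
move=> /nbhs_ballP[e /= e0 eP].
have h0 : e / 2 != 0 by rewrite gt_eqF// divr_gt0.
(* Symmetrizing makes [g' 0 = 0] automatic. Two applications of the mean value theorem, with g'' > 0
   near 0, then give g (e / 2) > g 0, against the maximality of f 0. *)
pose g t := f t + f (- t); pose g' t := f' t - f' (- t); pose g'' t := f'' t + f'' (- t).
have dN (p p' : R -> R) (t : R) : (forall s : R, is_derive s 1 p (p' s)) ->
    is_derive t 1 (fun t : R => p (- t)) (- p' (- t)).
  by move=> dp; rewrite -mulrN1; apply: (@is_derive1_comp _ p (fun t : R => - t)).
have dg (t : R) : is_derive t 1 g (g' t) by apply: is_deriveD; exact: dN.
have dg' (t : R) : is_derive t 1 g' (g'' t).
  by rewrite /g'' -[f'' (- t)]opprK; apply: is_deriveB; exact: dN.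
have [k /andP[k0 k1] E1] := mean_value dg h0.
have kh : k * (e / 2) != 0 by apply: mulf_neq0 => //; rewrite gt_eqF.
have [l /andP[l0 l1]] := mean_value dg' kh.
rewrite /g' oppr0 subrr subr0 => E2.
have : g (e / 2) - g 0 <= 0.
  by rewrite /g oppr0 subr_le0; apply: lerD; exact: fmax.
apply/negP; rewrite -ltNge E1 /g' E2.
have e2 : 0 < e / 2 by rewrite divr_gt0.
rewrite !mulr_gt0// /g''.
have lt1 : l * (k * (e / 2)) < e.
  rewrite (@le_lt_trans _ _ (1 * (1 * (e / 2))))//; last by rewrite !mul1r; lra.
  by rewrite ler_pM ?mulr_ge0 ?ltW// ltr_pM2r.
have p0 : 0 < l * (k * (e / 2)) by rewrite !mulr_gt0.
by apply: addr_gt0; apply: eP; rewrite /ball/= sub0r ?opprK ?normrN gtr0_norm.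
Qed.

End OneDim.

Section Helmholtz.
Variable R : realType.
Local Notation plane := (R * R)%type.
Local Notation mplane := (measurableTypeR R * measurableTypeR R)%type.
Local Notation e := (basis_dir R).
Local Notation I f := (\int[leb2 R]_x f x).

Definition lap (f : plane -> R) : plane -> R :=
  fun x => partial 0 (partial 0 f) x + partial 1 (partial 1 f) x.

Lemma laplacianE f : laplacian f = lap f.
Proof.
apply/funext => x; rewrite /laplacian big_ord_recl big_ord1 /lap.
by congr (partial _ (partial _ f) x + partial _ (partial _ f) x); exact: val_inj.
Qed.

Lemma norm_basis_dir i : `|e i| = 1.
Proof.
rewrite basis_dirE prod_normE/=; case: (i == 0); rewrite /= normr1 normr0.
  exact: max_l.
exact: max_r.
Qed.

Lemma plane_decomp (y z : plane) : y = z + (y.1 - z.1) *: e 0 + (y.2 - z.2) *: e 1.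
Proof.
rewrite !basis_dirE; apply: injective_projections => /=.
  by rewrite !scaleRE mulr1 mulr0 addr0 addrC subrK.
by rewrite !scaleRE mulr1 mulr0 addr0 addrC subrK.
Qed.

Lemma testf_lap f : testf f -> testf (lap f).
Proof. by move=> tf; apply: testfD; do 2 apply: testf_partial. Qed.

Lemma lap_shift b f : smooth2 f -> lap (fun x => f (x + b)) = (fun x => lap f (x + b)).
Proof.
move=> sf; have E i h : smooth2 h -> partial i (fun x => h (x + b)) = (fun x => partial i h (x + b)).
  move=> sh; have := partial_affine i 1 b sh.
  under eq_fun do rewrite scale1r.
  by move=> ->; apply/funext => x; rewrite mul1r scale1r.
by rewrite /lap !E//; exact: smooth2_partial.
Qed.

Variable lam : R.
Hypothesis lam0 : 0 < lam.
Variable g : plane -> R.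
Hypothesis mg : measurable_fun setT (g : mplane -> R).
Hypothesis gi : forall psi, testf psi -> intble (leb2 R) (fun x => g x * psi x).
(** Takes the place of a growth condition at infinity; bounded functions, square-integrable
    functions and their sums all satisfy it. *)
Hypothesis gB : forall psi, testf psi ->
  exists B, forall y, `|I (fun x => g x * psi (x + y))| <= B.
Hypothesis geq : forall psi, testf psi -> I (fun x => g x * (lam * psi x - lap psi x)) = 0.

Let T psi (y : plane) := I (fun x => g x * psi (x + y)).

Let Ti psi y : testf psi -> intble (leb2 R) (fun x => g x * psi (x + y)).
Proof. by move=> tp; apply: gi; exact: testf_shift. Qed.

Let T_derive psi i (y : plane) : testf psi -> is_derive y (e i) (T psi) (T (partial i psi) y).
Proof.
move=> tp; have [sp [M pM]] := tp.
have tp1 := testf_partial i tp; have tp2 := testf_partial i tp1.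
have [K [K0 pK]] : exists K : R, 0 <= K /\ forall x, `|partial i (partial i psi) x| <= K.
  have [C [N [C0 CN]]] := ccf_bounded (testf_ccf tp2).
  exists C; split => // x; apply: le_trans (CN x) _.
  by rewrite indicE; case: (_ \in _); rewrite ?mulr1 ?mulr0.
(* A shift by y + h e_i with |h| <= 1 has norm at most |y| + 1. Outside [box N] all three terms of
   the remainder therefore vanish, and inside it the second derivative bound K applies. *)
pose N := M + `|y| + 1.
pose B := I (fun x => `|g x * \1_(box N) x|).
have bi : intble (leb2 R) (fun x => `|g x * \1_(box N) x|).
  by apply: intble_norm; exact: intble_box.
apply: (@is_derive_quadratic _ _ _ _ _ _ (K * B)) => h h1.
rewrite /T -(RintZ h (Ti y tp1)) -RintB; [|exact: Ti|exact: Ti].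
rewrite -RintB; [|by apply: intbleB; exact: Ti|by apply: intbleZ; exact: Ti].
rewrite [leRHS](_ : _ = I (fun x => (K * h ^+ 2) * `|g x * \1_(box N) x|)); last first.
  by rewrite RintZ// /B; ring.
apply: Rint_norm_le.
- apply: intbleB; first by apply: intbleB; exact: Ti.
  by apply: intbleZ; exact: Ti.
- exact: intbleZ.
move=> x.
have -> : g x * psi (x + (h *: e i + y)) - g x * psi (x + y) - h * (g x * partial i psi (x + y)) =
    g x * (psi (x + (h *: e i + y)) - psi (x + y) - h * partial i psi (x + y)) by ring.
rewrite normrM [`|g x * _|]normrM mulrCA ler_wpM2l//.
have sl := @taylor1_bound R (fun s => psi (x + y + s *: e i))
   (fun s => partial i psi (x + y + s *: e i))
   (fun s => partial i (partial i psi) (x + y + s *: e i)) K h.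
have {sl} : `|psi (x + (h *: e i + y)) - psi (x + y) - h * partial i psi (x + y)| <= K * h ^+ 2.
  have -> : x + (h *: e i + y) = x + y + h *: e i by rewrite addrA addrAC.
  move: sl; rewrite !scale0r !addr0; apply.
  - by move=> t; apply: is_derive_slice; exact: partial_derive.
  - by move=> t; apply: is_derive_slice; apply: partial_derive; exact: smooth2_partial.
  - by move=> t; exact: pK.
have [xN|xN] := boolP (x \in box N); first by rewrite indicE xN normr1 mulr1.
move=> _; rewrite indicE (negPf xN) normr0 mulr0.
have xl : N < `|x|.
  by rewrite ltNge; apply: contra xN => xN; rewrite inE; exact/boxP.
have z0 (z : plane) : `|z| <= `|y| + 1 -> M < `|x + z|.
  move=> zy; have := ler_normB (x + z) z; rewrite addrK => xz.
  by move: xl xz zy; rewrite /N; lra.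
have v0 (q : plane -> R) : (forall x, q x != 0 -> `|x| <= M) -> forall z, `|z| <= `|y| + 1 -> q (x + z) = 0.
  move=> qM z /z0 Mz; apply/eqP; apply: contraTT Mz => /qM.
  by rewrite -leNgt.
have hy : `|h *: e i + y| <= `|y| + 1.
  by rewrite addrC (le_trans (ler_normD _ _))// lerD2l normrZ norm_basis_dir mulr1.
have yy : `|y| <= `|y| + 1 by rewrite lerDl.
by rewrite !v0 ?mulr0 ?subrr ?normr0//; exact: partial_bsupp.
Qed.

(** The partial derivatives of [T psi] are the functions [T] of the partial derivatives of psi,
    which [gB] bounds; y and z are joined by two coordinate segments. *)
Let T_lipschitz psi : testf psi -> exists B, forall y z, `|T psi y - T psi z| <= B * `|y - z|.
Proof.
move=> tp; have [B0 HB0] := gB (testf_partial 0 tp).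
have [B1 HB1] := gB (testf_partial 1 tp).
have B00 := le_trans (normr_ge0 _) (HB0 0); have B10 := le_trans (normr_ge0 _) (HB1 0).
exists (B1 + B0) => y z.
have along i (B : R) : (forall y, `|T (partial i psi) y| <= B) ->
    forall (w : plane) (h : R), `|T psi (w + h *: e i) - T psi w| <= B * `|h|.
  move=> HB w h; have [->|h0] := eqVneq h 0.
    by rewrite scale0r addr0 subrr !normr0 mulr0.
  have := @mean_value R (fun s => T psi (w + s *: e i)) (fun s => T (partial i psi) (w + s *: e i)) h.
  rewrite scale0r addr0; case=> //; first by move=> t; apply: is_derive_slice; exact: T_derive.
  move=> k _ ->; rewrite normrM mulrC ler_wpM2r//.
have E : y = z + (y.1 - z.1) *: e 0 + (y.2 - z.2) *: e 1.
  exact: plane_decomp.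
rewrite {1}E -(subrK (T psi (z + (y.1 - z.1) *: e 0)) (T psi _)) -addrA.
apply: (le_trans (ler_normD _ _)); rewrite mulrDl; apply: lerD.
  apply: le_trans (along 1 B1 HB1 _ _) _; rewrite ler_wpM2l// prod_normE le_max.
  by rewrite /= lexx orbT.
apply: le_trans (along 0 B0 HB0 _ _) _; rewrite ler_wpM2l// prod_normE le_max.
by rewrite /= lexx.
Qed.

Let T_continuous psi : testf psi -> continuous (T psi).
Proof.
move=> /T_lipschitz[B HB] y; apply/cvgrPdist_lt => eps eps0.
have B1 : 0 < `|B| + 1 by rewrite ltr_wpDl.
have eB := divr_gt0 eps0 B1.
have cid' : \forall z \near y, `|y - z| < eps / (`|B| + 1).
  exact: (@cvgrPdist_lt _ _ _ _ _ id y).1 (@cvg_id _ (nbhs y)) _ eB.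
near=> z; apply: le_lt_trans (HB y z) _.
have : `|y - z| < eps / (`|B| + 1).
  near: z; exact: cid'.
rewrite ltr_pdivlMr// mulrC; apply: le_lt_trans.
rewrite ler_wpM2r// (le_trans (ler_norm _))// lerDl//.
Unshelve. all: by end_near. Qed.

Let T_eq psi y : testf psi -> lam * T psi y =
  T (partial 0 (partial 0 psi)) y + T (partial 1 (partial 1 psi)) y.
Proof.
move=> tp; have t0 := testf_partial 0 (testf_partial 0 tp).
have t1 := testf_partial 1 (testf_partial 1 tp).
rewrite /T -(RintZ lam (Ti y tp)) -RintD; [|exact: Ti..].
apply/eqP; rewrite -subr_eq0 -RintB; last 2 first.
- by apply: intbleZ; exact: Ti.
- by apply: intbleD; exact: Ti.
rewrite -[X in _ == X](geq (testf_shift y tp)) lap_shift; last by case: tp.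
have E (l a p q r : R) : l * (a * p) - (a * q + a * r) = a * (l * p - (q + r)) by ring.
by apply/eqP; apply: eq_Rintegral => x _; exact: E.
Qed.

(** [C t] is 2 cosh(c t) and [S] its derivative. With c^2 = lam / 2, each pure second derivative of
    [weight] is lam / 2 times [weight], so that its Laplacian is lam times [weight]. *)
Let c := Num.sqrt (lam / 2).
Let c2 : c ^+ 2 = lam / 2. Proof. by rewrite sqr_sqrtr// divr_ge0// ltW. Qed.
Let c0 : 0 < c. Proof. by rewrite sqrtr_gt0 divr_gt0. Qed.

Let C (t : R) := expR (c * t) + expR (- c * t).
Let S (t : R) := c * (expR (c * t) - expR (- c * t)).

Let dexp (k t : R) : is_derive t 1 (fun t => expR (k * t)) (k * expR (k * t)).
Proof.
rewrite mulrC; apply: (@is_derive1_comp _ expR (fun t : R => k * t)).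
by apply: is_derive_eq; rewrite scaleRE mulr1.
Qed.

Let dC (t : R) : is_derive t 1 C (S t).
Proof.
rewrite (_ : S t = c * expR (c * t) + - c * expR (- c * t)); last by rewrite /S; ring.
by apply: is_deriveD; exact: dexp.
Qed.

Let dS (t : R) : is_derive t 1 S (lam / 2 * C t).
Proof.
rewrite (_ : _ * _ = c *: (c * expR (c * t) - - c * expR (- c * t))); last first.
  by rewrite -c2 scaleRE /C; ring.
by apply: is_deriveZ; apply: is_deriveB; exact: dexp.
Qed.

Let C_ge t : 1 + c * `|t| <= C t.
Proof.
have [t0|t0] := leP 0 t.
  by rewrite ger0_norm//; apply: le_trans (expR_ge1Dx _) _; rewrite /C lerDl expR_ge0.
by rewrite ltr0_norm// mulrN -mulNr; apply: le_trans (expR_ge1Dx _) _; rewrite /C lerDr expR_ge0.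
Qed.

Let C_ge1 t : 1 <= C t.
Proof. by apply: le_trans (C_ge t); rewrite lerDl mulr_ge0// ltW. Qed.

Let weight (y : plane) := C y.1 * C y.2.

Let weight_ge y : c * `|y| <= weight y.
Proof.
have h t s : c * `|t| <= C t * C s.
  apply: (@le_trans _ _ (C t)); first by apply: le_trans (C_ge t); rewrite lerDr.
  by rewrite ler_peMr// (le_trans ler01).
have -> : `|y| = Num.max `|y.1| `|y.2| by rewrite prod_normE.
by rewrite /Order.max; case: ifP => _; [rewrite [leRHS]mulrC|]; exact: h.
Qed.

Let weight_continuous : continuous weight.
Proof.
have cC : continuous C by move=> t; apply/differentiable_continuous/derivable1_diffP; have [] := dC t.
move=> y; apply: cvgM; [apply: (cvg_comp fst C)|apply: (cvg_comp snd C)];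
  [exact: cvg_fst|exact: cC|exact: cvg_snd|exact: cC].
Qed.

Let shiftd (p p' : R -> R) (a k t : R) : (forall s : R, is_derive s 1 p (p' s)) ->
  is_derive t 1 (fun t : R => k * p (a + t)) (k * p' (a + t)).
Proof.
move=> dp; apply: (@is_deriveZ _ _ _ (fun t : R => p (a + t)) k).
have da : is_derive t 1 (fun t : R => a + t) 1 by rewrite -[X in is_derive _ _ _ X]add0r; apply: is_deriveD.
by rewrite -[p' _]mulr1; exact: (@is_derive1_comp _ p (fun t : R => a + t) t _ _ (dp _) da).
Qed.

Let weight_d1 i (z : plane) (k t : R) : is_derive t 1 (fun t : R => k * weight (z + t *: e i))
  (k * (if i == 0 then S (z.1 + t) * C z.2 else C z.1 * S (z.2 + t))).
Proof.
rewrite basis_dirE; case: (i == 0).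
  rewrite (_ : (fun t => _) = fun t => (k * C z.2) * C (z.1 + t)); last first.
    by apply/funext => s; rewrite /weight /= !scaleRE mulr1 mulr0 addr0; ring.
  rewrite [X in is_derive _ _ _ X](_ : _ = (k * C z.2) * S (z.1 + t)); first exact: shiftd.
  ring.
rewrite (_ : (fun t => _) = fun t => (k * C z.1) * C (z.2 + t)); last first.
  by apply/funext => s; rewrite /weight /= !scaleRE mulr1 mulr0 addr0; ring.
rewrite [X in is_derive _ _ _ X](_ : _ = (k * C z.1) * S (z.2 + t)); first exact: shiftd.
ring.
Qed.

Let weight_d2 i (z : plane) (k t : R) : is_derive t 1
  (fun t : R => k * (if i == 0 then S (z.1 + t) * C z.2 else C z.1 * S (z.2 + t)))
  (k * (lam / 2 * weight (z + t *: e i))).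
Proof.
rewrite basis_dirE; case: (i == 0).
  rewrite (_ : (fun t => _) = fun t => (k * C z.2) * S (z.1 + t)); last first.
    by apply/funext => s; ring.
  rewrite [X in is_derive _ _ _ X](_ : _ = (k * C z.2) * (lam / 2 * C (z.1 + t))).
    exact: (@shiftd S (fun t => lam / 2 * C t)).
  by rewrite /weight /= !scaleRE mulr1 mulr0 addr0; ring.
rewrite (_ : (fun t => _) = fun t => (k * C z.1) * S (z.2 + t)); last first.
  by apply/funext => s; ring.
rewrite [X in is_derive _ _ _ X](_ : _ = (k * C z.1) * (lam / 2 * C (z.2 + t))).
  exact: (@shiftd S (fun t => lam / 2 * C t)).
by rewrite /weight /= !scaleRE mulr1 mulr0 addr0; ring.
Qed.

Let slice_continuous (h : plane -> R) i (z : plane) :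
  continuous h -> continuous (fun t : R => h (z + t *: e i)).
Proof.
move=> ch t; apply: (@continuous_comp _ _ _ (fun t : R => z + t *: e i) h); last exact: ch.
by apply: cvgD; [exact: cvg_cst|apply: cvgZr_tmp; exact: cvg_id].
Qed.

(** Maximum principle: if F = T psi - eps weight is positive somewhere it has a positive maximum,
    because T psi is bounded and the weight grows. There both second derivatives are at most 0,
    while their sum is lam F > 0. *)
Let T_le_weight psi eps y : testf psi -> 0 < eps -> T psi y <= eps * weight y.
Proof.
move=> tp eps0; rewrite leNgt; apply/negP => ylt.
have [B HB] := gB tp.
pose F z := T psi z - eps * weight z.
have Fy : 0 < F y by rewrite /F subr_gt0.
(* Beyond norm |B| / (eps c), eps times the weight exceeds the bound of T psi, so F <= 0 outside the
   box; the summand |y| keeps y inside. *)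
pose M := `|y| + `|B| / (eps * c).
have cF : continuous F.
  move=> z; apply: cvgB; first exact: T_continuous.
  by apply: cvgM; [exact: cvg_cst|exact: weight_continuous].
have cK : compact (box M) by apply: compact_setX; exact: segment_compact.
have yM : box M y.
  by apply/boxP; rewrite /M lerDl divr_ge0// mulr_ge0// ltW.
have [||z zM zmax] := @compact_EVT_max _ R F (box M) _ cK.
- by exists y.
- exact: continuous_subspaceT.
have Fz : 0 < F z by apply: lt_le_trans Fy _; apply: zmax; rewrite inE.
have Fmax x : F x <= F z.
  have [xM|xM] := boolP (x \in box M); first exact: zmax.
  apply: le_trans (ltW Fz); rewrite /F subr_le0.
  have {xM} : M < `|x|.
    by rewrite ltNge; apply: contra xM => xM; rewrite inE; exact/boxP.
  move=> Mx; have : `|B| / (eps * c) <= `|x|.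
    by apply: le_trans (ltW Mx); rewrite /M lerDr.
  rewrite ler_pdivrMr ?mulr_gt0// => Bx.
  apply: le_trans (ler_norm _) _; apply: le_trans (HB x) _.
  apply: le_trans (ler_norm _) _; apply: le_trans Bx _.
  by rewrite mulrCA ler_wpM2l ?(ltW eps0)// mulrC weight_ge.
have dd i : T (partial i (partial i psi)) z - eps * (lam / 2 * weight z) <= 0.
  have tp1 := testf_partial i tp; have tp2 := testf_partial i tp1.
  have := @second_derivative_max R (fun t => T psi (z + t *: e i) - eps * weight (z + t *: e i))
    (fun t => T (partial i psi) (z + t *: e i) -
       eps * (if i == 0 then S (z.1 + t) * C z.2 else C z.1 * S (z.2 + t)))
    (fun t => T (partial i (partial i psi)) (z + t *: e i) - eps * (lam / 2 * weight (z + t *: e i))).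
  rewrite scale0r addr0; apply.
  - move=> t; apply: is_deriveB; last exact: weight_d1.
    by apply: is_derive_slice; exact: T_derive.
  - move=> t; apply: is_deriveB; last exact: weight_d2.
    by apply: is_derive_slice; exact: T_derive.
  - apply: (@slice_continuous (fun w => T (partial i (partial i psi)) w - eps * (lam / 2 * weight w))).
    move=> w; apply: cvgB; first exact: T_continuous.
    apply: cvgM; first exact: cvg_cst.
    by apply: cvgM; [exact: cvg_cst|exact: weight_continuous].
  - by move=> t; exact: Fmax.
have := lerD (dd 0) (dd 1); rewrite addr0.
rewrite (_ : _ + _ = lam * F z); first by rewrite leNgt mulr_gt0.
have E (a b x t : R) : a - x * (lam / 2 * t) + (b - x * (lam / 2 * t)) = a + b - lam * (x * t) by field.
by rewrite /F mulrBr (T_eq _ tp) E.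
Qed.

Let T0_le psi : testf psi -> T psi 0 <= 0.
Proof.
move=> tp; rewrite leNgt; apply/negP => T0.
have W : 0 < weight 0 by rewrite /weight mulr_gt0// (lt_le_trans ltr01).
have := T_le_weight 0 tp (divr_gt0 T0 (mulr_gt0 (ltr0Sn R 1) W)).
rewrite [T psi 0 / _ * _](_ : _ = T psi 0 / 2); last by field; rewrite gt_eqF.
by apply/negP; rewrite -ltNge ltr_pdivrMr// ltr_pMr// ltr1n.
Qed.

(* [T psi y = \int g(x) psi(x + y) dx] is bounded and satisfies
   [Delta (T psi) = lam T psi]; comparing it with multiples of [weight], a
   solution of the same equation that grows at infinity, gives [T psi <= 0]. *)
Lemma helmholtz_unique : {ae leb2 R, forall x, g x = 0}.
Proof.
apply: du_Bois_Reymond_tensor => //.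
move=> n a b c' d; have tp := testf_step n a b c' d.
set psi := (X in testf X) in tp.
have E p : testf p -> T p 0 = I (fun x => g x * p x).
  by move=> _; apply: eq_Rintegral => x _; rewrite addr0.
rewrite -[LHS](E psi)//; apply/eqP; rewrite eq_le (T0_le tp)/= -oppr_le0.
rewrite -[X in X <= _](_ : T (fun x => - psi x) 0 = _); first exact: T0_le (testfN tp).
rewrite /T -RintN; last exact: Ti.
by apply: eq_Rintegral => x _; rewrite mulrN.
Qed.

End Helmholtz.

(** * The Riesz representation theorem in L^2 *)

Section Hilbert.
Context d (T : measurableType d) (R : realType).
Variable mu : {measure set T -> \bar R}.
Local Notation I f := (\int[mu]_x f x).

Lemma quadratic_ge0 (a b c : R) : 0 <= c -> (forall t, 0 <= a + 2 * t * b + t ^+ 2 * c) ->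
  b ^+ 2 <= a * c.
Proof.
rewrite le_eqVlt => /predU1P[<-|c0] h.
  have [->|b0] := eqVneq b 0; first by rewrite expr0n mulr0.
  have := h (- (a + 1) / (2 * b)).
  rewrite mulr0 addr0 [2 * _ * _](_ : _ = - (a + 1)); first by rewrite opprD addrA subrr add0r ler0N1.
  by field.
have := h (- b / c); have -> : a + 2 * (- b / c) * b + (- b / c) ^+ 2 * c = (a * c - b ^+ 2) / c.
  by field; rewrite gt_eqF.
by rewrite pmulr_lge0 ?invr_gt0// subr_ge0.
Qed.

Lemma cvg0_sqr (s u : nat -> R) (K : R) : (forall n, s n ^+ 2 <= K * u n) ->
  u n @[n --> \oo] --> (0 : R) -> s n @[n --> \oo] --> (0 : R).
Proof.
move=> su u0; have h : Num.sqrt (K * u n) @[n --> \oo] --> (0 : R).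
  rewrite -[X in _ --> X](@sqrtr0 R); apply: continuous_cvg; first exact: sqrt_continuous.
  by rewrite -[X in _ --> X](mulr0 K); apply: cvgM => //; exact: cvg_cst.
apply: (@squeeze_cvgr _ _ _ _ (fun n => - Num.sqrt (K * u n)) (fun n => Num.sqrt (K * u n))) => //.
  apply: nearW => n; rewrite -ler_norml -sqrtr_sqr; exact: ler_wsqrtr.
by rewrite -oppr0; exact: cvgN.
Qed.

Lemma cvg_sub_cst (u : nat -> R) (a : R) : (fun m => u m - a) @ \oo --> (0 : R) -> u @ \oo --> a.
Proof.
move=> h; rewrite (_ : u = fun m => (u m - a) + a); last by apply/funext => m; rewrite subrK.
by rewrite -[X in _ --> X]add0r; apply: cvgD => //; exact: cvg_cst.
Qed.

Lemma cvg_sum0 (J : Type) (r : seq J) (u : J -> nat -> R) : (forall j, u j @ \oo --> (0 : R)) ->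
  (fun m => \sum_(j <- r) u j m) @ \oo --> (0 : R).
Proof.
move=> hu; elim: r => [|j r IH].
  rewrite (_ : (fun m => _) = fun=> 0); first exact: cvg_cst.
  by apply/funext => m; rewrite big_nil.
rewrite (_ : (fun m => _) = fun m => u j m + \sum_(k <- r) u k m); last first.
  by apply/funext => m; rewrite big_cons.
by rewrite -[X in _ --> X]addr0; apply: cvgD.
Qed.

Lemma le_of_sqr (a b : R) : 0 <= b -> a ^+ 2 <= b ^+ 2 -> a <= b.
Proof. by move=> b0 ab; rewrite leNgt; apply/negP => lt; nra. Qed.

Lemma le_cvg (a : R) (u v : nat -> R) (b : R) : (forall m, u m <= v m) ->
  u @ \oo --> a -> v @ \oo --> b -> a <= b.
Proof.
move=> uv ua vb; rewrite -(cvg_lim (@Rhausdorff R) ua) -(cvg_lim (@Rhausdorff R) vb).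
by apply: ler_lim; [exact: cvgP ua|exact: cvgP vb|exact: nearW].
Qed.

Variable n : nat.
Implicit Types h k l : 'I_n -> T -> R.

Definition l2 h := forall j, sqint mu (h j).
Definition dot h k := \sum_(j < n) I (fun x => h j x * k j x).
Definition comb (a : R) h k : 'I_n -> T -> R := fun j x => a * h j x + k j x.

Lemma dotC h k : dot h k = dot k h.
Proof. by apply: eq_bigr => j _; apply: eq_Rintegral => x _; rewrite mulrC. Qed.

Lemma l2_comb a h k : l2 h -> l2 k -> l2 (comb a h k).
Proof. by move=> lh lk j; apply: sqintD => //; exact: sqintZ. Qed.

Lemma dot_combl a h k l : l2 h -> l2 k -> l2 l ->
  dot (comb a h k) l = a * dot h l + dot k l.
Proof.
move=> lh lk ll; rewrite /dot mulr_sumr -big_split; apply: eq_bigr => j _ /=.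
rewrite -RintZ; last exact: sqint_intbleM.
rewrite -RintD; [|by apply: intbleZ; exact: sqint_intbleM|exact: sqint_intbleM].
by apply: eq_Rintegral => x _; rewrite /comb mulrDl mulrA.
Qed.

Lemma dot_combr a h k l : l2 h -> l2 k -> l2 l ->
  dot l (comb a h k) = a * dot l h + dot l k.
Proof. by move=> lh lk ll; rewrite dotC dot_combl// ![dot l _]dotC. Qed.

Lemma dot_ge0 h : 0 <= dot h h.
Proof. by apply: sumr_ge0 => j _; apply: Rint_ge0 => x; rewrite -expr2 sqr_ge0. Qed.

Lemma dot_comb a h k : l2 h -> l2 k ->
  dot (comb a h k) (comb a h k) = a ^+ 2 * dot h h + 2 * a * dot h k + dot k k.
Proof.
move=> lh lk; have lc := l2_comb a lh lk.
by rewrite dot_combl// !dot_combr// (dotC k h); ring.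
Qed.

Lemma dot_CS h k : l2 h -> l2 k -> dot h k ^+ 2 <= dot h h * dot k k.
Proof.
move=> lh lk; rewrite mulrC dotC mulrC; apply: quadratic_ge0; first exact: dot_ge0.
move=> t; have := dot_ge0 (comb t k h); rewrite dot_comb// [dot k h]dotC.
by rewrite -addrA addrC [_ + dot h h]addrC (dotC h k).
Qed.

Lemma dot_ge_comp h j : l2 h -> I (fun x => h j x ^+ 2) <= dot h h.
Proof.
move=> lh; rewrite /dot (bigD1 j)//= -[leLHS]addr0; apply: lerD.
  by rewrite le_eqVlt; apply/orP; left; apply/eqP; apply: eq_Rintegral => x _; rewrite expr2.
by apply: sumr_ge0 => i _; apply: Rint_ge0 => x; rewrite -expr2 sqr_ge0.
Qed.

Definition l2cvg (f : nat -> 'I_n -> T -> R) h :=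
  dot (comb (-1) h (f m)) (comb (-1) h (f m)) @[m --> \oo] --> (0 : R).

Lemma l2cvg_dot f h k : (forall m, l2 (f m)) -> l2 h -> l2 k -> l2cvg f h ->
  dot (f m) k @[m --> \oo] --> dot h k.
Proof.
move=> lf lh lk fh; apply: cvg_sub_cst; apply: (@cvg0_sqr _ (fun m => dot (comb (-1) h (f m)) (comb (-1) h (f m))) (dot k k)) => // m.
rewrite mulrC [X in X ^+ 2](_ : _ = dot (comb (-1) h (f m)) k); last first.
  by rewrite dot_combl// mulN1r addrC.
by apply: dot_CS => //; exact: l2_comb.
Qed.

Lemma l2cvg_norm (f : nat -> 'I_n -> T -> R) h : (forall m, l2 (f m)) -> l2 h -> l2cvg f h ->
  dot (f m) (f m) @[m --> \oo] --> dot h h.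
Proof.
move=> lf lh fh; have fh1 := l2cvg_dot lf lh lh fh.
rewrite (_ : (fun m => _) = fun m => dot (comb (-1) h (f m)) (comb (-1) h (f m)) +
    (2 * dot (f m) h - dot h h)); last first.
  by apply/funext => m; rewrite dot_comb// (dotC h); ring.
rewrite -[X in _ --> X](_ : 0 + (2 * dot h h - dot h h) = _); last by ring.
apply: cvgD => //; apply: cvgB; last exact: cvg_cst.
by apply: cvgM => //; exact: cvg_cst.
Qed.

(** D carries the scalar product pulled back by L and need not be complete. A minimizing sequence of
    |L x|^2 - 2 F x is Cauchy in L^2; its limit h represents F. The sequence is part of the
    conclusion because it shows that h is approximated by elements of D, which later gives
    density. *)
Lemma riesz (X : lmodType R) (D : set X) (L : X -> 'I_n -> T -> R) (F : X -> R) (C : R) :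
  D 0 -> (forall a x y, D x -> D y -> D (a *: x + y)) ->
  (forall x, D x -> l2 (L x)) ->
  (forall a x y, D x -> D y -> L (a *: x + y) = comb a (L x) (L y)) ->
  (forall a x y, D x -> D y -> F (a *: x + y) = a * F x + F y) ->
  (forall x, D x -> F x ^+ 2 <= C * dot (L x) (L x)) -> 0 <= C ->
  exists h xn, [/\ l2 h, forall m, D (xn m), l2cvg (L \o xn) h,
    forall x, D x -> dot h (L x) = F x & dot h h <= C].
Proof.
move=> D0 Dl Ll2 Llin Flin FC C0.
pose e x := dot (L x) (L x); have e0 x : 0 <= e x by exact: dot_ge0.
pose J x := e x - 2 * F x.
have JC x : D x -> - C <= J x.
  move=> Dx; rewrite /J -subr_ge0 opprK addrAC subr_ge0; apply: le_of_sqr.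
    by rewrite addr_ge0.
  by have := FC x Dx; have := sqr_ge0 (C - e x); rewrite -/(e x); nra.
have hJ : has_inf [set J x | x in D].
  by split; [exists (J 0); exists 0|exists (- C) => _ [x Dx <-]; exact: JC].
pose m := inf [set J x | x in D].
have mJ x : D x -> m <= J x.
  by move=> Dx; apply: ge_inf; [case: hJ|exists x].
have /choice[xn xnP] : forall i : nat, exists x, D x /\ J x <= m + i.+1%:R^-1.
  move=> i; have [] := @inf_adherent _ [set J x | x in D] i.+1%:R^-1 _ hJ.
    by rewrite invr_gt0.
  by move=> _ [x Dx <-] /ltW; exists x.
have xD i : D (xn i) := (xnP i).1.
pose dl (i : nat) : R := i.+1%:R^-1.
have dl0 : dl i @[i --> \oo] --> (0 : R) by exact: cvg_harmonic.
have var i x : D x -> (dot (L (xn i)) (L x) - F x) ^+ 2 <= dl i * e x.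
  move=> Dx; apply: quadratic_ge0 => // t.
  have := mJ _ (Dl t _ _ Dx (xD i)); have := (xnP i).2; rewrite /J -/(dl i).
  have -> : e (t *: x + xn i) = t ^+ 2 * e x + 2 * t * dot (L (xn i)) (L x) + e (xn i).
    rewrite /e Llin//.
    rewrite dot_comb; [|exact: Ll2..].
    by rewrite (dotC (L x)).
  rewrite Flin//; set a := dot _ _.
  move: (e x) (e (xn i)) (F x) (F (xn i)) (dl i) => ex ei fx fi di h1 h2; clearbody m a; lra.
(* Both L (xn i) and L (xn k) nearly represent F, so [var] is used for both indices at x = xn i - xn
   k. The square of e x is then at most 2 (dl i + dl k) e x, and one factor e x cancels. *)
have cau (i k : nat) : dot (comb (-1) (L (xn k)) (L (xn i))) (comb (-1) (L (xn k)) (L (xn i)))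
    <= 2 * (dl i + dl k).
  have Dx := Dl (-1) _ _ (xD k) (xD i); set x := (X in D X) in Dx.
  have Ex : L x = comb (-1) (L (xn k)) (L (xn i)) by exact: Llin.
  have := var i x Dx; have := var k x Dx.
  have eE : e x = dot (L (xn i)) (L x) - dot (L (xn k)) (L x).
    by have := dot_combl (-1) (Ll2 _ (xD k)) (Ll2 _ (xD i)) (Ll2 _ Dx); rewrite -Ex mulN1r addrC.
  rewrite -Ex -/(e x) eE; set a := dot _ _; set b := dot _ _; rewrite -eE => h1 h2.
  have : e x ^+ 2 <= 2 * (dl i + dl k) * e x.
    have key (p q f A B : R) : (p - f) ^+ 2 <= A -> (q - f) ^+ 2 <= B -> (q - p) ^+ 2 <= 2 * (B + A).
      by move=> hA hB; have := sqr_ge0 ((p - f) + (q - f)); nra.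
    have := key _ _ _ _ _ h1 h2; rewrite -eE => h3; apply: le_trans h3 _.
    by rewrite -mulrDl mulrA.
  have := e0 x; rewrite le_eqVlt => /predU1P[<- _|ex].
    by rewrite mulr_ge0// addr_ge0// invr_ge0.
  by rewrite expr2 ler_pM2r.
have /choice[h hP] : forall j, exists g, sqint mu g /\
    forall eps, 0 < eps -> exists N, forall i, (N <= i)%N -> I (fun x => (L (xn i) j x - g x) ^+ 2) <= eps.
  move=> j; have [|eps eps0|g] := @sqint_complete _ _ _ mu (fun i => L (xn i) j).
  - by move=> i; exact: Ll2.
  - have : \forall i \near \oo, dl i < eps / 4.
      by apply: (cvgr_lt (0 : R)) => //; rewrite divr_gt0.
    move=> [N _ NP]; exists N => i k Ni Nk.
    have := dot_ge_comp j (l2_comb (-1) (Ll2 _ (xD k)) (Ll2 _ (xD i))).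
    have := cau i k; have := NP _ Ni; have := NP _ Nk => /= h1 h2 h3 h4.
    apply: (@le_trans _ _ (2 * (dl i + dl k))); last by lra.
    apply: le_trans h3; apply: le_trans h4.
    rewrite le_eqVlt; apply/orP; left; apply/eqP; apply: eq_Rintegral => x _.
    by rewrite /comb mulN1r addrC.
  - by move=> sg gP; exists g.
have lh : l2 h by move=> j; case: (hP j).
have lx i : l2 (L (xn i)) by exact: Ll2.
have xh : l2cvg (L \o xn) h.
  apply: cvg_sum0 => j; apply/cvgrPdist_le => eps eps0.
  have [N NP] := (hP j).2 _ eps0; exists N => // i /= Ni.
  rewrite sub0r normrN ger0_norm; last by apply: Rint_ge0 => x; rewrite -expr2 sqr_ge0.
  apply: le_trans (NP _ Ni).
  rewrite le_eqVlt; apply/orP; left; apply/eqP; apply: eq_Rintegral => x _.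
  by rewrite /comb mulN1r addrC expr2.
have hF x : D x -> dot h (L x) = F x.
  move=> Dx; have h1 := l2cvg_dot lx lh (Ll2 _ Dx) xh.
  have h2 : dot ((L \o xn) i) (L x) @[i --> \oo] --> F x.
    apply: cvg_sub_cst; apply: (@cvg0_sqr _ dl (e x)) => // i.
    by rewrite mulrC; exact: var.
  by rewrite -(cvg_lim (@Rhausdorff R) h1) (cvg_lim (@Rhausdorff R) h2).
exists h, xn; split => //.
have Fh : F (xn i) @[i --> \oo] --> dot h h.
  by under eq_fun do rewrite -hF// dotC; exact: l2cvg_dot.
have eh : e (xn i) @[i --> \oo] --> dot h h by exact: (l2cvg_norm lx lh xh).
(* The bound [FC] along the sequence passes to the limit, since F (xn i) and e (xn i) both tend to
   the squared norm of h. *)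
have : dot h h ^+ 2 <= C * dot h h.
  apply: (le_cvg (u := fun i => F (xn i) ^+ 2) (v := fun i => C * e (xn i))).
  - by move=> i; exact: FC.
  - by under eq_fun do rewrite expr2; rewrite expr2; exact: cvgM.
  - by apply: cvgM => //; exact: cvg_cst.
have := dot_ge0 h; rewrite le_eqVlt => /predU1P[<- //|hh].
by rewrite expr2 ler_pM2r.
Qed.

End Hilbert.

(** * Second derivatives and existence of the Green function *)

Lemma ae0_Rint d (T : measurableType d) (R : realType) (mu : {measure set T -> \bar R}) (f : T -> R) :
  measurable_fun setT f -> {ae mu, forall x, f x = 0} -> \int[mu]_x f x = 0.
Proof.
move=> mf f0; have [|_ <-] := ae_Rint (intble0 mu) mf; last exact: Rint_cst0.
by apply: filterS f0 => x ->.
Qed.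

Lemma ae_imp d (T : measurableType d) (R : realType) (mu : {measure set T -> \bar R}) (P Q : T -> Prop) :
  {ae mu, forall x, P x} -> (forall x, P x -> Q x) -> {ae mu, forall x, Q x}.
Proof. by move=> aeP PQ; apply: filterS aeP. Qed.

Lemma Rint_mulself d (T : measurableType d) (R : realType) (mu : {measure set T -> \bar R}) (f : T -> R) :
  \int[mu]_x (f x * f x) = \int[mu]_x (f x ^+ 2).
Proof. by apply: eq_Rintegral => x _; rewrite expr2. Qed.

Lemma Rint_helmholtz d (T : measurableType d) (R : realType) (mu : {measure set T -> \bar R})
  (l : R) (g f p q : T -> R) : intble mu (fun x => g x * f x) ->
  intble mu (fun x => g x * p x) -> intble mu (fun x => g x * q x) ->
  \int[mu]_x (g x * (l * f x - (p x + q x))) =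
  l * \int[mu]_x (g x * f x) - \int[mu]_x (g x * p x) - \int[mu]_x (g x * q x).
Proof.
move=> gf gp gq; have lgf := intbleZ l gf; rewrite -RintZ// -RintB// -RintB//; last exact: intbleB.
by apply: eq_Rintegral => x _; ring.
Qed.

Lemma young d (T : measurableType d) (R : realType) (mu : {measure set T -> \bar R}) (l : R) (f k : T -> R) :
  0 < l -> sqint mu f -> sqint mu k ->
  \int[mu]_x (f x * k x) <= l / 2 * \int[mu]_x (f x ^+ 2) + (2 * l)^-1 * \int[mu]_x (k x ^+ 2).
Proof.
move=> l0 sf sk; have [_ f2] := sf; have [_ k2] := sk.
have lf := intbleZ (l / 2) f2; have lk := intbleZ (2 * l)^-1 k2.
rewrite -!RintZ// -RintD//; apply: Rint_le; [exact: sqint_intbleM|exact: intbleD|].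
move=> x; move: (f x) (k x) => a b.
have -> : l / 2 * a ^+ 2 + (2 * l)^-1 * b ^+ 2 = a * b + (l * a - b) ^+ 2 / (2 * l).
  by field; rewrite gt_eqF.
by rewrite lerDl divr_ge0 ?sqr_ge0// mulr_ge0// ltW.
Qed.

Lemma opp_young d (T : measurableType d) (R : realType) (mu : {measure set T -> \bar R}) (f k : T -> R) :
  sqint mu f -> sqint mu k ->
  - (\int[mu]_x (f x * k x)) <= \int[mu]_x (f x ^+ 2) + \int[mu]_x (k x ^+ 2).
Proof.
move=> sf sk; have [_ f2] := sf; have [_ k2] := sk; have fk := sqint_intbleM sf sk.
rewrite -RintN// -RintD//; apply: Rint_le; [exact: intbleN|exact: intbleD|].
by move=> x; move: (f x) (k x) => a b; nra.
Qed.

#[local] Opaque partial.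

Section Elliptic.
Variable R : realType.
Local Notation plane := (R * R)%type.
Local Notation leb := (@lebesgue_measure R).
Local Notation I f := (\int[leb2 R]_x f x).
Local Notation N f := (\int[leb2 R]_x (f x ^+ 2)).
Implicit Types f g : plane -> R.

(** The derivative 2 h h' of h^2 is at most h^2 + h'^2 in absolute value. *)
Lemma sqr_le_Rint (h h' : R -> R) (M t : R) : (forall t : R, is_derive t 1 h (h' t)) ->
  continuous h' -> (forall t, h t != 0 -> `|t| <= M) ->
  intble leb (fun s => h s ^+ 2 + h' s ^+ 2) -> h t ^+ 2 <= \int[leb]_s (h s ^+ 2 + h' s ^+ 2).
Proof.
move=> dh ch' hM hi; have ch : continuous h.
  by move=> s; apply/differentiable_continuous/derivable1_diffP; have [] := dh s.
have dh2 (s : R) : is_derive s 1 (fun s => h s * h s) (2 * (h s * h' s)).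
  rewrite (_ : 2 * _ = h s *: h' s + h s *: h' s); first exact: is_deriveM.
  by rewrite scaleRE; ring.
have c2 : continuous (fun s => 2 * (h s * h' s)).
  by move=> s; apply: cvgM; [exact: cvg_cst|apply: cvgM; [exact: ch|exact: ch']].
have hM2 s : h s * h s != 0 -> `|s| <= M by rewrite mulf_eq0 orbb; exact: hM.
have := @norm_le_Rint_derive R _ _ M dh2 c2 hM2 t.
rewrite -expr2 ger0_norm ?sqr_ge0// => h1; apply: le_trans h1 _.
apply: Rint_le => //; first by apply: intble_norm; exact: (@derive_intble R _ _ M dh2).
move=> s; move: (h s) (h' s) => a b; rewrite ler_norml; apply/andP; split.
  by have := sqr_ge0 (a + b); nra.
by have := sqr_ge0 (a - b); nra.
Qed.

Lemma testfM_intble f g : testf f -> testf g -> intble (leb2 R) (fun x => f x * g x).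
Proof. by move=> tf tg; apply: testf_intble; apply: testfMl => //; case: tf. Qed.

Lemma testf_sqr f : testf f -> testf (fun x => f x ^+ 2).
Proof. by move=> tf; under eq_fun do rewrite expr2; apply: testfMl => //; case: tf. Qed.

(** The one-dimensional bound is used on the horizontal axis for f, then on the vertical lines for f
    and for its first partial derivative. The mixed derivative is the only one of second order that
    enters. *)
Lemma testf_sqr_le f : testf f -> f 0 ^+ 2 <=
  N f + N (partial 1 f) + (N (partial 0 f) + N (partial 1 (partial 0 f))).
Proof.
move=> tf; have [sf [M fM]] := tf.
have t0 := testf_partial 0 tf; have t1 := testf_partial 1 tf.
have t10 := testf_partial 1 t0.
have tk (g : plane -> R) : testf g -> testf (fun x => g x ^+ 2 + partial 1 g x ^+ 2).
  by move=> tg; apply: testfD; apply: testf_sqr => //; exact: testf_partial.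
have inner (g : plane -> R) (s : R) : testf g -> g (s, 0) ^+ 2 <= \int[leb]_t (g (s, t) ^+ 2 + partial 1 g (s, t) ^+ 2).
  move=> tg; have [sg [L gL]] := tg.
  apply: (@sqr_le_Rint (fun t => g (s, t)) (fun t => partial 1 g (s, t)) L).
  - by move=> t; exact: slice_derive2.
  - move=> t; apply: (@cvg_comp _ _ _ (fun t : R => (s, t)) (partial 1 g) (nbhs t) (nbhs (s, t))).
      exact: continuous_pair2.
    exact: (smooth2_continuous (smooth2_partial 1 sg)).
  - by move=> t /gL; rewrite prod_normE ge_max => /andP[].
  - exact: (ccf_slice2 s (testf_ccf (tk _ tg))).
have outer : f (0, 0) ^+ 2 <= \int[leb]_s (f (s, 0) ^+ 2 + partial 0 f (s, 0) ^+ 2).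
  apply: (@sqr_le_Rint (fun t => f (t, 0)) (fun t => partial 0 f (t, 0)) M).
  - by move=> t; exact: slice_derive1.
  - move=> t; apply: (@cvg_comp _ _ _ (fun t : R => (t, 0)) (partial 0 f) (nbhs t) (nbhs (t, 0))).
      exact: continuous_pair1.
    exact: (smooth2_continuous (smooth2_partial 0 sf)).
  - by move=> t /fM; rewrite prod_normE ge_max => /andP[].
  - exact: (ccf_slice1 0 (testf_ccf (testfD (testf_sqr tf) (testf_sqr t0)))).
have i2 g : testf g -> intble (leb2 R) (fun x => g x ^+ 2).
  by move=> tg; exact: testf_intble (testf_sqr tg).
pose a (s : R) := \int[leb]_t (f (s, t) ^+ 2 + partial 1 f (s, t) ^+ 2).
pose b (s : R) := \int[leb]_t (partial 0 f (s, t) ^+ 2 + partial 1 (partial 0 f) (s, t) ^+ 2).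
have [i1 e1] : intble leb a /\ I (fun x => f x ^+ 2 + partial 1 f x ^+ 2) = \int[leb]_s a s.
  exact: ccf_fubini2 (testf_ccf (tk _ tf)).
have [i3 e3] : intble leb b /\
    I (fun x => partial 0 f x ^+ 2 + partial 1 (partial 0 f) x ^+ 2) = \int[leb]_s b s.
  exact: ccf_fubini2 (testf_ccf (tk _ t0)).
have fa (s : R) : f (s, 0) ^+ 2 + partial 0 f (s, 0) ^+ 2 <= a s + b s.
  by apply: lerD; exact: inner.
clearbody a b.
rewrite -RintD; [|exact: i2..].
rewrite -RintD; [|exact: i2..].
rewrite e1 e3 -(RintD (mu := leb))//; apply: le_trans outer _.
apply: (Rint_le (mu := leb)) => //; last exact: intbleD.
exact: (ccf_slice1 0 (testf_ccf (testfD (testf_sqr tf) (testf_sqr t0)))).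
Qed.

Lemma partial_tensor (p q p' q' : R -> R) : smooth1 p -> smooth1 q ->
  (forall t : R, is_derive t 1 p (p' t)) -> (forall t : R, is_derive t 1 q (q' t)) ->
  partial 0 (fun x : plane => p x.1 * q x.2) = (fun x => p' x.1 * q x.2) /\
  partial 1 (fun x : plane => p x.1 * q x.2) = (fun x => p x.1 * q' x.2).
Proof.
move=> sp sq dp dq; have st := smooth2_tensor sp sq.
split; apply/funext => -[s t] /=.
  have [_ <-] := slice_derive1 t s st; rewrite /= mulrC.
  have : is_derive s 1 (fun s => q t * p s) (q t * p' s) by exact: is_deriveZ.
  by under eq_fun do rewrite mulrC; case.
have [_ <-] := slice_derive2 s t st; rewrite /=.
by have [] : is_derive t 1 (fun t => p s * q t) (p s * q' t) by exact: is_deriveZ.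
Qed.

Lemma partial_tensorC (p q : R -> R) : smooth1 p -> smooth1 q ->
  partial 0 (partial 1 (fun x : plane => p x.1 * q x.2)) =
  partial 1 (partial 0 (fun x : plane => p x.1 * q x.2)).
Proof.
move=> sp sq; have [p' sp' dp] := smooth1_derive sp; have [q' sq' dq] := smooth1_derive sq.
have [p'' sp'' dp'] := smooth1_derive sp'; have [q'' sq'' dq'] := smooth1_derive sq'.
have [-> ->] := partial_tensor sp sq dp dq.
by have [-> _] := partial_tensor sp sq' dp dq'; have [_ ->] := partial_tensor sp' sq dp' dq.
Qed.

(* The difference [d] of the mixed derivatives vanishes almost everywhere, by
   testing against tensor products; so do its derivatives, and
   [testf_sqr_le] then gives [d 0 = 0]. *)
Lemma partialC f : testf f -> partial 0 (partial 1 f) = partial 1 (partial 0 f).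
Proof.
move=> tf; have t10 := testf_partial 1 (testf_partial 0 tf).
have t01 := testf_partial 0 (testf_partial 1 tf).
pose d x := partial 0 (partial 1 f) x - partial 1 (partial 0 f) x.
have td : testf d by exact: testfB.
have ibp i (g h : plane -> R) : testf g -> testf h -> I (fun x => partial i g x * h x) = - I (fun x => g x * partial i h x).
  by move=> tg th; rewrite Rint_by_parts ?opprK//; case: tg.
have ae0 : {ae leb2 R, forall x, d x = 0}.
  apply: du_Bois_Reymond_tensor.
  - by apply: continuous_plane_measurable; case: td => /smooth2_continuous.
  - by move=> psi tp; exact: testfM_intble.
  move=> n a b c e; have tp := testf_step n a b c e; set psi := (X in testf X) in tp.
  transitivity (I (fun x => partial 0 (partial 1 f) x * psi x) - I (fun x => partial 1 (partial 0 f) x * psi x)).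
    rewrite -RintB; [|exact: testfM_intble..].
    by apply: eq_Rintegral => x _; rewrite /d mulrBl.
  have tpsi i := testf_partial i tp.
  have E1 := ibp 0 _ psi (testf_partial 1 tf) tp; have E2 := ibp 1 _ psi (testf_partial 0 tf) tp.
  have E3 := ibp 1 f _ tf (tpsi 0); have E4 := ibp 0 f _ tf (tpsi 1).
  have C : partial 0 (partial 1 psi) = partial 1 (partial 0 psi).
    exact: (partial_tensorC (smooth1_step n a b) (smooth1_step n c e)).
  rewrite C in E4; clearbody psi.
  have F1 := etrans E1 (congr1 -%R E3); have F2 := etrans E2 (congr1 -%R E4).
  exact: (etrans (congr2 (fun u v : R => u - v) F1 F2) (subrr _)).
have N0 g : testf g -> {ae leb2 R, forall x, g x = 0} -> N g = 0.
  move=> tg g0; apply: ae0_Rint; first exact: intble_meas (testf_intble (testf_sqr tg)).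
  by apply: (ae_imp g0) => x ->; rewrite expr0n.
have ae0p g i : testf g -> {ae leb2 R, forall x, g x = 0} -> {ae leb2 R, forall x, partial i g x = 0}.
  move=> tg g0; have tg1 := testf_partial i tg; have tg2 := testf_partial i tg1.
  have : N (partial i g) = 0.
    rewrite -Rint_mulself.
    rewrite (ibp i g _ tg tg1); apply/eqP; rewrite oppr_eq0; apply/eqP; apply: ae0_Rint.
      exact: intble_meas (testfM_intble tg tg2).
    by apply: (ae_imp g0) => x ->; rewrite mul0r.
  move/(Rint_eq0 (testf_intble (testf_sqr tg1)) (fun x => sqr_ge0 _)).
  by move/ae_imp; apply => x /eqP; rewrite sqrf_eq0 => /eqP.
have d00 b : d b = 0.
  pose db x := d (x + b).
  have tdb : testf db by exact: testf_shift.
  have sd := proj1 td.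
  have shift i g : smooth2 g -> partial i (fun x => g (x + b)) = (fun x => partial i g (x + b)).
    move=> sg; have := partial_affine i 1 b sg.
    under eq_fun do rewrite scale1r.
    by move=> ->; apply/funext => x; rewrite mul1r scale1r.
  have Ns g : testf g -> N (fun x => g (x + b)) = N g.
    move=> tg; rewrite [RHS](Rint_affine b ltr01 (testf_intble (testf_sqr tg))) expr1n mul1r.
    by apply: eq_Rintegral => x _; rewrite scale1r.
  have := testf_sqr_le tdb; rewrite /db add0r !shift//; last exact: smooth2_partial.
  have a0 := ae0p _ 0 td ae0; have td0 := testf_partial 0 td.
  have le0 (g : plane -> R) : testf g -> {ae leb2 R, forall x, g x = 0} -> N (fun x => g (x + b)) <= 0.
    by move=> tg g0; rewrite Ns// N0.
  have E0 := le0 _ td ae0; have E1 := le0 _ (testf_partial 1 td) (ae0p _ _ td ae0).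
  have E2 := le0 _ td0 a0; have E3 := le0 _ (testf_partial 1 td0) (ae0p _ _ td0 a0).
  move=> h; have := le_trans h (lerD (lerD E0 E1) (lerD E2 E3)).
  by rewrite !addr0 => d2; apply/eqP; rewrite -sqrf_eq0 eq_le d2 sqr_ge0.
by apply/funext => x; apply/eqP; rewrite -subr_eq0; apply/eqP; exact: (d00 x).
Qed.

Variable lam : R.
Hypothesis lam0 : 0 < lam.

Lemma green_identity f g : testf f -> testf g ->
  I (fun x => g x * (lam * f x - lap f x)) =
  I (fun x => partial 0 g x * partial 0 f x) + I (fun x => partial 1 g x * partial 1 f x) + lam * I (fun x => g x * f x).
Proof.
move=> tf tg; have t0 := testf_partial 0 tf; have t1 := testf_partial 1 tf.
have t00 := testf_partial 0 t0; have t11 := testf_partial 1 t1.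
have sg := proj1 tg.
have B0 := Rint_by_parts 0 sg t0; have B1 := Rint_by_parts 1 sg t1.
have alg (x y z u v : R) : y = - u -> z = - v -> lam * x - y - z = u + v + lam * x.
  by move=> -> ->; ring.
apply: etrans (alg _ _ _ _ _ B0 B1).
exact: (Rint_helmholtz lam (testfM_intble tg tf) (testfM_intble tg t00) (testfM_intble tg t11)).
Qed.

Lemma green_norm f : testf f -> I (fun x => f x * (lam * f x - lap f x)) =
  N (partial 0 f) + N (partial 1 f) + lam * N f.
Proof.
move=> tf; apply: etrans (green_identity tf tf) _.
exact: (congr2 +%R (congr2 +%R (Rint_mulself _ _) (Rint_mulself _ _)) (congr1 ( *%R lam) (Rint_mulself _ _))).
Qed.

Lemma partial_helmholtz i f g : smooth2 f -> smooth2 g ->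
  partial i (fun x => lam * f x - g x) = (fun x => lam * partial i f x - partial i g x).
Proof.
move=> sf sg; apply: partial_val => x; apply: is_deriveB; last exact: partial_derive.
by apply: is_deriveZ; exact: partial_derive.
Qed.

Lemma lap_partial0 f : testf f -> partial 0 (lap f) = lap (partial 0 f).
Proof.
move=> tf; have t1 := testf_partial 1 tf; have t0 := testf_partial 0 tf.
have [s00 _] := testf_partial 0 t0; have [s11 _] := testf_partial 1 t1.
have E := etrans (partialC t1) (congr1 (partial 1) (partialC tf)).
exact: (etrans (partialD 0 s00 s11) (congr1 (fun (h : plane -> R) x => partial 0 (partial 0 (partial 0 f)) x + h x) E)).
Qed.

Let H2_arith (A B0 B1 K M P X Y : R) : 0 <= A -> 0 <= B0 -> 0 <= B1 -> 0 <= K ->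
  X = B0 + B1 + lam * A -> X <= lam / 2 * A + (2 * lam)^-1 * K ->
  Y = P + M + lam * B0 -> Y <= P + K -> A + B1 + (B0 + M) <= (1 / lam ^+ 2 + 1 / lam + 1) * K.
Proof.
move=> A0 B00 B10 K0 -> h1 -> h2.
have M1 : M <= K by have := mulr_ge0 (ltW lam0) B00; lra.
have l0 : lam != 0 by rewrite gt_eqF.
have E : (2 * lam)^-1 * K = K / lam / 2 by field.
have A1 : A <= 1 / lam ^+ 2 * K.
  by rewrite mulrAC mul1r ler_pdivlMr ?exprn_gt0// expr2 mulrA -ler_pdivlMr//; lra.
have B1' : B0 + B1 <= 1 / lam * K.
  have := mulr_ge0 (ltW lam0) A0; have := divr_ge0 K0 (ltW lam0).
  by rewrite mulrAC mul1r; lra.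
by rewrite !mulrDl mul1r; lra.
Qed.

(** Let k = lam f - Delta f. Testing k against f bounds f and its gradient; testing it against minus
    the second derivative of f in the first direction bounds the mixed derivative. The three terms
    of the constant bound f, the gradient and the mixed derivative in terms of the norm of k, and
    [testf_sqr_le] reaches f 0. *)
Lemma H2_estimate : exists2 C, 0 <= C & forall f, testf f ->
  f 0 ^+ 2 <= C * N (fun x => lam * f x - lap f x).
Proof.
exists (1 / lam ^+ 2 + 1 / lam + 1).
  by rewrite !addr_ge0// divr_ge0// ?sqr_ge0// ltW.
move=> f tf; apply: le_trans (testf_sqr_le tf) _.
have t0 := testf_partial 0 tf; have t00 := testf_partial 0 t0; have tl := testf_lap tf.
pose k x := lam * f x - lap f x; have tk : testf k.
  by apply: testfB; [exact: testfZ|exact: tl].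
have k0 : partial 0 k = (fun x => lam * partial 0 f x - lap (partial 0 f) x).
  by rewrite /k (partial_helmholtz 0 (proj1 tf) (proj1 tl)) (lap_partial0 tf).
(* After one integration by parts the right side is the energy of the first partial derivative. Its
   pure second derivative term will cancel against the same term of [opp_young], leaving the mixed
   one. *)
have e2 : - I (fun x => partial 0 (partial 0 f) x * k x) = _ := etrans (esym (Rint_by_parts 0 (proj1 t0) tk))
  (etrans (congr1 (fun h : plane -> R => I (fun x => partial 0 f x * h x)) k0) (green_norm t0)).
have N0 (g : plane -> R) : 0 <= N g by apply: Rint_ge0 => x; exact: sqr_ge0.
apply: (H2_arith (N0 _) (N0 _) (N0 _) (N0 k) (green_norm tf) _ e2).
  exact: (young lam0 (testf_sqint tf) (testf_sqint tk)).
exact: (opp_young (testf_sqint t00) (testf_sqint tk)).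
Qed.

Lemma partial_linear i a f g : testf f -> testf g ->
  partial i (fun x => a * f x + g x) = (fun x => a * partial i f x + partial i g x).
Proof.
move=> [sf _] [sg _]; apply: partial_val => x; apply: is_deriveD; last exact: partial_derive.
by apply: is_deriveZ; exact: partial_derive.
Qed.

Lemma lap_linear a f g : testf f -> testf g ->
  lap (fun x => a * f x + g x) = (fun x => a * lap f x + lap g x).
Proof.
move=> tf tg.
have E i := etrans (congr1 (partial i) (partial_linear i a tf tg))
  (partial_linear i a (testf_partial i tf) (testf_partial i tg)).
have alg (p q r s : R) : (a * p + q) + (a * r + s) = a * (p + r) + (q + s) by ring.
apply/funext => x; apply: etrans (alg _ _ _ _).
exact: (congr2 (fun p q : plane -> R => p x + q x) (E 0) (E 1)).
Qed.

(** By [H2_estimate], evaluation at 0 is a bounded functional of lam f - Delta f in L^2; G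
    represents it. *)
Lemma green_exists : exists2 G, sqint (leb2 R) G &
  forall f, testf f -> I (fun x => G x * (lam * f x - lap f x)) = f 0.
Proof.
have [C C0 HC] := H2_estimate.
pose L (f : plane -> R) (j : 'I_1) x := lam * f x - lap f x.
have [|||||||h [_ [lh _ _ hF _]]] := @riesz _ _ R (leb2 R) 1 (plane -> R) (fun f => testf f)
  L (fun f => f 0) C; last first.
- exists (h 0); first exact: lh.
  by move=> f tf; have := hF f tf; rewrite /dot big_ord1.
- exact: C0.
- move=> f tf; apply: le_trans (HC f tf) _; by rewrite /dot big_ord1 ler_wpM2l.
- by [].
- move=> a f g tf tg; apply/funext => j; apply/funext => x.
  have alg (p q r s : R) : lam * (a * p + q) - (a * r + s) = a * (lam * p - r) + (lam * q - s) by ring.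
  apply: etrans (alg _ _ _ _).
  exact: (congr1 (fun p : plane -> R => lam * (a * f x + g x) - p x) (lap_linear a tf tg)).
- move=> f tf j; apply: testf_sqint; apply: testfB; [exact: testfZ|exact: testf_lap].
- by move=> a f g tf tg; apply: testfD => //; exact: testfZ.
- exact: testf0.
Qed.

End Elliptic.

(** * Weak derivatives and regularity *)

Section Generic.
Context d (T : measurableType d) (R : realType).
Variable mu : {measure set T -> \bar R}.
Local Notation I f := (\int[mu]_x f x).
Local Notation N f := (\int[mu]_x (f x ^+ 2)).
Implicit Types f g k : T -> R.

Lemma N_ge0 f : 0 <= N f.
Proof. by apply: Rint_ge0 => x; exact: sqr_ge0. Qed.

Lemma young_norm f k : sqint mu f -> sqint mu k -> `|I (fun x => f x * k x)| <= N f + N k.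
Proof.
move=> sf sk; rewrite ler_norml; have := opp_young sf sk; have := opp_young (sqintN sf) sk.
rewrite [I (fun x => - f x * k x)](_ : _ = - I (fun x => f x * k x)); last first.
  by rewrite -RintN; [apply: eq_Rintegral => x _; rewrite mulNr|exact: sqint_intbleM].
rewrite opprK [I (fun x => (- f x) ^+ 2)](_ : _ = N f); last by apply: eq_Rintegral => x _; rewrite sqrrN.
by move=> h1 h2; rewrite h1 andbT lerNl.
Qed.

Lemma ae_sym f g : {ae mu, forall x, f x = g x} -> {ae mu, forall x, g x = f x}.
Proof. by move=> h; apply: (ae_imp h). Qed.

Lemma ae_Rint_eq f g : measurable_fun setT f -> measurable_fun setT g ->
  {ae mu, forall x, f x = g x} -> I f = I g.
Proof.
move=> mf mg fg; rewrite /Rintegral; congr fine; apply: ae_eq_integral => //.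
- exact/measurable_EFinP.
- exact/measurable_EFinP.
- by apply: (ae_imp fg) => x ->.
Qed.

Lemma ae_dot n (h h' k k' : 'I_n -> T -> R) : l2 mu h -> l2 mu h' -> l2 mu k -> l2 mu k' ->
  (forall j, {ae mu, forall x, h j x = h' j x}) -> (forall j, {ae mu, forall x, k j x = k' j x}) ->
  dot mu h k = dot mu h' k'.
Proof.
move=> lh lh' lk lk' hh kk; apply: eq_bigr => j _; apply: ae_Rint_eq.
- by apply: measurable_funM; [case: (lh j)|case: (lk j)].
- by apply: measurable_funM; [case: (lh' j)|case: (lk' j)].
by apply: filterS2 (hh j) (kk j) => x -> ->.
Qed.

Lemma Rint_comb (a : R) f g k : sqint mu f -> sqint mu g -> sqint mu k ->
  I (fun x => (a * f x + g x) * k x) = a * I (fun x => f x * k x) + I (fun x => g x * k x).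
Proof.
move=> sf sg sk; have fk := sqint_intbleM sf sk; have gk := sqint_intbleM sg sk.
have afk := intbleZ a fk; rewrite -RintZ// -RintD//.
by apply: eq_Rintegral => x _; ring.
Qed.

(* [4 f g^3 <= f^4 + 3 g^4], applied where [|g| <= M]. *)
Lemma L4_limit (f : nat -> T -> R) g (c : nat -> R) (C : R) : (forall n, sqint mu (f n)) ->
  (forall n, sqint mu (fun x => f n x ^+ 2)) -> sqint mu g ->
  (fun n => N (fun x => f n x - g x)) @ \oo --> (0 : R) ->
  (forall n, I (fun x => f n x ^+ 4) <= c n) -> c @ \oo --> C ->
  sqint mu (fun x => g x ^+ 2) /\ I (fun x => g x ^+ 4) <= C.
Proof.
move=> sf sf2 sg fg fC cC; have [mg ig] := sg.
pose A (M : nat) : set T := [set x | `|g x| <= M%:R].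
have mA M : measurable (A M).
  rewrite (_ : A M = [set: T] `&` (fun x => `|g x|) @^-1` [set` `]-oo, M%:R]]).
    by apply: (measurableT_comp (@normr_measurable R setT) mg) => //; exact: measurable_itv.
  by apply/seteqP; split => x /=; rewrite ?in_itv/=; [|case]; rewrite ?in_itv/=.
have AE M x : \1_(A M) x = 0 :> R \/ \1_(A M) x = 1 :> R /\ `|g x| <= M%:R.
  rewrite indicE; have [xA|xA] := boolP (x \in A M); [right|by left].
  by split => //; move: xA; rewrite inE.
have m1 M : measurable_fun setT (\1_(A M) : T -> R) by exact: measurable_indic.
have f4 (h : T -> R) : (fun x => h x ^+ 4) = (fun x => (h x ^+ 2) ^+ 2).
  by apply/funext => x; rewrite -exprM.
have sM (M j : nat) : sqint mu (fun x => g x ^+ j.+1 * \1_(A M) x).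
  have mm : measurable_fun setT (fun x => g x ^+ j.+1 * \1_(A M) x).
    by apply: measurable_funM => //; exact: measurable_funX.
  split => //; apply: (@intble_le _ _ _ mu _ (fun x => (M%:R ^+ j) ^+ 2 * g x ^+ 2)).
  - exact: measurable_funX.
  - exact: intbleZ.
  move=> x; case: (AE M x) => [->|[-> gM]].
    by rewrite mulr0 expr0n normr0 mulr_ge0// sqr_ge0.
  rewrite mulr1 ger0_norm ?sqr_ge0// [g x ^+ j.+1]exprSr exprMn ler_wpM2r ?sqr_ge0//.
  rewrite -[leLHS]real_normK ?num_real// lerXn2r ?nnegrE//.
  by rewrite normrX lerXn2r ?nnegrE.
have i4 M : intble mu (fun x => g x ^+ 4 * \1_(A M) x).
  have := sqint_intbleM (sM M 2) sg; congr (intble mu _); apply/funext => x; ring.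
have X M : I (fun x => g x ^+ 4 * \1_(A M) x) <= C.
  pose psi x := g x ^+ 3 * \1_(A M) x; have spsi : sqint mu psi by exact: (sM M 2).
  pose X := I (fun x => g x ^+ 4 * \1_(A M) x); rewrite -/X.
  pose s n := I (fun x => (f n x - g x) * psi x).
  have s0 : s @ \oo --> (0 : R).
    apply: (@cvg0_sqr _ _ (fun n => N (fun x => f n x - g x)) (N psi)) => // n.
    by rewrite mulrC; apply: Cauchy_Schwarz => //; exact: sqintB.
  have key n : X + 4 * s n <= c n.
    have if4 : intble mu (fun x => f n x ^+ 4) by rewrite f4; exact: (sf2 n).2.
    have ifp : intble mu (fun x => (f n x - g x) * psi x).
      by apply: sqint_intbleM => //; exact: sqintB.
    apply: le_trans (fC n); rewrite -RintZ// /X -RintD//; last exact: intbleZ.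
    apply: Rint_le => //; first by apply: intbleD => //; exact: intbleZ.
    move=> x; rewrite /psi; move: (f n x) => a; case: (AE M x) => [->|[-> _]].
      by rewrite !mulr0 addr0 -[4%N]/(2 * 2)%N exprM sqr_ge0.
    rewrite !mulr1; move: (g x) => b; rewrite -subr_ge0.
    have -> : a ^+ 4 - (b ^+ 4 + 4 * ((a - b) * b ^+ 3)) = (a - b) ^+ 2 * ((a + b) ^+ 2 + 2 * b ^+ 2) by ring.
    by apply: mulr_ge0; [exact: sqr_ge0|apply: addr_ge0; [exact: sqr_ge0|apply: mulr_ge0 => //; exact: sqr_ge0]].
  have h : (fun n => X + 4 * s n) @ \oo --> X + 4 * 0.
    by apply: cvgD; [exact: cvg_cst|apply: cvgM => //; exact: cvg_cst].
  by rewrite mulr0 addr0 in h; exact: (le_cvg key h).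
have [|||||||i X4] := @mono_intble _ _ _ mu (fun x => g x ^+ 4) A C.
- exact: measurable_funX.
- by move=> x; rewrite -[4%N]/(2 * 2)%N exprM sqr_ge0.
- by [].
- by move=> M x /=; rewrite /A /= => /le_trans; apply; rewrite ler_nat.
- move=> x; exists (Num.bound `|g x|); rewrite /A/=; apply/ltW.
  by rewrite archi_boundP.
- exact: i4.
- exact: X.
split => //; split; first exact: measurable_funX.
by move: i; rewrite f4.
Qed.

End Generic.

Section RealH1.
Variable R : realType.
Local Notation plane := (R * R)%type.
Local Notation mplane := (measurableTypeR R * measurableTypeR R)%type.
Local Notation mu := (leb2 R).
Local Notation I f := (\int[leb2 R]_x f x).
Local Notation N f := (\int[leb2 R]_x (f x ^+ 2)).
Implicit Types (f u v w phi psi : plane -> R) (g h : 'I_2 -> plane -> R).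

Definition wpart (i : 'I_2) u (g : plane -> R) := forall phi, testf phi ->
  I (fun x => u x * partial i phi x) = - I (fun x => g x * phi x).

(** The weak gradient is carried as data instead of being chosen, so that it can be combined,
    translated and passed to the limit along with the function. *)
Definition wder u g := sqint mu u /\ forall i, sqint mu (g i) /\ wpart i u (g i).

(* The pair [(u, g)] of a function and its weak gradient is embedded in (L^2)^3 so
   that the scalar product becomes [en lam]. *)
Definition jet (lam : R) u g : 'I_3 -> plane -> R := fun j =>
  if j == 0 then g 0 else if j == 1 then g 1 else fun x => Num.sqrt lam * u x.

Definition grad u : 'I_2 -> plane -> R := fun i => partial i u.

Definition en lam u g v h := I (fun x => g 0 x * h 0 x) + I (fun x => g 1 x * h 1 x) + lam * I (fun x => u x * v x).

Definition h1l2 u g := sqint mu u /\ forall i, sqint mu (g i).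

Lemma wder_h1l2 u g : wder u g -> h1l2 u g.
Proof. by move=> [su sg]; split => // i; case: (sg i). Qed.

Lemma jet_l2 lam u g : h1l2 u g -> l2 mu (jet lam u g).
Proof.
move=> [su sg] j; rewrite /jet; case: ifP => _ //; case: ifP => _ //; exact: sqintZ.
Qed.

Lemma dot_jet lam u g v h : 0 <= lam -> h1l2 u g -> h1l2 v h ->
  dot mu (jet lam u g) (jet lam v h) = en lam u g v h.
Proof.
move=> l0 [su sg] [sv sh]; rewrite /dot 2!big_ord_recl big_ord1 /jet /= addrA /en.
congr (_ + _); rewrite -RintZ; last exact: sqint_intbleM.
by apply: eq_Rintegral => x _; rewrite mulrACA -expr2 sqr_sqrtr.
Qed.

Lemma wder_test phi : testf phi -> wder phi (grad phi).
Proof.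
move=> tp; split; first exact: testf_sqint.
by move=> i; split; [exact/testf_sqint/testf_partial|move=> psi tpsi; apply: Rint_by_parts => //; case: tp].
Qed.

Lemma wder_comb a u g v h : wder u g -> wder v h ->
  wder (fun x => a * u x + v x) (comb a g h).
Proof.
move=> [su sg] [sv sh]; split; first by apply: sqintD => //; exact: sqintZ.
move=> i; have [sgi wg] := sg i; have [shi wh] := sh i.
split; first by apply: sqintD => //; exact: sqintZ.
move=> phi tp; have sp := testf_sqint tp; have spi := testf_sqint (testf_partial i tp).
rewrite (Rint_comb a su sv spi) (wg _ tp) (wh _ tp) /comb (Rint_comb a sgi shi sp); ring.
Qed.

Lemma wder_ae u v g : wder u g -> measurable_fun setT (v : mplane -> R) ->
  {ae mu, forall x, u x = v x} -> wder v g.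
Proof.
move=> [su sg] mv uv; split; first exact: sqint_ae su mv uv.
move=> i; have [sgi wg] := sg i; split=> // phi tp; rewrite -(wg _ tp).
have [mp _] := testf_sqint (testf_partial i tp).
apply: ae_Rint_eq; [exact: measurable_funM|by apply: measurable_funM => //; case: su|].
by apply: (ae_imp uv) => x ->.
Qed.

Lemma testf_sq_intble (g : plane -> R) psi : sqint mu g -> testf psi -> intble mu (fun x => g x * psi x).
Proof. by move=> sg tp; apply: sqint_intbleM => //; exact: testf_sqint. Qed.

Lemma Rint_shift_sqr (f : plane -> R) y : intble mu (fun x => f x ^+ 2) -> N (fun x => f (x + y)) = N f.
Proof.
move=> fi; rewrite [RHS](Rint_affine y ltr01 fi) expr1n mul1r.
by apply: eq_Rintegral => x _; rewrite scale1r.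
Qed.

Lemma sq_conv_bounded (g : plane -> R) psi : sqint mu g -> testf psi ->
  exists B, forall y, `|I (fun x => g x * psi (x + y))| <= B.
Proof.
move=> sg tp; exists (N g + N psi) => y.
apply: le_trans (young_norm sg (testf_sqint (testf_shift y tp))) _.
by rewrite lerD2l Rint_shift_sqr//; exact: (testf_sqint tp).2.
Qed.

Lemma ae_eq_of_test (f g : plane -> R) : sqint mu f -> sqint mu g ->
  (forall phi, testf phi -> I (fun x => f x * phi x) = I (fun x => g x * phi x)) ->
  {ae mu, forall x, f x = g x}.
Proof.
move=> sf sg fg; have sfg := sqintB sf sg.
have := @du_Bois_Reymond_tensor R (fun x => f x - g x).
move/(_ (proj1 sfg) (fun psi => testf_sq_intble sfg)) => h.
apply: ae_imp (h _) _; last by move=> x /eqP; rewrite subr_eq0 => /eqP.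
move=> n a b c e; have tp := testf_step n a b c e; set psi := (X in testf X) in tp.
have fp := testf_sq_intble sf tp; have gp := testf_sq_intble sg tp.
transitivity (I (fun x => f x * psi x) - I (fun x => g x * psi x)); last by rewrite fg ?subrr.
by rewrite -RintB//; apply: eq_Rintegral => x _; rewrite /psi mulrBl.
Qed.

Lemma wder_unique u v g h : wder u g -> wder v h -> {ae mu, forall x, u x = v x} ->
  forall i, {ae mu, forall x, g i x = h i x}.
Proof.
move=> [su sg] [sv sh] uv i; have [sgi wg] := sg i; have [shi wh] := sh i.
apply: ae_eq_of_test => // phi tp; apply: oppr_inj; rewrite -(wg _ tp) -(wh _ tp).
have [mp _] := testf_sqint (testf_partial i tp).
apply: ae_Rint_eq; [by apply: measurable_funM => //; case: su|by apply: measurable_funM => //; case: sv|].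
by apply: (ae_imp uv) => x ->.
Qed.

Variable lam : R.
Hypothesis lam0 : 0 < lam.

Lemma en_ge0 u g : h1l2 u g -> 0 <= en lam u g u g.
Proof. by move=> hu; rewrite -dot_jet ?dot_ge0// ltW. Qed.

Lemma en_CS u g v h : h1l2 u g -> h1l2 v h -> en lam u g v h ^+ 2 <= en lam u g u g * en lam v h v h.
Proof.
move=> hu hv; have l0 := ltW lam0.
by rewrite -(dot_jet l0 hu hv) -(dot_jet l0 hu hu) -(dot_jet l0 hv hv); apply: dot_CS; exact: jet_l2.
Qed.

Lemma wder_helmholtz u g phi : wder u g -> testf phi ->
  I (fun x => u x * (lam * phi x - lap phi x)) = en lam u g phi (grad phi).
Proof.
move=> [su sg] tp; have t0 := testf_partial 0 tp; have t1 := testf_partial 1 tp.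
have t00 := testf_partial 0 t0; have t11 := testf_partial 1 t1.
apply: etrans (Rint_helmholtz lam (testf_sq_intble su tp) (testf_sq_intble su t00) (testf_sq_intble su t11)) _.
have alg (x y z p q : R) : y = - p -> z = - q -> lam * x - y - z = p + q + lam * x.
  by move=> -> ->; ring.
exact: alg ((sg 0).2 _ t0) ((sg 1).2 _ t1).
Qed.

Lemma l2cvg_wpart (f : nat -> plane -> R) (F : nat -> plane -> R) u v i :
  (forall n, sqint mu (f n)) -> (forall n, sqint mu (F n)) -> sqint mu u -> sqint mu v ->
  (fun n => N (fun x => f n x - u x)) @ \oo --> (0 : R) ->
  (fun n => N (fun x => F n x - v x)) @ \oo --> (0 : R) ->
  (forall n, wpart i (f n) (F n)) -> wpart i u v.
Proof.
move=> sf sF su sv fu Fv w phi tp; have sp := testf_sqint tp; have spi := testf_sqint (testf_partial i tp).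
have lim (p : nat -> plane -> R) (q psi : plane -> R) : (forall n, sqint mu (p n)) -> sqint mu q -> sqint mu psi ->
    (fun n => N (fun x => p n x - q x)) @ \oo --> (0 : R) ->
    (fun n => I (fun x => p n x * psi x)) @ \oo --> I (fun x => q x * psi x).
  move=> sP sq spsi pq; apply: cvg_sub_cst; apply: (@cvg0_sqr _ _ (fun n => N (fun x => p n x - q x)) (N psi)) => // n.
  have [pp qp] := (sqint_intbleM (sP n) spsi, sqint_intbleM sq spsi).
  rewrite -RintB// mulrC; under eq_Rintegral do rewrite -mulrBl.
  by apply: Cauchy_Schwarz => //; exact: sqintB.
have h1 := lim _ _ _ sf su spi fu;
have h2 : (fun n => - I (fun x => F n x * phi x)) @ \oo --> - I (fun x => v x * phi x).
  by apply: cvgN; exact: lim.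
have E : (fun n => I (fun x => f n x * partial i phi x)) = (fun n => - I (fun x => F n x * phi x)).
  by apply/funext => n; exact: w.
by rewrite E in h1; exact: (cvg_unique (@Rhausdorff R) h1 h2).
Qed.

Lemma cvg0_le (s v : nat -> R) (K : R) : (forall n, 0 <= s n <= K * v n) ->
  v @ \oo --> (0 : R) -> s @ \oo --> (0 : R).
Proof.
move=> sv v0; have h : (fun n => K * v n) @ \oo --> (0 : R).
  by rewrite -[X in _ --> X](mulr0 K); apply: cvgM => //; exact: cvg_cst.
apply: (@squeeze_cvgr _ _ _ _ (fun=> 0) (fun n => K * v n)) => //; last exact: cvg_cst.
exact: nearW.
Qed.

Let tjet f := jet lam f (grad f).

Lemma l2cvg_jet (f : nat -> plane -> R) u g : (forall n, testf (f n)) -> h1l2 u g ->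
  l2cvg mu (fun n => tjet (f n)) (jet lam u g) ->
  (fun n => N (fun x => f n x - u x)) @ \oo --> (0 : R) /\
  forall i, (fun n => N (fun x => partial i (f n) x - g i x)) @ \oo --> (0 : R).
Proof.
move=> tf hu fu; have lu := jet_l2 lam hu.
have lf n : l2 mu (tjet (f n)) by apply: jet_l2; exact/wder_h1l2/wder_test.
have comp j n : N (fun x => tjet (f n) j x - jet lam u g j x) <=
    dot mu (comb (-1) (jet lam u g) (tjet (f n))) (comb (-1) (jet lam u g) (tjet (f n))).
  apply: le_trans (dot_ge_comp j (l2_comb (-1) lu (lf n))).
  rewrite le_eqVlt; apply/orP; left; apply/eqP; apply: eq_Rintegral => x _.
  by rewrite /comb mulN1r addrC.
split.
  apply: (cvg0_le (K := lam^-1)) fu => n; rewrite N_ge0/= ler_pdivlMl//.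
  apply: le_trans (comp 2 n); rewrite -RintZ; last first.
    by apply: (sqintB _ _).2; [exact: testf_sqint|case: hu].
  rewrite le_eqVlt; apply/orP; left; apply/eqP; apply: eq_Rintegral => x _.
  by rewrite /tjet /jet /= -mulrBr exprMn sqr_sqrtr// ltW.
move=> i; apply: (cvg0_le (K := 1)) fu => n; rewrite N_ge0/= mul1r.
by case: (ord2P i) => ->; [exact: (comp 0 n)|exact: (comp 1 n)].
Qed.

(** k solves (- Delta + lam) k = F in distributions, with F bounded for the energy. Riesz gives a
    solution w in H^1, and uniqueness gives k = w almost everywhere. The hypotheses on k are those
    of the uniqueness theorem, weaker than k in L^2, because the convolution treated later is only
    known to be bounded. *)
Lemma weak_regularity (k : plane -> R) (F : (plane -> R) -> R) (C : R) :
  measurable_fun setT (k : mplane -> R) ->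
  (forall psi, testf psi -> intble mu (fun x => k x * psi x)) ->
  (forall psi, testf psi -> exists B, forall y, `|I (fun x => k x * psi (x + y))| <= B) ->
  (forall a f v, testf f -> testf v -> F (fun x => a * f x + v x) = a * F f + F v) ->
  (forall f, testf f -> F f ^+ 2 <= C * en lam f (grad f) f (grad f)) -> 0 <= C ->
  (forall f, testf f -> I (fun x => k x * (lam * f x - lap f x)) = F f) ->
  exists w h xn, [/\ wder w h, {ae mu, forall x, k x = w x}, en lam w h w h <= C,
    forall f, testf f -> en lam w h f (grad f) = F f &
    (forall n, testf (xn n)) /\ l2cvg mu (fun n => tjet (xn n)) (jet lam w h)].
Proof.
move=> mk ki kB Flin FC C0 kF; have l0 := ltW lam0.
have ht f : testf f -> h1l2 f (grad f) by move=> tf; exact/wder_h1l2/wder_test.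
have [|||||||H [xn [lH tx xH HF HC]]] := @riesz _ _ R mu 3 (plane -> R) (fun f => testf f) tjet F C; last first.
(* The last component of a jet is the square root of lam times the function, hence the division.
   That H is a jet with h the weak gradient of w is inherited from the approximating test
   functions. *)
- pose w x := (Num.sqrt lam)^-1 * H 2 x; pose h (i : 'I_2) := H (if i == 0 then 0 else 1).
  have Hw : H = jet lam w h.
    apply/funext => j; rewrite /jet /h /=; case: eqP => [->//|j0]; case: eqP => [->//|j1].
    apply/funext => x; rewrite /w mulrA divff ?mul1r; last by rewrite gt_eqF// sqrtr_gt0.
    congr (H _ x); apply/val_inj; move: j0 j1; case: j => -[|[|[|//]]] //= jp j0 j1.
    - by exfalso; apply: j0; exact/val_inj.
    - by exfalso; apply: j1; exact/val_inj.
  have hw : h1l2 w h.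
    by split=> [|i]; [apply: sqintZ; exact: lH|exact: lH].
  rewrite Hw in xH HF HC.
  have [xw xh] := l2cvg_jet tx hw xH.
  have ww : wder w h.
    split; first by case: hw.
    move=> i; split; first by case: hw.
    apply: (l2cvg_wpart _ _ _ _ xw (xh i)).
    + by move=> n; exact: testf_sqint.
    + by move=> n; exact/testf_sqint/testf_partial.
    + by case: hw.
    + by case: hw.
    + by move=> n phi tp; apply: Rint_by_parts => //; case: (tx n).
  have wF f : testf f -> en lam w h f (grad f) = F f.
    by move=> tf; rewrite -HF// dot_jet//; exact: ht.
  exists w, h, xn; split => //; last by rewrite -dot_jet.
  have sw : sqint mu w by case: hw.
  have wi psi (tp : testf psi) := testf_sq_intble sw tp.
  have kwE (p : plane -> R) : testf p -> I (fun x => (k x - w x) * p x) = I (fun x => k x * p x) - I (fun x => w x * p x).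
    move=> tp; rewrite -RintB; [|exact: ki|exact: wi].
    by apply: eq_Rintegral => x _; rewrite mulrBl.
  have := @helmholtz_unique R lam lam0 (fun x => k x - w x).
  move=> HU; apply: ae_imp (HU _ _ _ _) _.
  + by apply: measurable_funB => //; case: sw.
  + move=> psi tp; have := intbleB (ki _ tp) (wi _ tp).
    by congr (intble _ _); apply/funext => x; rewrite mulrBl.
  + move=> psi tp; have [B1 HB1] := kB _ tp; have [B2 HB2] := sq_conv_bounded sw tp.
    exists (B1 + B2) => y; rewrite kwE; last exact: testf_shift.
    by apply: le_trans (ler_normB _ _) _; apply: lerD.
  + move=> psi tp; rewrite kwE; last by apply: testfB; [exact: testfZ|exact: testf_lap].
    by rewrite kF// (wder_helmholtz ww tp) wF// subrr.
  + by move=> x /eqP; rewrite subr_eq0 => /eqP.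
- exact: C0.
- by move=> f tf; rewrite dot_jet ?FC//; exact: ht.
- by move=> a f g; exact: Flin.
- move=> a f g tf tg; apply/funext => j; apply/funext => x; rewrite /tjet /jet /comb /grad.
  case: ifP => _; first exact: (congr1 (@^~ x) (partial_linear 0 a tf tg)).
  case: ifP => _; first exact: (congr1 (@^~ x) (partial_linear 1 a tf tg)).
  by rewrite mulrDr mulrCA.
- by move=> f tf; apply: jet_l2; exact: ht.
- by move=> a f g tf tg; apply: testfD => //; exact: testfZ.
- exact: testf0.
Qed.

End RealH1.

(** * Density of test functions and the Gagliardo-Nirenberg inequality *)

Lemma Rint_lin d (T : measurableType d) (R : realType) (mu : {measure set T -> \bar R}) (a : R) (k f g : T -> R) :
  intble mu (fun x => k x * f x) -> intble mu (fun x => k x * g x) ->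
  \int[mu]_x (k x * (a * f x + g x)) = a * \int[mu]_x (k x * f x) + \int[mu]_x (k x * g x).
Proof.
move=> fi gi; have afi := intbleZ a fi; rewrite -RintZ// -RintD//.
by apply: eq_Rintegral => x _; ring.
Qed.

Section Green.
Variable R : realType.
Local Notation plane := (R * R)%type.
Local Notation mplane := (measurableTypeR R * measurableTypeR R)%type.
Local Notation mu := (leb2 R).
Local Notation I f := (\int[leb2 R]_x f x).
Local Notation N f := (\int[leb2 R]_x (f x ^+ 2)).
Implicit Types (f u v w phi psi : plane -> R) (g h : 'I_2 -> plane -> R).

Lemma en_self (lam : R) u g : en lam u g u g = N (g 0) + N (g 1) + lam * N u.
Proof.
exact: (congr2 +%R (congr2 +%R (Rint_mulself _ _) (Rint_mulself _ _)) (congr1 ( *%R lam) (Rint_mulself _ _))).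
Qed.

Lemma en_ge_part (lam : R) u g i : lam * N u + N (g i) <= en lam u g u g.
Proof.
have aux (p q r : R) : 0 <= p -> 0 <= q -> r + p <= p + q + r /\ r + q <= p + q + r by lra.
have [h0 h1] := aux _ _ (lam * N u) (N_ge0 mu (g 0)) (N_ge0 mu (g 1)).
by rewrite en_self; case: (ord2P i) => ->.
Qed.

Lemma en_ge_mass (lam : R) u g : lam * N u <= en lam u g u g.
Proof. by apply: le_trans (en_ge_part lam u g 0); rewrite lerDl N_ge0. Qed.

(** [weak_regularity] is applied to u itself, with its own energy product as functional: the
    solution is u again, and the minimizing sequence consists of test functions. *)
Lemma test_dense (lam : R) u g : 0 < lam -> wder u g -> exists2 xn, forall n, testf (xn n) &
  l2cvg mu (fun n => jet lam (xn n) (grad (xn n))) (jet lam u g).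
Proof.
move=> lam0 wu; have [su sg] := wu; have hu := wder_h1l2 wu.
have ht f : testf f -> h1l2 f (grad f) by move=> tf; exact/wder_h1l2/wder_test.
have [|||||||w [h [xn [ww uw _ _ [tx xw]]]]] := @weak_regularity R lam lam0 u (fun f => en lam u g f (grad f)) (en lam u g u g).
- by case: su.
- by move=> psi; exact: testf_sq_intble.
- by move=> psi; exact: sq_conv_bounded.
- move=> a f v tf tv.
  have tc : testf (fun x => a * f x + v x) by apply: testfD => //; exact: testfZ.
  rewrite -!(wder_helmholtz lam wu)//.
  have [tkf tkv] : testf (fun x => lam * f x - lap f x) /\ testf (fun x => lam * v x - lap v x).
    by split; apply: testfB; (exact: testfZ || exact: testf_lap).
  have fi := testf_sq_intble su tkf; have vi := testf_sq_intble su tkv; rewrite -(Rint_lin a fi vi).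
  apply: eq_Rintegral => x _; rewrite (lap_linear a tf tv).
  have alg (l p q r s t : R) : p * (l * (a * q + r) - (a * s + t)) = p * (a * (l * q - s) + (l * r - t)) by ring.
  exact: alg.
- by move=> f tf; apply: en_CS => //; exact: ht.
- exact: en_ge0.
- by move=> f tf; exact: wder_helmholtz.
exists xn => //; have l0 := ltW lam0; have hw := wder_h1l2 ww.
have lx n : l2 mu (jet lam (xn n) (grad (xn n))) by apply: jet_l2; exact: ht.
have E : forall j, {ae mu, forall x, jet lam w h j x = jet lam u g j x}.
  have gh := wder_unique wu ww uw.
  move=> j; rewrite /jet; case: ifP => _; first by apply: (ae_imp (gh 0)).
  by case: ifP => _; [apply: (ae_imp (gh 1))|apply: (ae_imp uw) => x ->].
apply: (cvg0_le (K := 1)) xw => n; rewrite dot_ge0 mul1r le_eqVlt; apply/orP; left; apply/eqP.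
have l1 := l2_comb (-1) (jet_l2 lam hw) (lx n); have l3 := l2_comb (-1) (jet_l2 lam hu) (lx n).
have E' : forall j, {ae mu, forall x, comb (-1) (jet lam w h) (jet lam (xn n) (grad (xn n))) j x = comb (-1) (jet lam u g) (jet lam (xn n) (grad (xn n))) j x}.
  by move=> j; apply: (ae_imp (E j)) => x; rewrite /comb => ->.
by apply/esym/ae_dot.
Qed.

Lemma testf_ladyzhenskaya (lam : R) phi : 0 < lam -> testf phi ->
  I (fun x => phi x ^+ 4) <= lam^-1 * en lam phi (grad phi) phi (grad phi) ^+ 2.
Proof.
move=> lam0 tp; have [sp _] := tp.
(* The first-order inequality is used for phi^2, whose derivative 2 phi phi' is split with weights s
   and 1/s. With s^2 = lam the bound is 1/s times (lam phi^2 + phi'^2), a part of the energy. *)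
pose s := Num.sqrt lam; have s0 : 0 < s by rewrite sqrtr_gt0.
have s2 : s ^+ 2 = lam by rewrite sqr_sqrtr// ltW.
have E := @testf_ladyzhenskaya1 R (fun x => phi x * phi x) (testfMl sp tp).
have sq := testf_sqint tp; have sq1 i := testf_sqint (testf_partial i tp).
have n2 i : intble mu (fun x => s * phi x ^+ 2 + s^-1 * partial i phi x ^+ 2).
  by apply: intbleD; apply: intbleZ; [case: sq|case: (sq1 i)].
have B i : I (fun x => `|partial i (fun x => phi x * phi x) x|) <= s^-1 * en lam phi (grad phi) phi (grad phi).
  have pE := partialM i sp sp.
  have h1 : I (fun x => `|partial i (fun x => phi x * phi x) x|) <= I (fun x => s * phi x ^+ 2 + s^-1 * partial i phi x ^+ 2).
    apply: Rint_le => //.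
      by apply: intble_norm; apply: testf_intble; apply: testf_partial; apply: testfMl.
    move=> x; rewrite (congr1 (@^~ x) pE); move: (phi x) (partial i phi x) => a b.
    have -> : s * a ^+ 2 + s^-1 * b ^+ 2 = (s * `|a| - `|b|) ^+ 2 / s + 2 * `|a * b|.
      rewrite normrM -[a ^+ 2]real_normK ?num_real// -[b ^+ 2]real_normK ?num_real//.
      by field; rewrite gt_eqF.
    have -> : `|a * b + a * b| = 2 * `|a * b| by rewrite -mulr2n normrMn mulr_natl.
    by rewrite lerDr mulr_ge0 ?sqr_ge0// invr_ge0 ltW.
  apply: le_trans h1 _; rewrite RintD; [|by apply: intbleZ; case: sq|by apply: intbleZ; case: (sq1 i)].
  rewrite RintZ; last by case: sq.
  rewrite RintZ; last by case: (sq1 i).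
  have -> : s * N phi = s^-1 * (lam * N phi) by rewrite -s2; field; rewrite gt_eqF.
  by rewrite -mulrDr ler_wpM2l ?invr_ge0 ?(ltW s0)//; exact: (en_ge_part lam phi (grad phi) i).
have P i : 0 <= I (fun x => `|partial i (fun x => phi x * phi x) x|) by apply: Rint_ge0.
rewrite (_ : I (fun x => phi x ^+ 4) = I (fun x => (phi x * phi x) ^+ 2)); last first.
  by apply: eq_Rintegral => x _; rewrite -expr2 -exprM.
apply: le_trans E _; apply: le_trans (ler_pM (P 0) (P 1) (B 0) (B 1)) _.
by rewrite -expr2 exprMn exprVn s2.
Qed.

(** Passage to the limit from test functions; [L4_limit] needs only their L^2 convergence and the
    convergence of their energies. *)
Lemma gagliardo_nirenberg (lam : R) u g : 0 < lam -> wder u g ->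
  sqint mu (fun x => u x ^+ 2) /\ I (fun x => u x ^+ 4) <= lam^-1 * en lam u g u g ^+ 2.
Proof.
move=> lam0 wu; have [xn tx xu] := test_dense lam0 wu; have hu := wder_h1l2 wu.
have l0 := ltW lam0; have ht n := wder_h1l2 (wder_test (tx n)).
have [x2 _] := l2cvg_jet lam0 tx hu xu.
have lx n : l2 mu (jet lam (xn n) (grad (xn n))) by exact: jet_l2.
have := l2cvg_norm lx (jet_l2 lam hu) xu; rewrite dot_jet// => xe.
apply: (L4_limit (c := fun n => lam^-1 * en lam (xn n) (grad (xn n)) (xn n) (grad (xn n)) ^+ 2) _ _ _ x2).
- by move=> n; exact/testf_sqint.
- by move=> n; exact/testf_sqint/testf_sqr.
- by case: hu.
- by move=> n; exact: testf_ladyzhenskaya.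
apply: cvgM; first exact: cvg_cst.
rewrite expr2; under eq_fun do rewrite expr2 -dot_jet//.
by apply: cvgM.
Qed.

Definition is_greenR (lam : R) (G : plane -> R) := sqint mu G /\
  forall f, testf f -> I (fun x => G x * (lam * f x - lap f x)) = f 0.

Lemma helmholtz_unique_sq (lam : R) (u v : plane -> R) : 0 < lam -> sqint mu u -> sqint mu v ->
  (forall f, testf f -> I (fun x => u x * (lam * f x - lap f x)) = I (fun x => v x * (lam * f x - lap f x))) ->
  {ae mu, forall x, u x = v x}.
Proof.
move=> lam0 su sv uv; have suv := sqintB su sv.
apply: ae_imp (@helmholtz_unique R lam lam0 (fun x => u x - v x) _ _ _ _) _.
- by case: suv.
- by move=> psi; exact: testf_sq_intble.
- by move=> psi; exact: sq_conv_bounded.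
- move=> psi tp; have tk : testf (fun x => lam * psi x - lap psi x).
    by apply: testfB; [exact: testfZ|exact: testf_lap].
  have ui := testf_sq_intble su tk; have vi := testf_sq_intble sv tk.
  transitivity (I (fun x => u x * (lam * psi x - lap psi x)) - I (fun x => v x * (lam * psi x - lap psi x))).
    by rewrite -RintB//; apply: eq_Rintegral => x _; rewrite mulrBl.
  by rewrite uv ?subrr.
- by move=> x /eqP; rewrite subr_eq0 => /eqP.
Qed.

(** The delta functions cancel: (- Delta + lam) (G - H) = (m - lam) H, which is in L^2 and so
    defines a functional bounded for the energy. *)
Lemma green_diff (lam m : R) (G H : plane -> R) : 0 < lam -> is_greenR lam G -> is_greenR m H ->
  exists h, wder (fun x => G x - H x) h.
Proof.
move=> lam0 [sG gG] [sH gH]; have sGH := sqintB sG sH.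
have [|||||||w [h [xn [ww uw _ _ _]]]] := @weak_regularity R lam lam0 (fun x => G x - H x)
    (fun f => (m - lam) * I (fun x => H x * f x)) ((m - lam) ^+ 2 * N H / lam).
- by case: sGH.
- by move=> psi; exact: testf_sq_intble.
- by move=> psi; exact: sq_conv_bounded.
- move=> a f v tf tv; have fi := testf_sq_intble sH tf; have vi := testf_sq_intble sH tv.
  by rewrite (Rint_lin a fi vi) mulrDr mulrCA.
- move=> f tf; rewrite exprMn.
  apply: le_trans (ler_wpM2l (sqr_ge0 _) (Cauchy_Schwarz sH (testf_sqint tf))) _.
  rewrite mulrA -[leRHS]mulrA; apply: ler_wpM2l; first by apply: mulr_ge0; [exact: sqr_ge0|exact: N_ge0].
  by rewrite ler_pdivlMl//; exact: en_ge_mass.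
- by rewrite divr_ge0 ?(ltW lam0)// mulr_ge0 ?sqr_ge0 ?N_ge0.
- move=> f tf; have tk l : testf (fun x => l * f x - lap f x).
    by apply: testfB; [exact: testfZ|exact: testf_lap].
  have Gi := testf_sq_intble sG (tk lam); have Hi := testf_sq_intble sH (tk m); have fi := testf_sq_intble sH tf.
  have mfi := intbleZ (m - lam) fi; have GHi := intbleB Gi Hi.
  transitivity (I (fun x => G x * (lam * f x - lap f x)) - I (fun x => H x * (m * f x - lap f x)) + (m - lam) * I (fun x => H x * f x)).
    by rewrite -RintZ// -RintB// -RintD//; apply: eq_Rintegral => x _; ring.
  by rewrite gG// gH// subrr add0r.
exists h; apply: (wder_ae ww); first by case: sGH.
exact: ae_sym.
Qed.

End Green.

(** * The Green function is in L^4 but not in H^1 *)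

Section Green2.
Variable R : realType.
Local Notation plane := (R * R)%type.
Local Notation mplane := (measurableTypeR R * measurableTypeR R)%type.
Local Notation mu := (leb2 R).
Local Notation I f := (\int[leb2 R]_x f x).
Local Notation N f := (\int[leb2 R]_x (f x ^+ 2)).
Implicit Types (f u v w phi psi : plane -> R) (g h : 'I_2 -> plane -> R).

Lemma Rint_scale (s : R) f : 0 < s -> intble mu f -> I (fun x => f (s *: x)) = s^-1 ^+ 2 * I f.
Proof.
move=> s0 fi; rewrite (Rint_affine 0 s0 fi) mulrA -exprMn mulVf ?gt_eqF// expr1n mul1r.
by apply: eq_Rintegral => x _; rewrite addr0.
Qed.

Lemma intble_scale (s : R) f : 0 < s -> intble mu f -> intble mu (fun x => f (s *: x)).
Proof.
by move=> s0 fi; have := intble_affine 0 s0 fi; congr (intble _ _); apply/funext => x; rewrite addr0.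
Qed.

Lemma measurable_scale (s : R) f : 0 < s -> measurable_fun setT (f : mplane -> R) ->
  measurable_fun setT ((fun x => f (s *: x)) : mplane -> R).
Proof.
move=> s0 mf; rewrite (_ : (fun x => _) = (fun x => f (s *: x + 0))); last by apply/funext => x; rewrite addr0.
exact: measurable_affine_comp.
Qed.

Lemma sqint_scale (s : R) f : 0 < s -> sqint mu f -> sqint mu (fun x => f (s *: x)).
Proof. by move=> s0 [mf fi]; split; [exact: measurable_scale|exact: (intble_scale s0 fi)]. Qed.

Lemma partial_scale i (s : R) f : smooth2 f ->
  partial i (fun x => f (s *: x)) = (fun x => s * partial i f (s *: x)).
Proof.
move=> sf; have := partial_affine i s 0 sf.
under eq_fun do rewrite addr0; move=> ->; by apply/funext => x; rewrite addr0.
Qed.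

Lemma testf_scale (s : R) f : s != 0 -> testf f -> testf (fun x => f (s *: x)).
Proof. by move=> s0 /(testf_affine 0 s0); under eq_fun do rewrite addr0. Qed.

Lemma lap_scale (s : R) f : testf f -> lap (fun x => f (s *: x)) = (fun x => s ^+ 2 * lap f (s *: x)).
Proof.
move=> [sf _]; have E i : partial i (partial i (fun x => f (s *: x))) = (fun x => s ^+ 2 * partial i (partial i f) (s *: x)).
  apply: etrans (congr1 (partial i) (partial_scale i s sf)) _.
  have spi := smooth2_partial i sf.
  have sc : smooth2 (fun x => partial i f (s *: x)).
    by have := smooth2_affine s 0 spi; under eq_fun do rewrite addr0.
  apply: etrans (partialZ i s sc) _; apply/funext => x.
  have := congr1 (@^~ x) (partial_scale i s spi) => /= ->.
  by rewrite mulrA expr2.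
apply/funext => x; apply: etrans (congr2 (fun p q : plane -> R => p x + q x) (E 0) (E 1)) _.
by rewrite -mulrDr.
Qed.

(** In dimension two, the factor s^2 that dilation gives to the Laplacian cancels the Jacobian s^-2,
    so the mass of delta_0 is preserved. *)
Lemma green_scale (lam s : R) (G : plane -> R) : 0 < s -> is_greenR lam G ->
  is_greenR (s ^+ 2 * lam) (fun x => G (s *: x)).
Proof.
move=> s0 [sG gG]; have sN0 : s != 0 by rewrite gt_eqF.
split; first exact: sqint_scale.
move=> phi tp; pose psi x := phi (s^-1 *: x).
have tpsi : testf psi by apply: testf_scale => //; rewrite invr_eq0.
have phiE : phi = (fun x => psi (s *: x)).
  by apply/funext => x; rewrite /psi scalerA mulVf// scale1r.
have tk : testf (fun x => lam * psi x - lap psi x) by apply: testfB; [exact: testfZ|exact: testf_lap].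
have Gk := testf_sq_intble sG tk.
transitivity (s ^+ 2 * I (fun x => G (s *: x) * (lam * psi (s *: x) - lap psi (s *: x)))).
  rewrite -RintZ; last exact: (intble_scale s0 Gk).
  apply: eq_Rintegral => x _; have := congr1 (@^~ x) (lap_scale s tpsi) => /= E.
  have alg (p q a b : R) : a = s ^+ 2 * b -> p * (s ^+ 2 * lam * q - a) = s ^+ 2 * (p * (lam * q - b)).
    by move=> ->; ring.
  by rewrite {1 2}phiE; exact: alg.
rewrite (Rint_scale s0 Gk) mulrA -exprMn divff// expr1n mul1r gG//.
by rewrite /psi scaler0.
Qed.

Lemma wder_shift u g b : wder u g -> wder (fun x => u (x + b)) (fun i x => g i (x + b)).
Proof.
have sqs f : sqint mu f -> sqint mu (fun x => f (x + b)).
  move=> [mf fi]; split.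
    have := @measurable_affine_comp _ 1 b f mf.
    by under eq_fun do rewrite scale1r.
  by have := intble_affine b ltr01 fi; under eq_fun do rewrite scale1r.
have shift f p : sqint mu f -> testf p -> I (fun x => f (x + b) * p x) = I (fun x => f x * p (x - b)).
  move=> sf tp; rewrite [RHS](Rint_affine b ltr01 (testf_sq_intble sf (testf_shift (- b) tp))).
  rewrite expr1n mul1r; apply: eq_Rintegral => x _.
  by rewrite !scale1r addrK.
move=> [su sg]; split; first exact: sqs.
move=> i; have [sgi wg] := sg i; split; first exact: sqs.
move=> phi tp; rewrite (shift _ _ su (testf_partial i tp)) (shift _ _ sgi tp).
rewrite -(wg _ (testf_shift (- b) tp)); apply: eq_Rintegral => x _; congr (_ * _).
have := partial_affine i 1 (- b) (proj1 tp); under eq_fun do rewrite scale1r.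
by move=> /(congr1 (@^~ x)) /= ->; rewrite mul1r scale1r.
Qed.

(* [D = G - G(4 .)] is in [H^1], hence in [L^4].  The truncations
   [h = min(|G|, M)] satisfy [h <= |D| + h(4 .)], and the last term scales,
   so that [\int h^4 <= 8 \int D^4 + 1/2 \int h^4]. *)
Lemma green_L4 (lam : R) (G : plane -> R) : 0 < lam -> is_greenR lam G ->
  sqint mu (fun x => G x ^+ 2).
Proof.
move=> lam0 gG; have [sG _] := gG; have [mG iG] := sG.
have p4 : (0 : R) < 4 by [].
have gG4 := green_scale p4 gG.
have lam4 : 0 < 4 ^+ 2 * lam by rewrite mulr_gt0// exprn_gt0.
have [h wD] := green_diff lam0 gG gG4.
have [[mD2 iD4] _] := gagliardo_nirenberg lam0 wD.
pose D x := G x - G (4 *: x).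
have f4 (f : plane -> R) : (fun x => f x ^+ 4) = (fun x => (f x ^+ 2) ^+ 2).
  by apply/funext => x; rewrite -exprM.
have {}iD4 : intble mu (fun x => D x ^+ 4) by rewrite f4.
pose t (M : nat) (x : plane) := Num.min `|G x| M%:R.
have t0 M x : 0 <= t M x by rewrite /t le_min normr_ge0 ler0n.
have mt M : measurable_fun setT (t M : mplane -> R).
  by apply: measurable_minr => //; exact: measurableT_comp.
have it M : intble mu (fun x => t M x ^+ 4).
  apply: (@intble_le _ _ R (leb2 R) _ (fun x => M%:R ^+ 2 * G x ^+ 2)).
  - exact: measurable_funX.
  - exact: intbleZ.
  move=> x; rewrite ger0_norm; last by apply: exprn_ge0.
  rewrite -[4%N]/(2 + 2)%N exprD; apply: ler_pM; try exact: sqr_ge0.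
    by rewrite lerXn2r ?nnegrE ?ler0n// /t ge_min lexx orbT.
  by rewrite -[leRHS]real_normK ?num_real// lerXn2r ?nnegrE// /t ge_min lexx.
have tt M x : t M x <= `|D x| + t M (4 *: x).
  rewrite /t /D; move: (G x) (G (4 *: x)) => a b.
  have := ler_normD (a - b) b; rewrite subrK => ab.
  have n1 := normr_ge0 (a - b); rewrite addrC -lerBlDr le_min; apply/andP; split.
    by rewrite lerBlDr; apply: le_trans (_ : `|a| <= _); [rewrite ge_min lexx|rewrite addrC].
  by rewrite lerBlDr; apply: le_trans (_ : M%:R <= _); [rewrite ge_min lexx orbT|rewrite lerDl].
have bound M : I (fun x => t M x ^+ 4) <= 16 * I (fun x => D x ^+ 4).
  have i4 := intble_scale p4 (it M).
  have h1 : I (fun x => t M x ^+ 4) <= I (fun x => 8 * D x ^+ 4 + 8 * t M (4 *: x) ^+ 4).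
    apply: Rint_le => //; first by apply: intbleD; exact: intbleZ.
    move=> x; have := tt M x; have := t0 M x; have := t0 M (4 *: x).
    have -> : D x ^+ 4 = `|D x| ^+ 4 by rewrite -[4%N]/(2 * 2)%N !exprM real_normK ?num_real.
    move: (t M x) (t M (4 *: x)) (normr_ge0 (D x)); move: (`|D x|) => a p b a0 b0 p0 pab.
    have -> : 8 * a ^+ 4 + 8 * b ^+ 4 = (a + b) ^+ 4 + (a - b) ^+ 2 * (7 * a ^+ 2 + 10 * (a * b) + 7 * b ^+ 2) by ring.
    apply: (@le_trans _ _ ((a + b) ^+ 4)); first by rewrite lerXn2r ?nnegrE ?addr_ge0.
    by rewrite lerDl mulr_ge0 ?sqr_ge0// !addr_ge0 ?mulr_ge0 ?sqr_ge0.
  have iD8 := intbleZ 8 iD4; have i48 := intbleZ 8 i4.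
  move: h1; rewrite RintD// RintZ// RintZ// (Rint_scale p4 (it M)).
  have n0 : 0 <= I (fun x => t M x ^+ 4) by apply: Rint_ge0 => x; exact: exprn_ge0.
  have -> : (4^-1 : R) ^+ 2 = 16^-1 by field.
  move: (I (fun x => t M x ^+ 4)) (I (fun x => D x ^+ 4)) n0 => p q ? ?; lra.
pose A (M : nat) : set plane := [set x | `|G x| <= M%:R].
have mA M : measurable (A M : set mplane).
  rewrite (_ : A M = [set: plane] `&` (fun x => `|G x|) @^-1` [set` `]-oo, M%:R]]).
    by apply: (measurableT_comp (@normr_measurable R setT) mG) => //; exact: measurable_itv.
  by apply/seteqP; split => x /=; rewrite ?in_itv/=; [|case]; rewrite ?in_itv/=.
have G4 x : 0 <= G x ^+ 4 by rewrite -[4%N]/(2 * 2)%N exprM sqr_ge0.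
have GA M x : G x ^+ 4 * \1_(A M) x <= t M x ^+ 4.
  rewrite indicE; have [xA|_] := boolP (x \in A M); last by rewrite mulr0 exprn_ge0.
  move: xA; rewrite inE /A /= => xA; rewrite mulr1 /t min_l//.
  by rewrite -[4%N]/(2 * 2)%N !exprM real_normK ?num_real.
have iA M : intble mu (fun x => G x ^+ 4 * \1_(A M) x).
  apply: (@intble_le _ _ R (leb2 R) _ (fun x => t M x ^+ 4)) => //.
    by apply: measurable_funM; [exact: measurable_funX|exact: measurable_indic].
  by move=> x; rewrite ger0_norm// mulr_ge0.
have [|||||||i X4] := @mono_intble _ _ R (leb2 R) (fun x => G x ^+ 4) A (16 * I (fun x => D x ^+ 4)).
- exact: measurable_funX.
- exact: G4.
- exact: mA.
- by move=> M x /=; rewrite /A /= => /le_trans; apply; rewrite ler_nat.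
- by move=> x; exists (Num.bound `|G x|); rewrite /A/=; apply/ltW; rewrite archi_boundP.
- exact: iA.
- by move=> M; apply: le_trans (bound M); apply: Rint_le.
split; first exact: measurable_funX.
by move: i; rewrite f4.
Qed.

Lemma test_at0 : exists2 f : plane -> R, testf f & f 0 = 1.
Proof.
have t := @testf_step R 0 (-1) 1 (-1) 1; set psi := (X in testf X) in t.
have p0 : psi 0 != 0.
  have s0 : step 0 (-1) 1 (0 : R) != 0.
    rewrite /step !mulr0 !mul1r !add0r opprK mulf_neq0//; rewrite /flat ltr01 expr0 invr1 mul1r gt_eqF// expR_gt0.
  by rewrite /psi mulf_neq0.
exists (fun x => (psi 0)^-1 * psi x); first exact: testfZ.
by rewrite mulVf.
Qed.

Lemma en_test (lam : R) f v : testf f -> testf v ->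
  en lam f (grad f) v (grad v) = I (fun x => f x * (lam * v x - lap v x)).
Proof. by move=> tf tv; rewrite -(wder_helmholtz lam (wder_test tf) tv). Qed.

Lemma en_average (lam : R) f v : testf f -> testf v ->
  let c := fun x => 2^-1 * f x + 2^-1 * v x in
  en lam c (grad c) c (grad c) =
  4^-1 * (en lam f (grad f) f (grad f) + en lam v (grad v) v (grad v) + 2 * en lam f (grad f) v (grad v)).
Proof.
move=> tf tv /=; set c := fun x => _.
have tv2 := testfZ 2^-1 tv; have tc : testf c by apply: testfD => //; exact: testfZ.
have sq f' (tf' : testf f') := testf_sqint tf'.
have E (p q : plane -> R) : testf p -> testf q -> I (fun x => (2^-1 * p x + 2^-1 * q x) * (2^-1 * p x + 2^-1 * q x)) =
    4^-1 * (I (fun x => p x * p x) + I (fun x => q x * q x) + 2 * I (fun x => p x * q x)).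
  move=> tp tq; have pp := testfM_intble tp tp; have qq := testfM_intble tq tq; have pq := testfM_intble tp tq.
  have pq2 := intbleZ 2 pq; have ppqq := intbleD pp qq; have all3 := intbleD ppqq pq2.
  rewrite -(RintZ 2)// -(RintD pp qq) -(RintD ppqq pq2) -(RintZ _ all3).
  by apply: eq_Rintegral => x _; field.
have gE i : partial i c = (fun x => 2^-1 * partial i f x + 2^-1 * partial i v x).
  apply: etrans (partial_linear i 2^-1 tf tv2) _; apply/funext => x; congr (_ + _).
  exact: (congr1 (@^~ x) (partialZ i 2^-1 (proj1 tv))).
have F i : I (fun x => grad c i x * grad c i x) = 4^-1 * (I (fun x => grad f i x * grad f i x) + I (fun x => grad v i x * grad v i x) + 2 * I (fun x => grad f i x * grad v i x)).
  apply: etrans (congr1 (fun p : plane -> R => I (fun x => p x * p x)) (gE i)) _.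
  exact: (E _ _ (testf_partial i tf) (testf_partial i tv)).
have alg (a0 b0 c0 a1 b1 c1 a2 b2 c2 d0 d1 d2 : R) : d0 = 4^-1 * (a0 + b0 + 2 * c0) -> d1 = 4^-1 * (a1 + b1 + 2 * c1) -> d2 = 4^-1 * (a2 + b2 + 2 * c2) ->
    d0 + d1 + lam * d2 = 4^-1 * ((a0 + a1 + lam * a2) + (b0 + b1 + lam * b2) + 2 * (c0 + c1 + lam * c2)).
  by move=> -> -> ->; ring.
exact: (alg _ _ _ _ _ _ _ _ _ _ _ _ (F 0) (F 1) (E _ _ tf tv)).
Qed.

(* Otherwise [phi 0 ^ 2 <= C E(phi)] on test functions.  Let [S > 0] be the
   infimum of [E] over [phi 0 = 1]; for a near minimizer [phi], the functions
   [phi] and [phi(s .)] become orthogonal as [s] grows, so that their average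
   has energy about [S / 2]. *)
Lemma green_notin_H1 (lam : R) (G : plane -> R) g : 0 < lam -> is_greenR lam G -> ~ wder G g.
Proof.
move=> lam0 [sG gG] wG.
pose E f := en lam f (grad f) f (grad f).
pose C := en lam G g G g.
have ht f : testf f -> h1l2 f (grad f) by move=> tf; exact/wder_h1l2/wder_test.
have CE f : testf f -> f 0 ^+ 2 <= C * E f.
  by move=> tf; rewrite -(gG _ tf) (wder_helmholtz lam wG tf); apply: en_CS => //; [exact: wder_h1l2|exact: ht].
pose Z := [set E f | f in [set f | testf f /\ f 0 = 1]].
have [f0 tf0 f01] := test_at0.
have C0 : 0 < C.
  have := CE _ tf0; rewrite f01 expr1n; have : 0 <= C by exact/en_ge0/wder_h1l2.
  by rewrite le_eqVlt => /predU1P[<-|//]; rewrite mul0r ler10.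
have ZC : lbound Z C^-1.
  by move=> _ [f [tf f1] <-]; have := CE _ tf; rewrite f1 expr1n -ler_pdivrMl ?mulr1//.
have hZ : has_inf Z by split; [exists (E f0), f0|exists C^-1].
pose S := inf Z.
have S0 : 0 < S by apply: (@lt_le_trans _ _ C^-1); [rewrite invr_gt0|apply: lb_le_inf; [case: hZ|]].
have SE f : testf f -> f 0 = 1 -> S <= E f by move=> tf f1; apply: ge_inf; [case: hZ|exists f].
have [|_ [f [tf f1] <-] fS] := @inf_adherent _ Z (S / 4) _ hZ; first by rewrite divr_gt0.
pose k x := lam * f x - lap f x.
have sk : sqint mu k by apply: testf_sqint; apply: testfB; [exact: testfZ|exact: testf_lap].
(* Young's inequality with weight s bounds the product of f(s .) and f by (N f + N k) / (2 s), since
   N (f(s .)) = s^-2 N f. This s makes it at most S / 4. *)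
pose s : R := (N f + N k) / S * 2 + 1.
have NN : 0 <= N f + N k by rewrite addr_ge0// N_ge0.
have s1 : 1 <= s by rewrite /s lerDr mulr_ge0// divr_ge0// ltW.
have s0 : 0 < s by apply: lt_le_trans s1.
pose fs x := f (s *: x).
have tfs : testf fs by apply: testf_scale => //; rewrite gt_eqF.
have [_ if2] := testf_sqint tf.
have Nfs : N fs = s^-1 ^+ 2 * N f by exact: (Rint_scale s0 if2).
have s2 : s^-1 ^+ 2 <= 1 by rewrite expr_le1// ?invr_ge0 ?invf_le1// ltW.
have Efs : E fs <= E f.
  rewrite /E !en_self; apply: lerD; last by rewrite ler_wpM2l ?(ltW lam0)// Nfs ler_piMl// N_ge0.
  have pE i : N (grad fs i) <= N (grad f i).
    have [_ ifi] := testf_sqint (testf_partial i tf).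
    have -> : N (grad fs i) = s ^+ 2 * (s^-1 ^+ 2 * N (grad f i)).
      rewrite -(Rint_scale s0 ifi) -RintZ; last exact: (intble_scale s0 ifi).
      apply: eq_Rintegral => x _; rewrite -exprMn; congr (_ ^+ 2).
      exact: (congr1 (@^~ x) (partial_scale i s (proj1 tf))).
    by rewrite mulrA -exprMn divff ?gt_eqF// expr1n mul1r.
  by apply: lerD.
have cross : en lam fs (grad fs) f (grad f) <= S / 4.
  rewrite (en_test lam tfs tf); apply: le_trans (young s0 (testf_sqint tfs) sk) _.
  have -> : s / 2 * N fs + (2 * s)^-1 * N k = (N f + N k) / (2 * s).
    by rewrite Nfs; field; rewrite gt_eqF.
  rewrite ler_pdivrMr ?mulr_gt0// /s.
  have -> : S / 4 * (2 * ((N f + N k) / S * 2 + 1)) = (N f + N k) + S / 2 by field; rewrite gt_eqF.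
  by rewrite lerDl divr_ge0// ltW.
pose c x := 2^-1 * f x + 2^-1 * fs x.
have tc : testf c by apply: testfD; exact: testfZ.
have c1 : c 0 = 1 by rewrite /c /fs scaler0 f1; field.
(* The average still takes the value 1 at 0, but its energy is at most (5/4 S + 5/4 S + 1/2 S) / 4 =
   3/4 S. *)
have := SE _ tc c1; rewrite /E (en_average lam tf tfs) -!/(E _).
have -> : en lam f (grad f) fs (grad fs) = en lam fs (grad fs) f (grad f).
  have l0 := ltW lam0; rewrite -(dot_jet l0 (ht _ tf) (ht _ tfs)) -(dot_jet l0 (ht _ tfs) (ht _ tf)); exact: dotC.
move: fS cross Efs S0; rewrite -/S.
move: (E f) (E fs) (en _ _ _ _ _) => a b d h1 h2 h3 h4; apply/negP; rewrite -ltNge; lra.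
Qed.

End Green2.

(** * Convolution with the Green function *)

Section RealFubini.
Context d1 d2 (T1 : measurableType d1) (T2 : measurableType d2) (R : realType).
Variable m1 : {sigma_finite_measure set T1 -> \bar R}.
Variable m2 : {sigma_finite_measure set T2 -> \bar R}.
Implicit Types H : T1 * T2 -> R.

Lemma measurable_Rint1 H : measurable_fun setT H -> (forall y, intble m1 (fun x => H (x, y))) ->
  measurable_fun setT (fun y => \int[m1]_x H (x, y)).
Proof.
move=> mH iH.
have mge0 (K : T1 * T2 -> R) : measurable_fun setT K -> (forall p, 0 <= K p) ->
    measurable_fun setT (fun y => \int[m1]_x K (x, y)).
  move=> mK K0; apply: measurableT_comp => //.
  apply: (@measurable_fun_fubini_tonelli_G _ _ _ _ R m1 (EFin \o K)); first exact/measurable_EFinP.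
  by move=> p; rewrite /= lee_fin.
have mn : measurable_fun setT (fun p => `|H p|) by exact: measurableT_comp.
rewrite (_ : (fun y => _) = fun y => \int[m1]_x (`|H (x, y)| + H (x, y)) - \int[m1]_x `|H (x, y)|).
  apply: measurable_funB; last exact: (mge0 (fun p => `|H p|)).
  apply: (mge0 (fun p => `|H p| + H p)); first exact: measurable_funD.
  by move=> p; have := ler_norm (- H p); rewrite normrN; lra.
by apply/funext => y; have in1 := intble_norm (iH y); rewrite RintD// addrAC subrr add0r.
Qed.

Lemma Rfubini H (B : T2 -> R) : measurable_fun setT H ->
  (forall x, intble m2 (fun y => H (x, y))) -> (forall y, intble m1 (fun x => H (x, y))) ->
  intble m2 B -> (forall y, \int[m1]_x `|H (x, y)| <= B y) ->
  [/\ intble m1 (fun x => \int[m2]_y H (x, y)), intble m2 (fun y => \int[m1]_x H (x, y)) &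
    \int[m1]_x \int[m2]_y H (x, y) = \int[m2]_y \int[m1]_x H (x, y)].
Proof.
move=> mH i2 i1 iB HB; have mE : measurable_fun setT (EFin \o H) by exact/measurable_EFinP.
have iH : (m1 \x m2)%E.-integrable setT (EFin \o H).
  apply/(integrable21ltyP _ _ mE).
  have [mB fB] := integrableP _ _ _ iB; apply: le_lt_trans fB.
  apply: ge0_le_integral => //.
  - by move=> y _; apply: integral_ge0.
  - apply: (@measurable_fun_fubini_tonelli_G _ _ _ _ R m1 (abse \o (EFin \o H))).
      exact: (measurableT_comp (f := abse)).
    by move=> x; exact: abse_ge0.
  - exact: (measurableT_comp (f := abse)).
  move=> y _; have := EFin_Rint (intble_norm (i1 y)) => /= <-.
  by rewrite lee_fin (le_trans (HB y))// ler_norm.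
have EG : fubini_G m1 (EFin \o H) = EFin \o (fun y => \int[m1]_x H (x, y)).
  by apply/funext => y; rewrite /= EFin_Rint.
have EF : fubini_F m2 (EFin \o H) = EFin \o (fun x => \int[m2]_y H (x, y)).
  by apply/funext => y; rewrite /= EFin_Rint.
have IF : intble m1 (fun x => \int[m2]_y H (x, y)) by rewrite /intble -EF; exact: integrable_fubini_F.
have mG : measurable_fun setT (fun y => \int[m1]_x H (x, y)) by exact: measurable_Rint1.
split => //.
  apply: intble_le mG iB _ => y.
  by apply: le_trans (HB y); exact: Rint_norm.
rewrite /Rintegral; congr fine.
transitivity (\int[m1]_x fubini_F m2 (EFin \o H) x)%E.
  by rewrite EF.
rewrite integral12_prod_meas1// -(integral21_prod_meas1 iH).
by rewrite EG.
Qed.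

End RealFubini.

Section SigmaFinite.
Variable R : realType.
Local Notation mplane := (measurableTypeR R * measurableTypeR R)%type.

Let leb2_raw : set mplane -> \bar R := leb2 R.

Let sigma_finite_leb2 : sigma_finite setT leb2_raw.
Proof.
exists (fun n => box n%:R).
  apply/seteqP; split => // x _; exists (Num.bound `|x|) => //.
  by apply/boxP/ltW; rewrite archi_boundP.
move=> n; split; first exact: box_measurable.
rewrite /leb2_raw /leb2 [X in (X < _)%E]product_measure1E; try exact: measurable_itv.
rewrite [X in (X * _)%E]lebesgue_measure_itv [X in (_ * X)%E]lebesgue_measure_itv /=.
by case: ifP => _; rewrite ?mul0e ?ltry// -EFinD -EFinM ltry.
Qed.

HB.instance Definition _ := Measure.on leb2_raw.
HB.instance Definition _ := Measure_isSigmaFinite.Build _ _ _ leb2_raw sigma_finite_leb2.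

Definition leb2_sigma_finite : {sigma_finite_measure set mplane -> \bar R} := leb2_raw.

End SigmaFinite.

Section Convolution.
Variable R : realType.
Local Notation plane := (R * R)%type.
Local Notation mplane := (measurableTypeR R * measurableTypeR R)%type.
Local Notation mu := (leb2 R).
Local Notation smu := (leb2_sigma_finite R).
Local Notation I f := (\int[leb2 R]_x f x).
Variables (k G : plane -> R).
Hypothesis mk : measurable_fun setT (k : mplane -> R).
Hypothesis mG : measurable_fun setT (G : mplane -> R).
Hypothesis ki : forall psi, testf psi -> intble mu (fun x => k x * psi x).
Hypothesis Gi : forall psi, testf psi -> intble mu (fun x => G x * psi x).
Hypothesis kGi : forall y, intble mu (fun x => k (x + y) * G x).
Variable C : R.
Hypothesis kGC : forall y, I (fun x => `|k (x + y) * G x|) <= C.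

Let madd : measurable_fun setT (fun p : mplane * mplane => (p.1 + p.2 : mplane)).
Proof.
apply/measurable_fun_pair.
  by apply: measurable_funD; [exact: (measurableT_comp measurable_fst measurable_fst)|exact: (measurableT_comp measurable_fst measurable_snd)].
by apply: measurable_funD; [exact: (measurableT_comp measurable_snd measurable_fst)|exact: (measurableT_comp measurable_snd measurable_snd)].
Qed.

Let msub : measurable_fun setT (fun p : mplane * mplane => (p.1 - p.2 : mplane)).
Proof.
apply/measurable_fun_pair.
  by apply: measurable_funB; [exact: (measurableT_comp measurable_fst measurable_fst)|exact: (measurableT_comp measurable_fst measurable_snd)].
by apply: measurable_funB; [exact: (measurableT_comp measurable_snd measurable_fst)|exact: (measurableT_comp measurable_snd measurable_snd)].
Qed.

Let W (y : plane) : R := I (fun x => k (x + y) * G x).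

Let mkG : measurable_fun setT (fun p : mplane * mplane => k (p.1 + p.2) * G p.1).
Proof.
apply: measurable_funM; first exact: (measurableT_comp mk madd).
exact: (measurableT_comp mG measurable_fst).
Qed.

Lemma conv_measurable : measurable_fun setT (W : mplane -> R).
Proof. exact: (@measurable_Rint1 _ _ _ _ R smu (fun p => k (p.1 + p.2) * G p.1) mkG kGi). Qed.

Let Rint_shift (f : plane -> R) b : intble mu f -> I (fun x => f (b + x)) = I f.
Proof.
move=> fi; rewrite [RHS](Rint_affine b ltr01 fi) expr1n mul1r.
by apply: eq_Rintegral => x _; rewrite scale1r addrC.
Qed.

Let intble_shift (f : plane -> R) b : intble mu f -> intble mu (fun x => f (b + x)).
Proof.
move=> fi; have := intble_affine b ltr01 fi; congr (intble _ _).
by apply/funext => x; rewrite scale1r addrC.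
Qed.

Lemma testf_reflect f (z : plane) : testf f -> testf (fun x => f (z - x)).
Proof.
have n1 : -1 != 0 :> R by rewrite oppr_eq0.
by move=> /(testf_affine z n1); under eq_fun do rewrite scaleN1r addrC.
Qed.

(** The shear z = x + y is never performed on the product space: integrals are exchanged in (x, y),
    then z = x + y is substituted for each fixed x, then integrals are exchanged in (z, x). *)
Lemma conv_fubini q : testf q -> I (fun y => W y * q y) = I (fun z => k z * I (fun x => G x * q (z - x))).
Proof.
move=> tq; have [mq _] := testf_sqint tq; have qi := testf_intble tq.
pose H (p : mplane * mplane) : R := k (p.1 + p.2) * G p.1 * q p.2.
have mH : measurable_fun setT H by apply: measurable_funM => //; exact: (measurableT_comp mq measurable_snd).
have kqi (x : plane) : intble mu (fun z => k z * q (z - x)) by apply: ki; exact: testf_shift.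
have kqsi (x : plane) : intble mu (fun y => k (x + y) * q y).
  have := intble_shift x (kqi x); congr (intble _ _); apply/funext => y.
  by rewrite [x + y]addrC addrK.
have Hx x : intble mu (fun y => H (x, y)).
  have := intbleZ (G x) (kqsi x); congr (intble _ _); apply/funext => y; rewrite /H /=; ring.
have Hy y : intble mu (fun x => H (x, y)).
  have := intbleZ (q y) (kGi y); congr (intble _ _); apply/funext => x; rewrite /H /=; ring.
have HB y : I (fun x => `|H (x, y)|) <= C * `|q y|.
  have E : I (fun x => `|H (x, y)|) = `|q y| * I (fun x => `|k (x + y) * G x|).
    have ni := intble_norm (kGi y); rewrite -RintZ//.
    by apply: eq_Rintegral => x _; rewrite /H normrM mulrC.
  by rewrite E mulrC ler_wpM2r.
have iB : intble mu (fun y => C * `|q y|) by apply: intbleZ; exact: intble_norm.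
have [_ _ F1] := @Rfubini _ _ _ _ R smu smu H _ mH Hx Hy iB HB.
have Hxn x := intble_norm (Hx x); have Hyn y := intble_norm (Hy y).
have HBn y : I (fun x => `| `|H (x, y)| |) <= C * `|q y|.
  by under eq_Rintegral do rewrite normr_id; exact: HB.
have mHn : measurable_fun setT (fun p => `|H p|) by exact: measurableT_comp.
(* Fubini for |H| makes the integral of |H (x, .)| integrable in x; it is the dominating function
   for the second exchange. *)
have [iA _ _] := @Rfubini _ _ _ _ R smu smu (fun p => `|H p|) _ mHn Hxn Hyn iB HBn.
pose K (p : mplane * mplane) : R := k p.1 * (G p.2 * q (p.1 - p.2)).
have mK : measurable_fun setT K.
  apply: measurable_funM; first exact: (measurableT_comp mk measurable_fst).
  by apply: measurable_funM; [exact: (measurableT_comp mG measurable_snd)|exact: (measurableT_comp mq msub)].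
have Kz z : intble mu (fun x => K (z, x)).
  by rewrite /K /=; apply: (@intbleZ _ _ _ mu (k z)); apply: Gi; exact: testf_reflect.
have Kx x : intble mu (fun z => K (z, x)).
  have := intbleZ (G x) (kqi x); congr (intble _ _); apply/funext => z; rewrite /K /=; ring.
have KH x y : K (x + y, x) = H (x, y).
  rewrite /K /H /= [x + y - x](_ : _ = y); first by ring.
  by rewrite [x + y]addrC addrK.
have KB x : I (fun z => `|K (z, x)|) <= I (fun y => `|H (x, y)|).
  rewrite -(Rint_shift x (intble_norm (Kx x))).
  by under eq_Rintegral do rewrite KH.
have [_ _ F2] := @Rfubini _ _ _ _ R smu smu K _ mK Kz Kx iA KB.
transitivity (I (fun y => I (fun x => H (x, y)))).
  apply: eq_Rintegral => y _; rewrite /W mulrC -RintZ//.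
  by apply: eq_Rintegral => x _; rewrite /H mulrC.
rewrite -F1.
transitivity (I (fun x => I (fun z => K (z, x)))).
  apply: eq_Rintegral => x _; rewrite -(Rint_shift x (Kx x)).
  by apply: eq_Rintegral => y _; rewrite KH.
rewrite -F2; apply: eq_Rintegral => z _.
by rewrite -RintZ//; apply: Gi; exact: testf_reflect.
Qed.

End Convolution.

(** * Near optimizers of the free problem *)

Section Quartic.
Context d (T : measurableType d) (R : realType).
Variable mu : {measure set T -> \bar R}.
Local Notation I f := (\int[mu]_x f x).
Local Notation N f := (\int[mu]_x (f x ^+ 2)).
Implicit Types f g p q r s : T -> R.

Definition L4 f := sqint mu f /\ sqint mu (fun x => f x ^+ 2).

(** The density |u|^4 + |v|^4 + 2 be |u|^2 |v|^2 for u = a + i b and v = c + i e. *)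
Definition quartic (be a b c e : R) : R :=
  (a ^+ 2 + b ^+ 2) ^+ 2 + (c ^+ 2 + e ^+ 2) ^+ 2 + 2 * be * ((a ^+ 2 + b ^+ 2) * (c ^+ 2 + e ^+ 2)).

Definition Nq be p q r s := I (fun x => quartic be (p x) (q x) (r x) (s x)).

Lemma sqint_mul f g : L4 f -> L4 g -> sqint mu (fun x => f x * g x).
Proof.
move=> [[mf _] f2] [[mg _] g2]; split; first exact: measurable_funM.
by have := sqint_intbleM f2 g2; congr (intble _ _); apply/funext => x; rewrite exprMn.
Qed.

Lemma L4Z (a : R) f : L4 f -> L4 (fun x => a * f x).
Proof.
move=> [f1 f2]; split; first exact: sqintZ.
by have := sqintZ (a ^+ 2) f2; congr (sqint _ _); apply/funext => x; rewrite exprMn.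
Qed.

Lemma L4D f g : L4 f -> L4 g -> L4 (fun x => f x + g x).
Proof.
move=> hf hg; have [f1 f2] := hf; have [g1 g2] := hg; split; first exact: sqintD.
have := sqintD (sqintD f2 (sqintZ 2 (sqint_mul hf hg))) g2.
by congr (sqint _ _); apply/funext => x; ring.
Qed.

Lemma quartic_intble be p q r s : L4 p -> L4 q -> L4 r -> L4 s ->
  intble mu (fun x => quartic be (p x) (q x) (r x) (s x)).
Proof.
move=> [_ p2] [_ q2] [_ r2] [_ s2]; have pq := sqintD p2 q2; have rs := sqintD r2 s2.
apply: intbleD; first by apply: intbleD; [exact: pq.2|exact: rs.2].
by apply: intbleZ; exact: sqint_intbleM.
Qed.

(** The graph lies above its tangent in the first variable because the difference is a sum of
    squares with nonnegative coefficients. As h may have any sign, this replaces differentiation of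
    the quartic integral. *)
Lemma quartic_convex be (a b c e h : R) : 0 <= be ->
  quartic be a b c e + 4 * ((a ^+ 2 + b ^+ 2 + be * (c ^+ 2 + e ^+ 2)) * a * h) <= quartic be (a + h) b c e.
Proof.
move=> be0; rewrite /quartic -subr_ge0.
rewrite (_ : _ - _ = (2 * a * h + h ^+ 2) ^+ 2 + 2 * (a ^+ 2 + b ^+ 2) * h ^+ 2 +
  2 * be * (c ^+ 2 + e ^+ 2) * h ^+ 2); last by ring.
have sq2 (x y : R) : 0 <= x ^+ 2 + y ^+ 2 by apply: addr_ge0; exact: sqr_ge0.
apply: addr_ge0; first apply: addr_ge0; first exact: sqr_ge0.
  by apply: mulr_ge0; [exact: mulr_ge0|exact: sqr_ge0].
by apply: mulr_ge0; [apply: mulr_ge0 => //; exact: mulr_ge0|exact: sqr_ge0].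
Qed.

(** A quarter of the derivative of [quartic] in its first argument: the nonlinearity of the
    Euler-Lagrange equation for the real part of the first component. *)
Definition coef be p q r s x := (p x ^+ 2 + q x ^+ 2 + be * (r x ^+ 2 + s x ^+ 2)) * p x.

Lemma coef_intble be p q r s f : L4 p -> L4 q -> L4 r -> L4 s -> L4 f ->
  intble mu (fun x => coef be p q r s x * f x).
Proof.
move=> hp [_ q2] [_ r2] [_ s2] hf; have [_ p2] := hp.
have := sqint_intbleM (sqintD (sqintD p2 q2) (sqintZ be (sqintD r2 s2))) (sqint_mul hp hf).
by congr (intble _ _); apply/funext => x; rewrite /coef mulrA.
Qed.

Lemma Nq_convex be p q r s f (t : R) : 0 <= be -> L4 p -> L4 q -> L4 r -> L4 s -> L4 f ->
  Nq be p q r s + 4 * t * I (fun x => coef be p q r s x * f x) <= Nq be (fun x => p x + t * f x) q r s.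
Proof.
move=> be0 hp hq hr hs hf; have ci := coef_intble be hp hq hr hs hf.
have cti := intbleZ (4 * t) ci; have ni := quartic_intble be hp hq hr hs.
rewrite -RintZ// /Nq -RintD//; apply: Rint_le; [exact: intbleD|by apply: quartic_intble => //; apply: L4D => //; exact: L4Z|].
move=> x; apply: le_trans (quartic_convex _ _ _ _ _ be0).
by rewrite lerD2l le_eqVlt; apply/orP; left; apply/eqP; rewrite /coef; ring.
Qed.

Lemma Rint_le_ae f g : intble mu f -> intble mu g -> {ae mu, forall x, f x <= g x} -> I f <= I g.
Proof.
move=> fi gi fg; pose h x := Num.max (f x) (g x).
have mh : measurable_fun setT h by apply: measurable_maxr; [exact: intble_meas fi|exact: intble_meas gi].
have hi : intble mu h.
  apply: (@intble_le _ _ _ mu _ (fun x => `|f x| + `|g x|)) => //.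
    by apply: intbleD; exact: intble_norm.
  by move=> x; rewrite /h /Num.max; case: ifP => _; rewrite ?lerDl ?lerDr.
have -> : I g = I h.
  apply: ae_Rint_eq => //; first exact: intble_meas gi.
  by apply: (ae_imp fg) => x fgx; rewrite /h max_r.
by apply: Rint_le => // x; rewrite /h le_max lexx.
Qed.

End Quartic.

(** 1 + 2 t a + t^2 b is the quadratic form along a line and 16 c t F the first-order change of 4 c
    N. To first order the hypothesis is 4 t (a - 4 c F) + tau^2 >= 0. At t = +- tau / sqrt B the
    neglected terms are also O(tau^2), and division by t leaves an error 3 tau sqrt B. *)
Lemma near_optimal_slope (R : realType) (a b c F B tau : R) : 0 < c -> 0 < tau -> tau <= 1 ->
  0 <= b -> b <= B -> a ^+ 2 <= B ->
  (forall t, 0 <= (1 + 2 * t * a + t ^+ 2 * b) ^+ 2 - (1 - tau ^+ 2) - 16 * c * t * F) ->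
  (4 * c * F - a) ^+ 2 <= 9 * tau ^+ 2 * B.
Proof.
move=> c0 tau0 tau1 b0 bB aB H; have B0 := le_trans b0 bB.
(* If B = 0 then a = b = 0 and the hypothesis is affine in t with slope -16 c F; a t at which it
   equals -1 exists unless F = 0. *)
have [Bz|BN0] := eqVneq B 0.
  have a0 : a = 0 by apply/eqP; rewrite -sqrf_eq0 eq_le sqr_ge0 andbT -Bz.
  have bz : b = 0 by apply/eqP; rewrite eq_le b0 -Bz bB.
  have [->|FN0] := eqVneq F 0; first by rewrite a0 mulr0 subr0 expr0n Bz mulr0.
  have := H ((tau ^+ 2 + 1) / (16 * c * F)); rewrite a0 bz !mulr0 !addr0 expr1n.
  have -> : 16 * c * ((tau ^+ 2 + 1) / (16 * c * F)) * F = tau ^+ 2 + 1.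
    by field; rewrite FN0 gt_eqF.
  by move: (tau ^+ 2) => q h; exfalso; lra.
have {}B0 : 0 < B by rewrite lt_def BN0.
pose s := Num.sqrt B; have s0 : 0 < s by rewrite sqrtr_gt0.
have s2 : s ^+ 2 = B by rewrite sqr_sqrtr// ltW.
have as_ : `|a| <= s by rewrite -sqrtr_sqr; exact: ler_wsqrtr.
(* The factor 3 is 12 / 4: with x = 2 t a and y = t^2 b, the error 2 y + (x + y)^2 + tau^2 is at
   most (2 + 9 + 1) tau^2. *)
have key e : e ^+ 2 = 1 -> e * (4 * c * F - a) <= 3 * tau * s.
  move=> e2; pose r := tau / s.
  have en : `|e| = 1 by apply/eqP; rewrite -sqrp_eq1// real_normK ?num_real// e2.
  have rs : r * s = tau by rewrite /r mulfVK// gt_eqF.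
  have r0 : 0 < r by rewrite divr_gt0.
  clearbody r.
  have := H (e * r); rewrite [(e * r) ^+ 2]exprMn e2 mul1r.
  pose x := 2 * (e * r) * a; have xb : `|x| <= 2 * tau.
    have -> : `|x| = 2 * (r * `|a|) by rewrite /x !normrM en (gtr0_norm r0) normr_nat mul1r mulrA.
    by rewrite -rs ler_pM2l// ler_pM2l.
  have y0 : 0 <= r ^+ 2 * b by rewrite mulr_ge0// sqr_ge0.
  have yb : r ^+ 2 * b <= tau ^+ 2.
    by rewrite -rs exprMn s2 ler_wpM2l// sqr_ge0.
  have xE : 4 * (e * r) * a = 2 * x by rewrite /x; ring.
  rewrite -/x; have -> : 16 * c * (e * r) * F = 4 * (r * (e * (4 * c * F - a))) + 2 * x by rewrite -xE; ring.
  move: (r ^+ 2 * b) y0 yb => y y0 yb.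
  have t2 : tau ^+ 2 <= tau by rewrite expr2 ler_piMl// ltW.
  have sq : (x + y) ^+ 2 <= (3 * tau) ^+ 2.
    rewrite -real_normK ?num_real// lerXn2r ?nnegrE ?mulr_ge0 ?(ltW tau0)//.
    apply: le_trans (ler_normD _ _) _; rewrite (ger0_norm y0).
    by move: xb yb t2; move: (`|x|) (tau ^+ 2) => ? ? ? ? ?; lra.
  move=> h; have : r * (e * (4 * c * F - a)) <= 3 * tau ^+ 2.
    move: h sq; rewrite exprMn.
    have -> : (1 + x + y) ^+ 2 = 1 + 2 * x + 2 * y + (x + y) ^+ 2 by ring.
    move: ((x + y) ^+ 2) (r * _) yb t2 => p q; have -> : (3 : R) ^+ 2 = 9 by ring.
    move: (tau ^+ 2) => w *; lra.
  have -> : 3 * tau ^+ 2 = r * (3 * tau * s) by rewrite -rs; ring.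
  by rewrite ler_pM2l.
have k1 := key 1 (expr1n _ _); have k2 := key (-1) (etrans (sqrrN 1) (expr1n _ _)).
rewrite -s2 (_ : 9 * _ * _ = (3 * tau * s) ^+ 2); last by ring.
rewrite -real_normK ?num_real// lerXn2r ?nnegrE ?mulr_ge0 ?(ltW tau0) ?(ltW s0)//.
by rewrite ler_norml; rewrite mul1r in k1; rewrite mulN1r in k2; rewrite k1 andbT lerNl.
Qed.

Section Concentration.
Variable R : realType.
Local Notation plane := (R * R)%type.
Local Notation mplane := (measurableTypeR R * measurableTypeR R)%type.
Local Notation mu := (leb2 R).
Local Notation I f := (\int[leb2 R]_x f x).
Local Notation N f := (\int[leb2 R]_x (f x ^+ 2)).
Implicit Types (f u v w phi psi : plane -> R) (g h : 'I_2 -> plane -> R).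

Lemma jet_comb (l a : R) u g v h :
  jet l (fun x => a * u x + v x) (comb a g h) = comb a (jet l u g) (jet l v h).
Proof.
apply/funext => j; apply/funext => x; rewrite /jet /comb; case: ifP => _ //; case: ifP => _ //.
by rewrite mulrDr mulrCA.
Qed.

Lemma h1l2_comb (a : R) u g v h : h1l2 u g -> h1l2 v h -> h1l2 (fun x => a * u x + v x) (comb a g h).
Proof.
move=> [su sg] [sv sh]; split; first by apply: sqintD => //; exact: sqintZ.
by move=> i; apply: sqintD => //; exact: sqintZ.
Qed.

Lemma en_comb (l a : R) u g v h : 0 <= l -> h1l2 u g -> h1l2 v h ->
  let w := fun x => a * u x + v x in
  en l w (comb a g h) w (comb a g h) = a ^+ 2 * en l u g u g + 2 * a * en l u g v h + en l v h v h.
Proof.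
move=> l0 hu hv /=; rewrite -(dot_jet l0 (h1l2_comb a hu hv) (h1l2_comb a hu hv)) jet_comb.
rewrite dot_comb; [|exact: jet_l2..].
by rewrite (dot_jet l0 hu hu) (dot_jet l0 hu hv) (dot_jet l0 hv hv).
Qed.

Lemma enC (l : R) u g v h : en l u g v h = en l v h u g.
Proof.
have C (p q : plane -> R) : I (fun x => p x * q x) = I (fun x => q x * p x).
  by apply: eq_Rintegral => x _; rewrite mulrC.
exact: (congr2 +%R (congr2 +%R (C _ _) (C _ _)) (congr1 ( *%R l) (C _ _))).
Qed.

Lemma wder_L4 u g : wder u g -> L4 mu u.
Proof. by move=> wu; have [u2 _] := gagliardo_nirenberg (ltr01 : (0 : R) < 1) wu; split => //; case: wu. Qed.

Lemma helmholtz_functional_linear (l : R) (k : plane -> R) :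
  (forall psi, testf psi -> intble mu (fun x => k x * psi x)) ->
  forall a f v, testf f -> testf v ->
  I (fun x => k x * (l * (a * f x + v x) - lap (fun x => a * f x + v x) x)) =
  a * I (fun x => k x * (l * f x - lap f x)) + I (fun x => k x * (l * v x - lap v x)).
Proof.
move=> ki a f v tf tv.
have [tkf tkv] : testf (fun x => l * f x - lap f x) /\ testf (fun x => l * v x - lap v x).
  by split; apply: testfB; (exact: testfZ || exact: testf_lap).
rewrite -(Rint_lin a (ki _ tkf) (ki _ tkv)).
apply: eq_Rintegral => x _; rewrite (lap_linear a tf tv).
have alg (p q r s t : R) : p * (l * (a * q + r) - (a * s + t)) = p * (a * (l * q - s) + (l * r - t)) by ring.
exact: alg.
Qed.

Lemma lap_reflect phi (z x : plane) : testf phi -> lap (fun x => phi (z - x)) x = lap phi (z - x).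
Proof.
move=> tp; have E i : partial i (partial i (fun x => phi (z - x))) = (fun x => partial i (partial i phi) (z - x)).
  have P f : smooth2 f -> partial i (fun x => f (z - x)) = (fun x => - partial i f (z - x)).
    move=> sf; have := partial_affine i (-1) z sf.
    rewrite (_ : (fun x => f (-1 *: x + z)) = (fun x => f (z - x))); last first.
      by apply/funext => y; rewrite scaleN1r addrC.
    by move=> ->; apply/funext => y; rewrite scaleN1r mulN1r addrC.
  have sp := smooth2_partial i (proj1 tp).
  have sr : smooth2 (fun x => partial i phi (z - x)).
    have := smooth2_affine (-1) z sp; congr smooth2; apply/funext => y.
    by rewrite scaleN1r addrC.
  apply: etrans (congr1 (partial i) (P _ (proj1 tp))) _.
  have -> : (fun x => - partial i phi (z - x)) = (fun x => -1 * partial i phi (z - x)).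
    by apply/funext => y; rewrite mulN1r.
  apply: etrans (partialZ i (-1) sr) _; apply/funext => y.
  have := congr1 (@^~ y) (P _ sp) => /= ->.
  by rewrite mulN1r opprK.
exact: (congr2 (fun p q : plane -> R => p x + q x) (E 0) (E 1)).
Qed.

Variables lam om tom be cc A : R.
Hypotheses (lam0 : 0 < lam) (lam_om : lam <= om) (tom0 : 0 < tom) (be0 : 0 <= be) (cc0 : 0 < cc) (A0 : 0 < A).
Variable G : plane -> R.
Hypothesis gG : is_greenR lam G.

(* [u1 + t G] and [u2] are the real and imaginary parts of the first component,
   [v1] and [v2] those of the second; the charge [t] is real. *)
Definition Qreal t u1 g1 u2 g2 v1 h1 v2 h2 :=
  en lam u1 g1 u1 g1 + en lam u2 g2 u2 g2 + (om - lam) * (N (fun x => u1 x + t * G x) + N u2) +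
  A * t ^+ 2 + (en tom v1 h1 v1 h1 + en tom v2 h2 v2 h2).

(** Supplied later by the assumption that both levels equal [cc]; for t = 0 it is the free quotient
    inequality. *)
Hypothesis HJ : forall t u1 g1 u2 g2 v1 h1 v2 h2,
  wder u1 g1 -> wder u2 g2 -> wder v1 h1 -> wder v2 h2 ->
  4 * cc * Nq mu be (fun x => u1 x + t * G x) u2 v1 v2 <= Qreal t u1 g1 u2 g2 v1 h1 v2 h2 ^+ 2.

Let om0 : 0 < om := lt_le_trans lam0 lam_om.

Lemma en_mass (l m : R) u g : en l u g u g + (m - l) * N u = en m u g u g.
Proof. by rewrite !en_self; ring. Qed.

Lemma en_mass2 (l m : R) u g v h : en l u g v h + (m - l) * I (fun x => u x * v x) = en m u g v h.
Proof.
have alg (a b c : R) : a + b + l * c + (m - l) * c = a + b + m * c by ring.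
exact: alg.
Qed.

Lemma en_om_le u g : en om u g u g <= om / lam * en lam u g u g.
Proof.
have aux (p q r : R) : 0 <= p -> 0 <= q -> p + q + om * r <= om / lam * (p + q + lam * r).
  move=> p0 q0; rewrite mulrDr; apply: lerD; last by rewrite mulrA divfK ?gt_eqF.
  by rewrite ler_peMl ?addr_ge0// ler_pdivlMr ?mul1r.
by rewrite !en_self; apply: aux; exact: N_ge0.
Qed.

Lemma Qreal0 u1 g1 u2 g2 v1 h1 v2 h2 : Qreal 0 u1 g1 u2 g2 v1 h1 v2 h2 =
  en om u1 g1 u1 g1 + en om u2 g2 u2 g2 + (en tom v1 h1 v1 h1 + en tom v2 h2 v2 h2).
Proof.
rewrite /Qreal (_ : N (fun x => u1 x + 0 * G x) = N u1); last first.
  by apply: eq_Rintegral => x _; rewrite mul0r addr0.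
by rewrite -(en_mass lam om u1 g1) -(en_mass lam om u2 g2) expr0n mulr0 addr0; ring.
Qed.

(** The value of the point form at G, which has regular part 0 and charge 1. *)
Let BG := (om - lam) * N G + A.
Let BG0 : 0 < BG.
Proof. by rewrite /BG ltr_wpDl// mulr_ge0 ?subr_ge0// N_ge0. Qed.

Let sG : sqint mu G. Proof. by case: gG. Qed.
Let LG : L4 mu G. Proof. by split; [exact: sG|exact: (green_L4 lam0 gG)]. Qed.

Section NearOptimal.
Variables (tau : R) (u1 u2 v1 v2 : plane -> R) (g1 g2 h1 h2 : 'I_2 -> plane -> R).
Hypotheses (tau0 : 0 < tau) (tau1 : tau <= 1).
Hypotheses (wu1 : wder u1 g1) (wu2 : wder u2 g2) (wv1 : wder v1 h1) (wv2 : wder v2 h2).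
Hypothesis Q1 : Qreal 0 u1 g1 u2 g2 v1 h1 v2 h2 = 1.
Hypothesis N1 : 1 - tau ^+ 2 <= 4 * cc * Nq mu be u1 u2 v1 v2.

Let f := coef be u1 u2 v1 v2.
Let L1 := wder_L4 wu1. Let L2' := wder_L4 wu2. Let L3 := wder_L4 wv1. Let L4' := wder_L4 wv2.
Let hu1 := wder_h1l2 wu1.

Let en_u1 : en om u1 g1 u1 g1 <= 1.
Proof.
have := Q1; rewrite Qreal0.
have := en_ge0 om0 (wder_h1l2 wu2); have := en_ge0 tom0 (wder_h1l2 wv1); have := en_ge0 tom0 (wder_h1l2 wv2).
move: (en om u1 g1 u1 g1) (en om u2 g2 u2 g2) (en tom v1 h1 v1 h1) (en tom v2 h2 v2 h2) => a b c e; lra.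
Qed.

Let slope (rho : plane -> R) (a b B : R) : L4 mu rho -> 0 <= b -> b <= B -> a ^+ 2 <= B ->
  (forall t, 4 * cc * Nq mu be (fun x => u1 x + t * rho x) u2 v1 v2 <= (1 + 2 * t * a + t ^+ 2 * b) ^+ 2) ->
  (4 * cc * I (fun x => f x * rho x) - a) ^+ 2 <= 9 * tau ^+ 2 * B.
Proof.
move=> Lr b0 bB aB H; apply: (near_optimal_slope cc0 tau0 tau1 b0 bB aB) => t.
have aux (F n0 n1 q w : R) : 1 - w <= 4 * cc * n0 -> n0 + 4 * t * F <= n1 -> 4 * cc * n1 <= q ->
    0 <= q - (1 - w) - 16 * cc * t * F.
  move=> n0w n01 n1q; have := ler_wpM2l (ltW (mulr_gt0 (ltr0Sn R 3) cc0)) n01.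
  by rewrite mulrDr (_ : 4 * cc * (4 * t * F) = 16 * cc * t * F); [lra|ring].
exact: (aux _ _ _ _ _ N1 (Nq_convex t be0 L1 L2' L3 L4' Lr) (H t)).
Qed.

(** The right-hand side of the Euler-Lagrange equation once (om - lam) u1 has been moved there, so
    that the operator left is - Delta + lam, the one with Green function G. *)
Let k x := 4 * cc * f x - (om - lam) * u1 x.

Let fi (rho : plane -> R) : L4 mu rho -> intble mu (fun x => f x * rho x).
Proof. exact: coef_intble. Qed.

Let kE (rho : plane -> R) : L4 mu rho -> intble mu (fun x => k x * rho x) /\
  I (fun x => k x * rho x) = 4 * cc * I (fun x => f x * rho x) - (om - lam) * I (fun x => u1 x * rho x).
Proof.
move=> Lr; have fr := intbleZ (4 * cc) (fi Lr); have ur := intbleZ (om - lam) (sqint_intbleM (proj1 L1) (proj1 Lr)).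
have E : (fun x => 4 * cc * (f x * rho x) - (om - lam) * (u1 x * rho x)) = (fun x => k x * rho x).
  by apply/funext => x; rewrite /k; move: (f x) (u1 x) (rho x) => p q r; ring.
split; first by rewrite -E; exact: intbleB.
rewrite -E RintB// !RintZ//; first exact: sqint_intbleM (proj1 L1) (proj1 Lr).
exact: fi.
Qed.

Let testL4 phi : testf phi -> L4 mu phi.
Proof. by move=> tp; exact: wder_L4 (wder_test tp). Qed.

(** Variation with charge 0: the weak equation for u1 holds up to O(tau) in the dual of the energy
    norm. The factor om / lam compares the energy of the quotient, with mass om, to the one with
    mass lam. *)
Lemma near_optimal_test phi : testf phi ->
  (I (fun x => k x * phi x) - en lam u1 g1 phi (grad phi)) ^+ 2 <=
  9 * tau ^+ 2 * (om / lam) * en lam phi (grad phi) phi (grad phi).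
Proof.
move=> tp; have wp := wder_test tp; have hp := wder_h1l2 wp.
have [_ ->] := kE (testL4 tp).
rewrite (_ : _ - _ - _ = 4 * cc * I (fun x => f x * phi x) - en om u1 g1 phi (grad phi)); last first.
  have alg (p q r s : R) : r + q = s -> p - q - r = p - s by move=> <-; ring.
  exact: (alg _ _ _ _ (en_mass2 lam om u1 g1 phi (grad phi))).
have b0 := en_ge0 om0 hp.
rewrite -[leRHS]mulrA; apply: (slope (testL4 tp) b0).
- exact: en_om_le.
- apply: le_trans (en_CS om0 hu1 hp) _; apply: le_trans (en_om_le _ _).
  by rewrite ler_piMl.
move=> t; have := HJ 0 (wder_comb t wp wu1) wu2 wv1 wv2.
rewrite Qreal0 (en_comb t (ltW om0) hp hu1) enC.
have -> : Nq mu be (fun x => t * phi x + u1 x + 0 * G x) u2 v1 v2 = Nq mu be (fun x => u1 x + t * phi x) u2 v1 v2.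
  by apply: eq_Rintegral => x _; rewrite mul0r addr0 addrC.
have := Q1; rewrite Qreal0.
move: (en om u1 g1 u1 g1) (en om u2 g2 u2 g2) (en tom v1 h1 v1 h1) (en tom v2 h2 v2 h2).
move: (en om u1 g1 phi (grad phi)) (en om phi (grad phi) phi (grad phi)) => a b p q r s E.
have -> : t ^+ 2 * b + 2 * t * a + p + q + (r + s) = p + q + (r + s) + 2 * t * a + t ^+ 2 * b by ring.
by rewrite E.
Qed.

(** Variation of the charge alone: the regular part u1 stays fixed, so the only linear term of the
    form is (om - lam) times the integral of u1 G, and it is absorbed in k. No energy product with G
    appears. *)
Lemma near_optimal_green : I (fun x => k x * G x) ^+ 2 <= 9 * tau ^+ 2 * BG.
Proof.
have [_ ->] := kE LG; have su1 := proj1 L1; have ol : 0 <= om - lam by rewrite subr_ge0.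
have NG0 := N_ge0 mu G; have Nu0 := N_ge0 mu u1.
have uG := sqint_intbleM su1 sG.
apply: (slope LG (ltW BG0) (lexx _)).
  rewrite exprMn; apply: le_trans (ler_wpM2l (sqr_ge0 _) (Cauchy_Schwarz su1 sG)) _.
  have -> : (om - lam) ^+ 2 * (N u1 * N G) = ((om - lam) * N u1) * ((om - lam) * N G) by ring.
  apply: (@le_trans _ _ (1 * ((om - lam) * N G))).
    apply: ler_wpM2r; first exact: mulr_ge0.
    apply: le_trans en_u1; apply: le_trans (en_ge_mass om u1 g1).
    by rewrite ler_wpM2r// gerBl ltW.
  by rewrite mul1r /BG lerDl ltW.
move=> t; have := HJ t wu1 wu2 wv1 wv2; congr (_ <= _ ^+ 2).
have tG := sqintZ t sG.
rewrite /Qreal Rint_sqrD// /BG.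
have -> : N (fun x => t * G x) = t ^+ 2 * N G.
  by rewrite -RintZ; [apply: eq_Rintegral => x _; rewrite exprMn|exact: sG.2].
have -> : I (fun x => u1 x * (t * G x)) = t * I (fun x => u1 x * G x).
  by rewrite -RintZ//; apply: eq_Rintegral => x _; rewrite mulrCA.
have := Q1; rewrite Qreal0 -(en_mass lam om u1 g1) -(en_mass lam om u2 g2) => <-; ring.
Qed.

End NearOptimal.

Let shiftE (F : plane -> R) b : intble mu F -> I (fun x => F (x + b)) = I F.
Proof.
move=> Fi; rewrite [RHS](Rint_affine b ltr01 Fi) expr1n mul1r.
by apply: eq_Rintegral => x _; rewrite scale1r.
Qed.

Let shift_intble (F : plane -> R) b : intble mu F -> intble mu (fun x => F (x + b)).
Proof.
move=> Fi; have := intble_affine b ltr01 Fi; congr (intble _ _).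
by apply/funext => x; rewrite scale1r.
Qed.

Lemma en_shift (l : R) u g b : h1l2 u g ->
  en l (fun x => u (x + b)) (fun i x => g i (x + b)) (fun x => u (x + b)) (fun i x => g i (x + b)) = en l u g u g.
Proof.
move=> [su sg]; rewrite !en_self.
exact: (congr2 +%R (congr2 +%R (shiftE b (sg 0).2) (shiftE b (sg 1).2)) (congr1 ( *%R l) (shiftE b su.2))).
Qed.

(* Applying the near-criticality inequality in the direction of all translates of
   [G] bounds the convolution [W] of [k] with [G] by a multiple of [tau].  As
   [(- Delta + lam) W = k], regularity makes [W - u1] small in H^1; hence [u1] is
   small in L^4. *)
Lemma concentration : exists2 C, 0 <= C & forall tau u1 g1 u2 g2 v1 h1 v2 h2,
  0 < tau -> tau <= 1 -> wder u1 g1 -> wder u2 g2 -> wder v1 h1 -> wder v2 h2 ->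
  Qreal 0 u1 g1 u2 g2 v1 h1 v2 h2 = 1 -> 1 - tau ^+ 2 <= 4 * cc * Nq mu be u1 u2 v1 v2 ->
  I (fun x => u1 x ^+ 4) <= C * tau ^+ 2.
Proof.
pose D := 9 * (om / lam); have D0 : 0 <= D by rewrite mulr_ge0// divr_ge0// ltW.
(* The first term bounds 4 W0^2 N u1, with W0^2 = 9 tau^2 BG and N u1 <= 1 / om. The second is
   Gagliardo-Nirenberg for w = W - u1, whose energy is at most D tau^2, together with tau^4 <=
   tau^2. *)
exists (4 * (9 * BG) / om + 4 * (lam^-1 * D ^+ 2)).
  apply: addr_ge0; first by apply: divr_ge0; [do !apply: mulr_ge0 => //; exact: ltW|exact: ltW].
  by apply: mulr_ge0 => //; apply: mulr_ge0; [rewrite invr_ge0 ltW|exact: sqr_ge0].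
move=> tau u1 g1 u2 g2 v1 h1 v2 h2 tau0 tau1 wu1 wu2 wv1 wv2 Q1 N1.
have L1 := wder_L4 wu1; have L2 := wder_L4 wu2; have L3 := wder_L4 wv1; have L4' := wder_L4 wv2.
have [hu1 hu2 hv1 hv2] := And4 (wder_h1l2 wu1) (wder_h1l2 wu2) (wder_h1l2 wv1) (wder_h1l2 wv2).
pose f := coef be u1 u2 v1 v2; pose k x := 4 * cc * f x - (om - lam) * u1 x.
have su1 := proj1 L1; have [mu1 iu1] := su1; have [mG iG] := sG.
pose S x := u1 x ^+ 2 + u2 x ^+ 2 + be * (v1 x ^+ 2 + v2 x ^+ 2).
have sS : sqint mu S.
  by apply: sqintD; [apply: sqintD; [exact: L1.2|exact: L2.2]|apply: sqintZ; apply: sqintD; [exact: L3.2|exact: L4'.2]].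
have mk : measurable_fun setT (k : mplane -> R).
  apply: measurable_funB; last exact: measurable_funM.
  by apply: measurable_funM => //; apply: measurable_funM => //; case: sS.
have ol : 0 <= om - lam by rewrite subr_ge0.
have cc4 : 0 <= 4 * cc by rewrite mulr_ge0// ltW.
(* Young's inequality splits k (x + y) G x into a function of x + y and a function of x. Translation
   invariance then makes the bound on the convolution independent of y. *)
pose P x := 4 * cc * (S x ^+ 2 + (u1 x ^+ 2) ^+ 2) + (om - lam) * u1 x ^+ 2.
pose P' x := 4 * cc * (G x ^+ 2) ^+ 2 + (om - lam) * G x ^+ 2.
have iP : intble mu P.
  by apply: intbleD; apply: intbleZ => //; apply: intbleD; [exact: sS.2|exact: L1.2.2].
have iP' : intble mu P' by apply: intbleD; apply: intbleZ => //; exact: LG.2.2.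
have kG x y : `|k (x + y) * G x| <= P (x + y) + P' x.
  have E : k (x + y) = 4 * cc * (S (x + y) * u1 (x + y)) - (om - lam) * u1 (x + y) by [].
  rewrite E /P /P'; move: (S (x + y)) (u1 (x + y)) (G x) => s a b.
  have y1 (p q : R) : `|p * q| <= p ^+ 2 + q ^+ 2.
    by rewrite ler_norml; have := sqr_ge0 (p + q); have := sqr_ge0 (p - q); move=> ? ?; apply/andP; split; nra.
  rewrite mulrBl; apply: le_trans (ler_normB _ _) _.
  have -> : 4 * cc * (s * a) * b = 4 * cc * (s * (a * b)) by ring.
  rewrite -[(om - lam) * a * b]mulrA [`|4 * cc * _|]normrM [`|(om - lam) * _|]normrM (ger0_norm cc4) (ger0_norm ol).
  have h1' : 4 * cc * `|s * (a * b)| <= 4 * cc * (s ^+ 2 + ((a ^+ 2) ^+ 2 + (b ^+ 2) ^+ 2)).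
    apply: ler_wpM2l => //; apply: le_trans (y1 _ _) _; rewrite lerD2l exprMn.
    by have := y1 (a ^+ 2) (b ^+ 2); rewrite ger0_norm// mulr_ge0 ?sqr_ge0.
  have h2' := ler_wpM2l ol (y1 a b).
  apply: le_trans (lerD h1' h2') _.
  by rewrite le_eqVlt; apply/orP; left; apply/eqP; ring.
have msh (F : plane -> R) b : measurable_fun setT (F : mplane -> R) -> measurable_fun setT ((fun x => F (x + b)) : mplane -> R).
  move=> mF; have := @measurable_affine_comp _ 1 b F mF; under eq_fun do rewrite scale1r; exact.
have iPP y : intble mu (fun x => P (x + y) + P' x) by apply: intbleD => //; exact: shift_intble.
have kGi y : intble mu (fun x => k (x + y) * G x).
  apply: (@intble_le _ _ R mu _ (fun x => P (x + y) + P' x)) => //.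
  by apply: measurable_funM => //; exact: msh.
have kGC y : I (fun x => `|k (x + y) * G x|) <= I P + I P'.
  have := iPP y => iy; rewrite -(shiftE y iP) -RintD//; last exact: shift_intble.
  by apply: Rint_le => //; exact: intble_norm.
pose W y := I (fun x => k (x + y) * G x).
have mW : measurable_fun setT (W : mplane -> R) by exact: conv_measurable.
pose W0 := 3 * tau * Num.sqrt BG; have W00 : 0 <= W0 by rewrite !mulr_ge0 ?sqrtr_ge0// ltW.
have W02 : W0 ^+ 2 = 9 * tau ^+ 2 * BG by rewrite /W0 !exprMn sqr_sqrtr ?ltW//; ring.
have WB y : `|W y| <= W0.
  (* Instead of G, the pair is translated by y: the free quotient does not change, so the translated
     pair is near optimal with the same tau. *)
  have h : W y ^+ 2 <= 9 * tau ^+ 2 * BG.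
    apply: (near_optimal_green tau0 tau1 (wder_shift y wu1) (wder_shift y wu2) (wder_shift y wv1) (wder_shift y wv2)).
      by rewrite -Q1 !Qreal0 !en_shift.
    have E : Nq mu be (fun x => u1 (x + y)) (fun x => u2 (x + y)) (fun x => v1 (x + y)) (fun x => v2 (x + y)) = Nq mu be u1 u2 v1 v2.
      exact: (shiftE y (quartic_intble be L1 L2 L3 L4')).
    by rewrite E.
  by rewrite -(@ler_pXn2r _ 2)// ?nnegrE// real_normK ?num_real// W02.
have ktest phi : testf phi -> intble mu (fun x => k x * phi x).
  move=> tp; have L5 := wder_L4 (wder_test tp).
  have := intbleB (intbleZ (4 * cc) (coef_intble be L1 L2 L3 L4' L5)) (intbleZ (om - lam) (testf_sq_intble su1 tp)).
  congr (intble _ _); apply/funext => x; rewrite /k /f.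
  have alg (p q r : R) : 4 * cc * (p * r) - (om - lam) * (q * r) = (4 * cc * p - (om - lam) * q) * r by ring.
  exact: alg.
have Gtest phi : testf phi -> intble mu (fun x => G x * phi x) by exact: testf_sq_intble.
have Wtest phi : testf phi -> intble mu (fun x => W x * phi x).
  move=> tp; have [mp ip] := testf_sqint tp.
  apply: (@intble_le _ _ R mu _ (fun x => W0 * `|phi x|)); first exact: measurable_funM.
    by apply: intbleZ; apply: intble_norm; exact: testf_intble.
  by move=> x; rewrite normrM ler_wpM2r.
pose K x := W x - u1 x.
have KE phi : testf phi -> intble mu (fun x => K x * phi x) /\
    I (fun x => K x * phi x) = I (fun x => W x * phi x) - I (fun x => u1 x * phi x).
  move=> tp; have Wi := Wtest _ tp; have ui := testf_sq_intble su1 tp.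
  have E : (fun x => K x * phi x) = (fun x => W x * phi x - u1 x * phi x) by apply/funext => x; rewrite mulrBl.
  by rewrite E RintB//; split => //; exact: intbleB.
(* Fubini moves the operator onto G, which evaluates the reflected test function at 0 and returns k
   against phi. So W solves (- Delta + lam) W = k, and K solves the equation whose right-hand side
   is the defect bounded by [near_optimal_test]. *)
have Kdist phi : testf phi -> I (fun x => K x * (lam * phi x - lap phi x)) =
    I (fun x => k x * phi x) - en lam u1 g1 phi (grad phi).
  move=> tp; have tk : testf (fun x => lam * phi x - lap phi x).
    by apply: testfB; [exact: testfZ|exact: testf_lap].
  rewrite (KE _ tk).2 (wder_helmholtz lam wu1 tp); congr (_ - _).
  apply: etrans (conv_fubini mk mG ktest Gtest kGi kGC tk) _.
  apply: eq_Rintegral => z _; congr (_ * _).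
  have tr := testf_reflect z tp; have := gG.2 _ tr; rewrite subr0 => <-.
  apply: eq_Rintegral => x _.
  exact: (congr1 (fun r => G x * (lam * phi (z - x) - r)) (esym (lap_reflect z x tp))).
have [|||||||w [h [xn [ww Kw ew _ _]]]] := @weak_regularity R lam lam0 K
    (fun phi => I (fun x => K x * (lam * phi x - lap phi x))) (D * tau ^+ 2).
- exact: measurable_funB.
- by move=> psi tp; have [] := KE _ tp.
- move=> psi tp; have [B HB] := sq_conv_bounded su1 tp.
  exists (W0 * I (fun x => `|psi x|) + B) => y; have ty := testf_shift y tp.
  rewrite (KE _ ty).2; apply: le_trans (ler_normB _ _) _; apply: lerD => //.
  have ni := intble_norm (testf_intble ty).
  rewrite -(shiftE y (intble_norm (testf_intble tp))) -RintZ//.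
  apply: Rint_norm_le; [exact: Wtest|exact: intbleZ|].
  by move=> x; rewrite normrM ler_wpM2r.
- by apply: helmholtz_functional_linear => psi tp; have [] := KE _ tp.
- move=> phi tp; rewrite Kdist// (_ : D * tau ^+ 2 = 9 * tau ^+ 2 * (om / lam)); last by rewrite /D; ring.
  exact: (near_optimal_test tau0 tau1 wu1 wu2 wv1 wv2 Q1 N1 tp).
- by rewrite mulr_ge0// sqr_ge0.
- by [].
have [w4 Iw4] := gagliardo_nirenberg lam0 ww.
have f4 (F : plane -> R) : (fun x => F x ^+ 4) = (fun x => (F x ^+ 2) ^+ 2).
  by apply/funext => x; rewrite -exprM.
have iw4 : intble mu (fun x => w x ^+ 4) by rewrite f4; exact: w4.2.
have iu4 : intble mu (fun x => u1 x ^+ 4) by rewrite f4; exact: L1.2.2.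
(* From W = u1 + w and |W| <= W0, by a^4 <= 4 a^2 (a + b)^2 + 4 b^4. Smallness of W in the sup norm
   suffices because u1 is bounded in L^2. *)
have h1' : I (fun x => u1 x ^+ 4) <= I (fun x => 4 * W0 ^+ 2 * u1 x ^+ 2 + 4 * w x ^+ 4).
  apply: Rint_le_ae => //; first by apply: intbleD; exact: intbleZ.
  apply: (ae_imp Kw) => x Kx.
  have : W x ^+ 2 <= W0 ^+ 2.
    by rewrite -real_normK ?num_real// lerXn2r ?nnegrE.
  have -> : W x = u1 x + w x by rewrite -Kx /K addrC subrK.
  move: (u1 x) (w x) (W0 ^+ 2) => a b c hc.
  have h3 := ler_wpM2l (sqr_ge0 a) hc.
  have -> : 4 * c * a ^+ 2 = 4 * (a ^+ 2 * c) by ring.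
  apply: (@le_trans _ _ (4 * (a ^+ 2 * (a + b) ^+ 2) + 4 * b ^+ 4)); last by rewrite lerD2r ler_wpM2l.
  rewrite -subr_ge0 (_ : _ - _ = 2 * (a ^+ 2 * (a + 2 * b) ^+ 2) + (a ^+ 2 - 2 * b ^+ 2) ^+ 2); last by ring.
  by apply: addr_ge0; [apply: mulr_ge0 => //; apply: mulr_ge0; exact: sqr_ge0|exact: sqr_ge0].
apply: le_trans h1' _; rewrite RintD; [|exact: intbleZ..].
rewrite RintZ// RintZ//.
have Nu : N u1 <= om^-1.
  rewrite -[om^-1]mulr1 ler_pdivlMl//; apply: le_trans (en_ge_mass om u1 g1) _.
  have := Q1; rewrite Qreal0.
  have := en_ge0 om0 hu2; have := en_ge0 tom0 hv1; have := en_ge0 tom0 hv2.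
  move: (en om u1 g1 u1 g1) (en om u2 g2 u2 g2) (en tom v1 h1 v1 h1) (en tom v2 h2 v2 h2) => a b c e; lra.
rewrite [leRHS]mulrDl; apply: lerD.
  have -> : 4 * (9 * BG) / om * tau ^+ 2 = 4 * W0 ^+ 2 * om^-1 by rewrite W02; ring.
  by apply: ler_wpM2l => //; rewrite mulr_ge0// sqr_ge0.
rewrite -mulrA; apply: ler_wpM2l => //; apply: le_trans Iw4 _.
rewrite -mulrA; apply: ler_wpM2l; first by rewrite invr_ge0 ltW.
have e0 := en_ge0 lam0 (wder_h1l2 ww).
have t1 : tau ^+ 2 <= 1 by rewrite expr_le1// ltW.
apply: (@le_trans _ _ ((D * tau ^+ 2) ^+ 2)).
  by rewrite lerXn2r ?nnegrE// mulr_ge0// sqr_ge0.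
by rewrite exprMn ler_wpM2l ?sqr_ge0// expr2 ler_piMl// sqr_ge0.
Qed.

End Concentration.

(** * Complex-valued functions *)

Lemma ae_imp2 d (T : measurableType d) (R : realType) (mu : {measure set T -> \bar R}) (P Q S : T -> Prop) :
  {ae mu, forall x, P x} -> {ae mu, forall x, Q x} -> (forall x, P x -> Q x -> S x) -> {ae mu, forall x, S x}.
Proof. by move=> aeP aeQ PQS; apply: filterS2 aeP aeQ. Qed.

Section ComplexLayer.
Variable R : realType.
Local Notation plane := (R * R)%type.
Local Notation mplane := (measurableTypeR R * measurableTypeR R)%type.
Local Notation cfun := (R * R -> R[i]).
Local Notation mu := (leb2 R).
Local Notation I f := (\int[leb2 R]_x f x).
Local Notation N f := (\int[leb2 R]_x (f x ^+ 2)).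
Implicit Types (u v G : cfun) (g h : 'I_2 -> plane -> R).

Definition re u (x : plane) : R := complex.Re (u x).
Definition im u (x : plane) : R := complex.Im (u x).

Lemma Lfun2P (f : plane -> R) : (f : mplane -> R) \in Lfun mu 2%:E <-> sqint mu f.
Proof.
split.
  move=> fL; split; last exact: Lfun2_integrable_sqr.
  by have /sub_Lfun_mfun := fL; rewrite inE.
move=> [mf fi]; rewrite inE; apply/andP; split; first by rewrite inE.
rewrite inE /finite_norm /=.
have n2 : (2 : R) != 0 by rewrite pnatr_eq0.
have := @poweR_Lnorm _ _ R mu (EFin \o f) 2 n2.
rewrite (_ : (\int[mu]_x _)%E = (\int[mu]_x (f x ^+ 2)%:E)%E); last first.
  by apply: eq_integral => x _; rewrite /= powR_mulrn ?normr_ge0// real_normK ?num_real.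
rewrite -EFin_Rint//; case: (Lnorm _ _ _) (Lnorm_ge0 mu 2%:E (EFin \o f)) => [r _ _||//].
  exact: ltry.
by move=> _ /=; rewrite pnatr_eq0.
Qed.

Lemma cmodE (z : R[i]) : cmod z ^+ 2 = complex.Re z ^+ 2 + complex.Im z ^+ 2.
Proof. by case: z => a b; rewrite /cmod /= sqr_sqrtr// addr_ge0 ?sqr_ge0. Qed.

Lemma cmod_ge0 (z : R[i]) : 0 <= cmod z.
Proof. by case: z => a b; rewrite /cmod /= sqrtr_ge0. Qed.

Lemma Lpnorm_pow (n : nat) u : (0 < n)%N -> intble mu (fun x => cmod (u x) ^+ n) ->
  Lpnorm n%:R u ^+ n = I (fun x => cmod (u x) ^+ n).
Proof.
move=> n0 ui; have nN0 : n%:R != 0 :> R by rewrite pnatr_eq0 -lt0n.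
have := @poweR_Lnorm _ _ R mu (fun x => (cmod (u x))%:E) n%:R nN0.
rewrite (_ : (\int[mu]_x _)%E = (\int[mu]_x (cmod (u x) ^+ n)%:E)%E); last first.
  by apply: eq_integral => x _; rewrite /= ger0_norm ?cmod_ge0// powR_mulrn// cmod_ge0.
rewrite -EFin_Rint// /Lpnorm; case: (Lnorm _ _ _) (Lnorm_ge0 mu n%:R%:E (fun x => (cmod (u x))%:E)) => [r r0||//].
  by rewrite poweR_EFin powR_mulrn// => -[].
by move=> _ /=; rewrite (negPf nN0).
Qed.

Lemma L2P u : L2 u <-> sqint mu (re u) /\ sqint mu (im u).
Proof. by rewrite /L2 /=; split => -[/Lfun2P h1 /Lfun2P h2]. Qed.

Lemma Lpnorm2 u : sqint mu (re u) -> sqint mu (im u) -> Lpnorm 2 u ^+ 2 = N (re u) + N (im u).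
Proof.
move=> [_ s1] [_ s2].
have E : (fun x => cmod (u x) ^+ 2) = (fun x => re u x ^+ 2 + im u x ^+ 2).
  by apply/funext => x; rewrite cmodE.
by rewrite Lpnorm_pow// E; [exact: RintD|exact: intbleD].
Qed.

Lemma Lpnorm4 u : L4 mu (re u) -> L4 mu (im u) ->
  Lpnorm 4 u ^+ 4 = I (fun x => (re u x ^+ 2 + im u x ^+ 2) ^+ 2).
Proof.
move=> [_ s1] [_ s2].
have E : (fun x => cmod (u x) ^+ 4) = (fun x => (re u x ^+ 2 + im u x ^+ 2) ^+ 2).
  by apply/funext => x; rewrite -cmodE -exprM.
by rewrite Lpnorm_pow// E//; exact: (sqintD s1 s2).2.
Qed.

Lemma couplingE u v : coupling u v = I (fun x => (re u x ^+ 2 + im u x ^+ 2) * (re v x ^+ 2 + im v x ^+ 2)).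
Proof.
apply: eq_Rintegral => x _; rewrite cmodE /re /im.
by case: (u x) => a b; case: (v x) => c e /=; ring.
Qed.

Lemma aezeroP u : aezero u <-> {ae mu, forall x, re u x = 0} /\ {ae mu, forall x, im u x = 0}.
Proof.
split=> [u0|[h1 h2]].
  by split; apply: (ae_imp u0) => x /(_ Logic.I) E; rewrite /re /im E.
apply: (ae_imp2 h1 h2) => x; rewrite /re /im => + + _.
by case: (u x) => a b /= -> ->.
Qed.

Let ReM (z : R[i]) (r : R) : complex.Re (z * (r%:C)%C) = complex.Re z * r.
Proof. by case: z => a b /=; rewrite mulr0 subr0. Qed.
Let ImM (z : R[i]) (r : R) : complex.Im (z * (r%:C)%C) = complex.Im z * r.
Proof. by case: z => a b /=; rewrite mulr0 add0r. Qed.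

Lemma cintM u (p : plane -> R) : cint (fun x => u x * ((p x)%:C)%C) =
  (I (fun x => re u x * p x) +i* I (fun x => im u x * p x))%C.
Proof. by rewrite /cint; congr (_ +i* _)%C; apply: eq_Rintegral => x _; rewrite ?ReM ?ImM. Qed.

Lemma is_weak_partialP i u v : is_weak_partial i u v <-> wpart i (re u) (re v) /\ wpart i (im u) (im v).
Proof.
split=> [w|[w1 w2] phi /test_functionP tp].
  by split=> phi tp; have := w phi (proj2 (test_functionP phi) tp); rewrite !cintM => -[].
by rewrite !cintM w1// w2.
Qed.

Lemma H1P u : H1 u <-> exists g h, wder (re u) g /\ wder (im u) h.
Proof.
split.
  move=> [/L2P[s1 s2] w].
  have /choice[g gP] : forall i : 'I_2, exists v, L2 v /\ is_weak_partial i u v.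
    by move=> i; have [v] := w i; exists v.
  exists (fun i => re (g i)), (fun i => im (g i)).
  by split; split => // i; have [/L2P[? ?] /is_weak_partialP[]] := gP i.
move=> [g [h [[s1 w1] [s2 w2]]]]; split; first exact/L2P.
move=> i; exists (fun x => (g i x +i* h i x)%C).
  by apply/L2P; split; [exact: (w1 i).1|exact: (w2 i).1].
by apply/is_weak_partialP; split; [exact: (w1 i).2|exact: (w2 i).2].
Qed.

Lemma dirichletE u g h : wder (re u) g -> wder (im u) h ->
  dirichlet u = (N (g 0) + N (h 0)) + (N (g 1) + N (h 1)).
Proof.
move=> wu1 wu2; have [s1 w1] := wu1; have [s2 w2] := wu2.
have E i : Lpnorm 2 (weak_partial i u) ^+ 2 = N (g i) + N (h i).
  have ex : exists v, L2 v /\ is_weak_partial i u v.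
    exists (fun x => (g i x +i* h i x)%C); split.
      by apply/L2P; split; [exact: (w1 i).1|exact: (w2 i).1].
    by apply/is_weak_partialP; split; [exact: (w1 i).2|exact: (w2 i).2].
  have [v0 v0P] := ex.
  have := @xgetPex _ (fun=> 0) [set v : cfun | L2 v /\ is_weak_partial i u v] ex.
  rewrite -/(weak_partial i u); set v := weak_partial i u => -[/L2P[t1 t2] /is_weak_partialP[p1 p2]].
  have e1 : {ae mu, forall x, re v x = g i x}.
    by apply: ae_eq_of_test => //; [exact: (w1 i).1|move=> phi tp; apply: oppr_inj; rewrite -p1// (w1 i).2].
  have e2 : {ae mu, forall x, im v x = h i x}.
    by apply: ae_eq_of_test => //; [exact: (w2 i).1|move=> phi tp; apply: oppr_inj; rewrite -p2// (w2 i).2].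
  have sq (p q : plane -> R) : sqint mu p -> sqint mu q -> {ae mu, forall x, p x = q x} -> N p = N q.
    move=> [mp _] [mq _] pq; apply: ae_Rint_eq; [exact: measurable_funX..|].
    by apply: (ae_imp pq) => x ->.
  by rewrite Lpnorm2// (sq _ _ t1 (w1 i).1 e1) (sq _ _ t2 (w2 i).1 e2).
rewrite /dirichlet big_ord_recl big_ord1.
have -> : lift ord0 ord0 = 1 :> 'I_2 by exact: val_inj.
exact: (congr2 +%R (E 0) (E 1)).
Qed.

Lemma free_formE (om : R) u g h : wder (re u) g -> wder (im u) h ->
  free_form om u = en om (re u) g (re u) g + en om (im u) h (im u) h.
Proof.
move=> w1 w2; rewrite /free_form (dirichletE w1 w2) Lpnorm2; [|by case: w1|by case: w2].
by rewrite !en_self; ring.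
Qed.

(** [green] is a choice among complex-valued functions. Existence makes the choice genuine, and the
    imaginary part, solving the homogeneous equation, vanishes by uniqueness. *)
Lemma greenP (lam : R) : 0 < lam -> is_greenR lam (re (green lam)) /\
  sqint mu (im (green lam)) /\ {ae mu, forall x, im (green lam) x = 0}.
Proof.
move=> lam0; have minus (phi : plane -> R) x : - laplacian phi x + lam * phi x = lam * phi x - lap phi x.
  by rewrite laplacianE addrC.
have isP v : is_green lam v <-> [/\ L2 v, forall f, testf f -> I (fun x => re v x * (lam * f x - lap f x)) = f 0
    & forall f, testf f -> I (fun x => im v x * (lam * f x - lap f x)) = 0].
  split=> [[L h]|[L h1 h2]].
    split=> // f tf; have := h f (proj2 (test_functionP f) tf); rewrite cintM;
      by under eq_Rintegral do rewrite minus; under [X in (_ +i* X)%C]eq_Rintegral do rewrite minus; case.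
  split=> // f /test_functionP tf; rewrite cintM.
  under eq_Rintegral do rewrite minus; under [X in (_ +i* X)%C]eq_Rintegral do rewrite minus.
  by rewrite h1// h2.
have ex : exists v, is_green lam v.
  have [G sG gG] := green_exists lam0.
  exists (fun x => (G x +i* 0)%C); apply/isP; split => //.
    by apply/L2P; split => //; exact: sqint0.
  by move=> f tf; rewrite /im /=; under eq_Rintegral do rewrite mul0r; exact: Rint_cst0.
have := @xgetPex _ (fun=> 0) [set v : cfun | is_green lam v] ex.
rewrite -/(green lam) => /isP[/L2P[s1 s2] h1 h2]; split => //; split => //.
apply: (helmholtz_unique_sq lam0 s2 (sqint0 mu)) => f tf.
by rewrite h2//; apply/esym; under eq_Rintegral do rewrite mul0r; exact: Rint_cst0.
Qed.

(** 2 pi (alpha + theta lam) is half of ln lam - ln (omega_min alpha). *)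
Lemma omega_theta (alpha lam : R) : omega_min alpha < lam -> 0 < lam /\ 0 < alpha + theta lam.
Proof.
move=> h; have p0 := @pi_gt0 R; have m0 : 0 < omega_min alpha by rewrite /omega_min mulr_gt0// expR_gt0.
have lam0 := lt_trans m0 h; split=> //.
have : ln (omega_min alpha) < ln lam by rewrite ltr_ln.
rewrite /omega_min lnM ?posrE ?expR_gt0// expRK.
have -> : ln (4 : R) = 2 * ln 2.
  by rewrite (_ : 4 = 2 ^+ 2); [rewrite lnXn// mulr_natl|ring].
have s0 : 0 < Num.sqrt lam by rewrite sqrtr_gt0.
have L : ln lam = 2 * ln (Num.sqrt lam).
  by rewrite -{1}(sqr_sqrtr (ltW lam0)) lnXn// mulr_natl.
rewrite L /theta ln_div ?posrE// => hl.
have aux (p a b c : R) : 0 < p -> 2 * a + (- (4 * p * alpha) - 2 * c) < 2 * b ->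
    0 < alpha + (b - a + c) / (2 * p).
  move=> p1 {}hl; have -> : alpha + (b - a + c) / (2 * p) = (2 * p * alpha + b - a + c) / (2 * p).
    by field; rewrite gt_eqF.
  by apply: divr_gt0; [lra|rewrite mulr_gt0].
exact: aux p0 hl.
Qed.

End ComplexLayer.

(** * The Nehari level and the point interaction form *)

Section NehariLevel.
Variables (R : realType) (T : Type) (D nz : T -> Prop) (Q N : T -> R) (sc : R -> T -> T).
Hypothesis Qpos : forall p, D p -> nz p -> 0 < Q p.
Hypothesis Npos : forall p, D p -> nz p -> 0 < N p.
Hypothesis scP : forall t p, 0 < t -> D p -> nz p ->
  [/\ D (sc t p), nz (sc t p), Q (sc t p) = t ^+ 2 * Q p & N (sc t p) = t ^+ 4 * N p].
Hypothesis ne : exists p, D p /\ nz p.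

Let Z := [set 2^-1 * Q p - 4^-1 * N p | p in [set p | D p /\ nz p /\ Q p = N p]].

Let proj p : D p -> nz p -> Z (Q p ^+ 2 / (4 * N p)).
Proof.
move=> Dp np; have Q0 := Qpos Dp np; have N0 := Npos Dp np.
pose t := Num.sqrt (Q p / N p); have t0 : 0 < t by rewrite sqrtr_gt0 divr_gt0.
have t2 : t ^+ 2 = Q p / N p by rewrite sqr_sqrtr// divr_ge0// ltW.
have [D' n' Q' N'] := scP t0 Dp np.
have t4 : t ^+ 4 = (Q p / N p) ^+ 2 by rewrite -t2 -exprM.
exists (sc t p); last by rewrite Q' N' t4 t2; field; rewrite gt_eqF.
by split => //; split => //; rewrite Q' N' t4 t2; field; rewrite gt_eqF.
Qed.

Let lb0 : lbound Z 0.
Proof.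
move=> _ [p [Dp [np QN]] <-]; rewrite QN.
have := Npos Dp np; move: (N p) => a; lra.
Qed.

Let hZ : has_inf Z.
Proof. by have [p [Dp np]] := ne; split; [eexists; exact: proj Dp np|exists 0]. Qed.

(* Scaling onto the Nehari set turns the level into the infimum of the quotient
   [Q ^ 2 / (4 N)]. *)
Lemma nehari_level_le p : D p -> nz p -> 4 * inf Z * N p <= Q p ^+ 2.
Proof.
move=> Dp np; have N0 := Npos Dp np.
have : inf Z <= Q p ^+ 2 / (4 * N p) by apply: ge_inf; [case: hZ|exact: proj].
by rewrite ler_pdivlMr ?mulr_gt0// mulrCA mulrA.
Qed.

Lemma nehari_level_ge b : (forall p, D p -> nz p -> 4 * b * N p <= Q p ^+ 2) -> b <= inf Z.
Proof.
move=> h; apply: lb_le_inf; first by case: hZ.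
move=> _ [p [Dp [np QN]] <-]; have := h p Dp np; have N0 := Npos Dp np.
rewrite QN expr2 ler_pM2r// => h1; move: h1; move: (N p) => a h1; lra.
Qed.

End NehariLevel.

Section PointInteraction.
Variable R : realType.
Local Notation plane := (R * R)%type.
Local Notation mplane := (measurableTypeR R * measurableTypeR R)%type.
Local Notation cfun := (R * R -> R[i]).
Local Notation mu := (leb2 R).
Local Notation I f := (\int[leb2 R]_x f x).
Local Notation N f := (\int[leb2 R]_x (f x ^+ 2)).
Implicit Types (u v : cfun) (g h : 'I_2 -> plane -> R) (f G H : plane -> R).

Lemma wder_change (l m q : R) f G H g : 0 < l -> is_greenR l G -> is_greenR m H ->
  wder (fun x => f x - q * G x) g -> exists h, wder (fun x => f x - q * H x) h.
Proof.
move=> l0 gG gH wf; have [h wh] := green_diff l0 gG gH.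
exists (comb q h g); have := wder_comb q wh wf; congr wder.
by apply/funext => x; ring.
Qed.

(** The two regular parts differ by (q - q') G, and G is not in H^1. *)
Lemma charge_unique (l q q' : R) f G g h : 0 < l -> is_greenR l G ->
  wder (fun x => f x - q * G x) g -> wder (fun x => f x - q' * G x) h -> q = q'.
Proof.
move=> l0 gG w1 w2; apply/eqP; rewrite -subr_eq0; apply/negP => /negP qq.
have w3 := wder_comb (-1) w1 w2; have w4 := wder_comb ((q - q')^-1) w3 w3.
have w0 := wder_comb (-1) w3 w3.
have w5 := wder_comb ((q - q')^-1) w3 w0.
apply: (@green_notin_H1 R l G _ l0 gG); move: w5; congr wder.
apply/funext => x; field; exact: qq.
Qed.

Lemma re_regular_part (l : R) (q : R[i]) u x : re (regular_part l q u) x =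
  re u x - (complex.Re q * re (green l) x - complex.Im q * im (green l) x).
Proof. by rewrite /re /im /regular_part; case: (u x) => a b; case: q => c e; case: (green l x) => r s. Qed.

Lemma im_regular_part (l : R) (q : R[i]) u x : im (regular_part l q u) x =
  im u x - (complex.Re q * im (green l) x + complex.Im q * re (green l) x).
Proof. by rewrite /re /im /regular_part; case: (u x) => a b; case: q => c e; case: (green l x) => r s. Qed.

Lemma regular_part_ae (l : R) (q : R[i]) u : 0 < l ->
  {ae mu, forall x, re (regular_part l q u) x = re u x - complex.Re q * re (green l) x} /\
  {ae mu, forall x, im (regular_part l q u) x = im u x - complex.Im q * re (green l) x}.
Proof.
move=> l0; have [_ [_ g0]] := greenP l0.
by split; apply: (ae_imp g0) => x E; rewrite ?re_regular_part ?im_regular_part E mulr0 ?subr0 ?add0r.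
Qed.

Lemma regular_part_meas (l : R) (q : R[i]) u : 0 < l -> L2 u ->
  [/\ measurable_fun setT (re (regular_part l q u) : mplane -> R),
      measurable_fun setT (im (regular_part l q u) : mplane -> R),
      measurable_fun setT ((fun x => re u x - complex.Re q * re (green l) x) : mplane -> R) &
      measurable_fun setT ((fun x => im u x - complex.Im q * re (green l) x) : mplane -> R)].
Proof.
move=> l0 /L2P[[m1 _] [m2 _]]; have [[[mg _] _] [[mh _] _]] := greenP l0.
split.
- rewrite (_ : re _ = fun x => re u x - (complex.Re q * re (green l) x - complex.Im q * im (green l) x)); last first.
    by apply/funext => x; rewrite re_regular_part.
  by apply: measurable_funB => //; apply: measurable_funB; exact: measurable_funM.
- rewrite (_ : im _ = fun x => im u x - (complex.Re q * im (green l) x + complex.Im q * re (green l) x)); last first.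
    by apply/funext => x; rewrite im_regular_part.
  by apply: measurable_funB => //; apply: measurable_funD; exact: measurable_funM.
- by apply: measurable_funB => //; exact: measurable_funM.
- by apply: measurable_funB => //; exact: measurable_funM.
Qed.

Lemma H1_regular_partP (l : R) (q : R[i]) u : 0 < l -> L2 u -> H1 (regular_part l q u) <->
  exists g h, wder (fun x => re u x - complex.Re q * re (green l) x) g /\
    wder (fun x => im u x - complex.Im q * re (green l) x) h.
Proof.
move=> l0 Lu; have [a1 a2] := regular_part_ae q u l0; have [m1 m2 m3 m4] := regular_part_meas q l0 Lu.
split=> [/H1P|] [g [h [w1 w2]]].
  by exists g, h; split; [exact: wder_ae w1 m3 a1|exact: wder_ae w2 m4 a2].
apply/H1P; exists g, h; split; [exact: wder_ae w1 m1 (ae_sym a1)|exact: wder_ae w2 m2 (ae_sym a2)].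
Qed.

(** Green functions for different parameters differ by an element of H^1, so the charge is attached
    to u alone. *)
Lemma regular_part_change (l m : R) (q : R[i]) u : 0 < l -> 0 < m -> L2 u ->
  H1 (regular_part l q u) -> H1 (regular_part m q u).
Proof.
move=> l0 m0 Lu /(H1_regular_partP q l0 Lu)[g [h [w1 w2]]]; apply/(H1_regular_partP q m0 Lu).
have [[gl _] [gm _]] := (greenP l0, greenP m0).
have [g' w1'] := wder_change l0 gl gm w1; have [h' w2'] := wder_change l0 gl gm w2.
by exists g', h'.
Qed.

Variable lam : R.
Hypothesis lam0 : 0 < lam.
Let Gr := re (green lam).
Let gGr : is_greenR lam Gr. Proof. by have [] := greenP lam0. Qed.

Lemma H1alphaP u : H1alpha u <-> L2 u /\ exists q, H1 (regular_part lam q u).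
Proof.
split=> [[Lu [q [l [l0 hl]]]]|[Lu [q hq]]]; last by split => //; exists q, lam.
by split => //; exists q; exact: (regular_part_change l0 lam0 Lu hl).
Qed.

Lemma point_chargeE q u : L2 u -> H1 (regular_part lam q u) -> point_charge u = q.
Proof.
move=> Lu hq; have ex : exists p, exists2 l : R, 0 < l & H1 (regular_part l p u) by exists q, lam.
have := @xgetPex _ 0 [set p | exists2 l : R, 0 < l & H1 (regular_part l p u)] ex.
rewrite -/(point_charge u) => -[l l0 /(regular_part_change l0 lam0 Lu)].
move=> /(H1_regular_partP _ lam0 Lu)[g [h [w1 w2]]].
move: hq => /(H1_regular_partP _ lam0 Lu)[g' [h' [w1' w2']]].
have := charge_unique lam0 gGr w1 w1'; have := charge_unique lam0 gGr w2 w2'.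
by case: (point_charge u) => a b; case: q {w1' w2'} => c e /= -> ->.
Qed.

Lemma point_formE (alpha om q1 q2 : R) u g h : L2 u ->
  wder (fun x => re u x - q1 * Gr x) g -> wder (fun x => im u x - q2 * Gr x) h ->
  point_form alpha lam om u =
  en lam (fun x => re u x - q1 * Gr x) g (fun x => re u x - q1 * Gr x) g +
  en lam (fun x => im u x - q2 * Gr x) h (fun x => im u x - q2 * Gr x) h +
  (om - lam) * (N (re u) + N (im u)) + (alpha + theta lam) * (q1 ^+ 2 + q2 ^+ 2).
Proof.
move=> Lu w1 w2; pose q := (q1 +i* q2)%C.
have hq : H1 (regular_part lam q u) by apply/(H1_regular_partP q lam0 Lu); exists g, h.
have [a1 a2] := regular_part_ae q u lam0; have [m1 m2 m3 m4] := regular_part_meas q lam0 Lu.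
have W1 := wder_ae w1 m1 (ae_sym a1); have W2 := wder_ae w2 m2 (ae_sym a2).
rewrite /point_form (point_chargeE Lu hq) (dirichletE W1 W2) cmodE /=.
have /L2P[s1 s2] := Lu.
rewrite (Lpnorm2 s1 s2) (Lpnorm2 (proj1 W1) (proj1 W2)).
have E1 : N (re (regular_part lam q u)) = N (fun x => re u x - q1 * Gr x).
  apply: ae_Rint_eq; [exact: measurable_funX..|].
  by apply: (ae_imp a1) => x ->.
have E2 : N (im (regular_part lam q u)) = N (fun x => im u x - q2 * Gr x).
  apply: ae_Rint_eq; [exact: measurable_funX..|].
  by apply: (ae_imp a2) => x ->.
rewrite !en_self E1 E2; ring.
Qed.

Lemma H1alpha_decomp u : H1alpha u -> L2 u /\ exists q1 q2 g h,
  wder (fun x => re u x - q1 * Gr x) g /\ wder (fun x => im u x - q2 * Gr x) h.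
Proof.
move=> /H1alphaP[Lu [q /(H1_regular_partP _ lam0 Lu)[g [h [w1 w2]]]]]; split => //.
by exists (complex.Re q), (complex.Im q), g, h.
Qed.

Lemma H1alpha_comp u q1 q2 g h : L2 u -> wder (fun x => re u x - q1 * Gr x) g ->
  wder (fun x => im u x - q2 * Gr x) h -> H1alpha u.
Proof.
move=> Lu w1 w2; apply/H1alphaP; split => //; exists (q1 +i* q2)%C.
by apply/(H1_regular_partP _ lam0 Lu); exists g, h.
Qed.

Lemma green_part_L4 f q g : wder (fun x => f x - q * Gr x) g -> L4 mu f.
Proof.
move=> w; have LG : L4 mu Gr by split; [by case: gGr|exact: (green_L4 lam0 gGr)].
by have := L4D (wder_L4 w) (L4Z q LG); congr (L4 _ _); apply/funext => x; rewrite subrK.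
Qed.

Lemma H1_sub_H1alpha u : H1 u -> H1alpha u.
Proof.
move=> hu; split; first by case: hu.
exists 0, lam; split=> //; rewrite (_ : regular_part lam 0 u = u)//.
by apply/funext => x; rewrite /regular_part mul0r subr0.
Qed.

Lemma point_form_H1 (alpha om : R) u : H1 u -> point_form alpha lam om u = free_form om u.
Proof.
move=> hu; have /H1P[g [h [w1 w2]]] := hu.
have E f : (fun x => f x - 0 * Gr x) = f by apply/funext => x; rewrite mul0r subr0.
have w1' : wder (fun x => re u x - 0 * Gr x) g by rewrite E.
have w2' : wder (fun x => im u x - 0 * Gr x) h by rewrite E.
rewrite (point_formE alpha om (proj1 hu) w1' w2') !E (free_formE om w1 w2).
by rewrite -(en_mass lam om (re u) g) -(en_mass lam om (im u) h) expr0n addr0 mulr0; ring.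
Qed.

End PointInteraction.

(** * Admissible forms and their levels *)

Section Admissible.
Variable R : realType.
Local Notation plane := (R * R)%type.
Local Notation mplane := (measurableTypeR R * measurableTypeR R)%type.
Local Notation cfun := (R * R -> R[i]).
Local Notation mu := (leb2 R).
Local Notation I f := (\int[leb2 R]_x f x).
Local Notation N f := (\int[leb2 R]_x (f x ^+ 2)).
Implicit Types (u v : cfun) (g h : 'I_2 -> plane -> R) (f : plane -> R) (X : set cfun) (Q : cfun -> R).

Definition n4 u : R := Lpnorm 4 u ^+ 4.
Definition good4 u := L4 mu (re u) /\ L4 mu (im u).
Definition csc (t : R) u : cfun := fun x => (t%:C)%C * u x.
Definition czero : cfun := fun=> 0.
Definition modsq u x := re u x ^+ 2 + im u x ^+ 2.

Lemma modsq_ge0 u x : 0 <= modsq u x.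
Proof. by rewrite /modsq addr_ge0 ?sqr_ge0. Qed.

Lemma modsq_sqint u : good4 u -> sqint mu (modsq u).
Proof. by move=> [[_ h1] [_ h2]]; exact: sqintD. Qed.

Lemma n4E u : good4 u -> n4 u = N (modsq u).
Proof. by move=> [h1 h2]; exact: Lpnorm4. Qed.

Lemma couplingE2 u v : coupling u v = I (fun x => modsq u x * modsq v x).
Proof. exact: couplingE. Qed.

Lemma n4_ge0 u : good4 u -> 0 <= n4 u.
Proof. by move=> gu; rewrite n4E// N_ge0. Qed.

Lemma coupling_ge0 u v : 0 <= coupling u v.
Proof. by rewrite couplingE2; apply: Rint_ge0 => x; rewrite mulr_ge0 ?modsq_ge0. Qed.

Lemma coupling_young (l : R) u v : 0 < l -> good4 u -> good4 v ->
  coupling u v <= l / 2 * n4 u + (2 * l)^-1 * n4 v.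
Proof.
by move=> l0 gu gv; rewrite couplingE2 !n4E//; apply: young => //; exact: modsq_sqint.
Qed.

Lemma re_csc t u x : re (csc t u) x = t * re u x.
Proof. by rewrite /re /csc; case: (u x) => a b /=; rewrite mul0r subr0. Qed.

Lemma im_csc t u x : im (csc t u) x = t * im u x.
Proof. by rewrite /im /csc; case: (u x) => a b /=; rewrite mul0r addr0. Qed.

Lemma re_cscE t u : re (csc t u) = (fun x => t * re u x).
Proof. by apply/funext => x; exact: re_csc. Qed.

Lemma im_cscE t u : im (csc t u) = (fun x => t * im u x).
Proof. by apply/funext => x; exact: im_csc. Qed.

Lemma modsq_csc t u x : modsq (csc t u) x = t ^+ 2 * modsq u x.
Proof. by rewrite /modsq re_csc im_csc; ring. Qed.

Lemma good4_csc t u : good4 u -> good4 (csc t u).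
Proof. by move=> [h1 h2]; split; rewrite ?re_cscE ?im_cscE; exact: L4Z. Qed.

Lemma n4_csc t u : good4 u -> n4 (csc t u) = t ^+ 4 * n4 u.
Proof.
move=> gu; rewrite !n4E//; last exact: good4_csc.
rewrite -RintZ; last by case: (modsq_sqint gu).
by apply: eq_Rintegral => x _; rewrite modsq_csc exprMn -exprM.
Qed.

Lemma coupling_csc t u v : good4 u -> good4 v -> coupling (csc t u) (csc t v) = t ^+ 4 * coupling u v.
Proof.
move=> gu gv; rewrite !couplingE2 -RintZ; last by apply: sqint_intbleM; exact: modsq_sqint.
by apply: eq_Rintegral => x _; rewrite !modsq_csc; ring.
Qed.

Lemma aezero_csc t u : 0 < t -> aezero (csc t u) -> aezero u.
Proof.
move=> t0 /aezeroP[h1 h2]; apply/aezeroP.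
have tN0 : t != 0 by rewrite gt_eqF.
split; [apply: (ae_imp h1)|apply: (ae_imp h2)] => x /eqP; rewrite ?re_csc ?im_csc mulf_eq0 (negPf tN0)/= => /eqP //.
Qed.

Lemma sq_ae0 f : sqint mu f -> N f = 0 -> {ae mu, forall x, f x = 0}.
Proof.
move=> [_ fi] /(Rint_eq0 fi (fun x => sqr_ge0 _)) h.
by apply: (ae_imp h) => x /eqP; rewrite sqrf_eq0 => /eqP.
Qed.

Lemma n4_gt0 u : good4 u -> ~ aezero u -> 0 < n4 u.
Proof.
move=> gu nu; rewrite lt_def n4_ge0// andbT; apply/negP => /eqP n0; apply: nu.
have := sq_ae0 (modsq_sqint gu); rewrite -n4E// n0 => /(_ erefl) h; apply/aezeroP.
split; apply: (ae_imp h) => x /eqP; rewrite /modsq paddr_eq0 ?sqr_ge0// !sqrf_eq0 => /andP[/eqP ? /eqP ?] //.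
Qed.

Lemma n4_le u : good4 u -> n4 u <= 2 * (I (fun x => re u x ^+ 4) + I (fun x => im u x ^+ 4)).
Proof.
move=> gu; have [[_ h1] [_ h2]] := gu.
have f4 f : (fun x => f x ^+ 4) = (fun x => (f x ^+ 2) ^+ 2) by apply/funext => x; rewrite -exprM.
rewrite n4E// !f4 -RintD; [|exact: h1.2|exact: h2.2].
have i12 := intbleD h1.2 h2.2; rewrite -RintZ//.
apply: Rint_le; [by case: (modsq_sqint gu)|exact: intbleZ|].
move=> x; rewrite /modsq; move: (re u x ^+ 2) (im u x ^+ 2) => a b.
by have := sqr_ge0 (a - b); nra.
Qed.

Lemma wderZ (a : R) f g : wder f g -> wder (fun x => a * f x) (fun i x => a * g i x).
Proof.
move=> w; have := wder_comb a w (wder_comb (-1) w w); congr wder.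
  by apply/funext => x; rewrite mulN1r addNr addr0.
by apply/funext => i; apply/funext => x; rewrite /comb mulN1r addNr addr0.
Qed.

Lemma NZ (a : R) f : sqint mu f -> N (fun x => a * f x) = a ^+ 2 * N f.
Proof. by move=> [_ fi]; rewrite -RintZ//; apply: eq_Rintegral => x _; rewrite exprMn. Qed.

Lemma enZ (l a : R) f g : h1l2 f g ->
  en l (fun x => a * f x) (fun i x => a * g i x) (fun x => a * f x) (fun i x => a * g i x) = a ^+ 2 * en l f g f g.
Proof.
move=> [sf sg]; rewrite !en_self (NZ a sf) (NZ a (sg 0)) (NZ a (sg 1)); ring.
Qed.

(** What the free form on H^1 and the point form on its larger domain have in common. The general
    comparison of levels is proved once from these properties; the last one says that Q extends the
    free form. *)
Record admissible X Q (om : R) : Prop := Admissible {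
  adm_good : forall u, X u -> good4 u;
  adm_csc : forall t u, 0 < t -> X u -> X (csc t u) /\ Q (csc t u) = t ^+ 2 * Q u;
  adm_ge0 : forall u, X u -> 0 <= Q u;
  adm_gt0 : forall u, X u -> ~ aezero u -> 0 < Q u;
  adm_gn : exists K, forall u, X u -> n4 u <= K * Q u ^+ 2;
  adm_H1 : forall u, H1 u -> X u /\ Q u = free_form om u }.

Lemma H1_good4 u : H1 u -> good4 u.
Proof. by move=> /H1P[g [h [w1 w2]]]; split; [exact: wder_L4 w1|exact: wder_L4 w2]. Qed.

Lemma free_admissible (om : R) : 0 < om -> admissible (@H1 R) (@free_form R om) om.
Proof.
move=> om0; split.
- exact: H1_good4.
- move=> t u t0 /H1P[g [h [w1 w2]]].
  have w1' : wder (re (csc t u)) (fun i x => t * g i x) by rewrite re_cscE; exact: wderZ.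
  have w2' : wder (im (csc t u)) (fun i x => t * h i x) by rewrite im_cscE; exact: wderZ.
  split; first by apply/H1P; do 2 eexists; split; eassumption.
  rewrite (free_formE om w1' w2') (free_formE om w1 w2) re_cscE im_cscE.
  by rewrite !enZ ?mulrDr//; exact: wder_h1l2.
- move=> u /H1P[g [h [w1 w2]]]; rewrite (free_formE om w1 w2).
  by apply: addr_ge0; apply: en_ge0 => //; exact: wder_h1l2.
- move=> u /H1P[g [h [w1 w2]]] nu; rewrite (free_formE om w1 w2).
  have e1 := en_ge0 om0 (wder_h1l2 w1); have e2 := en_ge0 om0 (wder_h1l2 w2).
  rewrite lt_def addr_ge0// andbT; apply/negP => /eqP /eqP; rewrite paddr_eq0// => /andP[/eqP z1 /eqP z2].
  apply: nu; apply/aezeroP.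
  have N0 f k : wder f k -> en om f k f k = 0 -> {ae mu, forall x, f x = 0}.
    move=> [sf _] z; apply: sq_ae0 => //; apply/eqP; rewrite eq_le N_ge0 andbT.
    by rewrite -(pmulr_rle0 _ om0) -z; exact: en_ge_mass.
  by split; [exact: N0 w1 z1|exact: N0 w2 z2].
- exists (2 * om^-1) => u hu; have /H1P[g [h [w1 w2]]] := hu; rewrite (free_formE om w1 w2).
  have e1 := en_ge0 om0 (wder_h1l2 w1); have e2 := en_ge0 om0 (wder_h1l2 w2).
  have [_ b1] := gagliardo_nirenberg om0 w1; have [_ b2] := gagliardo_nirenberg om0 w2.
  apply: le_trans (n4_le (H1_good4 hu)) _; rewrite -mulrA ler_wpM2l//.
  apply: le_trans (lerD b1 b2) _; rewrite -mulrDr ler_wpM2l ?invr_ge0 ?(ltW om0)//.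
  move: (en _ _ _ _ _) (en _ _ _ _ _) e1 e2 => a b a0 b0; have := mulr_ge0 a0 b0; nra.
- by [].
Qed.

Section Point.
Variables (alpha lam om : R).
Hypotheses (hlam : omega_min alpha < lam) (lam_om : lam <= om).
Let lam0 : 0 < lam. Proof. by have [] := omega_theta hlam. Qed.
Let A := alpha + theta lam.
Let A0 : 0 < A. Proof. by have [] := omega_theta hlam. Qed.
Let Gr := re (green lam).
Let gGr : is_greenR lam Gr. Proof. by have [] := greenP lam0. Qed.
Let Aq (x y : R) : 0 <= A * (x ^+ 2 + y ^+ 2).
Proof. by apply: mulr_ge0; [exact: ltW|apply: addr_ge0; exact: sqr_ge0]. Qed.

Lemma point_admissible : admissible (@H1alpha R) (@point_form R alpha lam om) om.
Proof.
have ol : 0 <= om - lam by rewrite subr_ge0.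
have good u : H1alpha u -> good4 u.
  move=> /(H1alpha_decomp lam0)[_ [q1 [q2 [g [h [w1 w2]]]]]].
  by split; [exact: (green_part_L4 lam0 w1)|exact: (green_part_L4 lam0 w2)].
have ge u q1 q2 g h : L2 u -> wder (fun x => re u x - q1 * Gr x) g -> wder (fun x => im u x - q2 * Gr x) h ->
    en lam (fun x => re u x - q1 * Gr x) g (fun x => re u x - q1 * Gr x) g +
    en lam (fun x => im u x - q2 * Gr x) h (fun x => im u x - q2 * Gr x) h + A * (q1 ^+ 2 + q2 ^+ 2) <= point_form alpha lam om u.
  move=> Lu w1 w2; rewrite (point_formE lam0 alpha om Lu w1 w2).
  by rewrite lerD2r lerDl mulr_ge0// addr_ge0// N_ge0.
split=> //.
- move=> t u t0 /(H1alpha_decomp lam0)[Lu [q1 [q2 [g [h [w1 w2]]]]]].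
  have /L2P[s1 s2] := Lu.
  have Lt : L2 (csc t u) by apply/L2P; rewrite re_cscE im_cscE; split; exact: sqintZ.
  have E q f : (fun x => t * f x - t * q * Gr x) = (fun x => t * (f x - q * Gr x)) by apply/funext => x; ring.
  have w1' : wder (fun x => re (csc t u) x - t * q1 * Gr x) (fun i x => t * g i x).
    by rewrite re_cscE E; exact: wderZ.
  have w2' : wder (fun x => im (csc t u) x - t * q2 * Gr x) (fun i x => t * h i x).
    by rewrite im_cscE E; exact: wderZ.
  split; first exact: (H1alpha_comp lam0 Lt w1' w2').
  rewrite (point_formE lam0 alpha om Lt w1' w2') (point_formE lam0 alpha om Lu w1 w2).
  rewrite re_cscE im_cscE !E (NZ t s1) (NZ t s2) (enZ lam t (wder_h1l2 w1)) (enZ lam t (wder_h1l2 w2)).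
  ring.
- move=> u /(H1alpha_decomp lam0)[Lu [q1 [q2 [g [h [w1 w2]]]]]].
  apply: le_trans (ge _ _ _ _ _ Lu w1 w2).
  apply: addr_ge0; first by apply: addr_ge0; apply: en_ge0 => //; exact: wder_h1l2.
  exact: Aq.
- move=> u /(H1alpha_decomp lam0)[Lu [q1 [q2 [g [h [w1 w2]]]]]] nu.
  apply: lt_le_trans (ge _ _ _ _ _ Lu w1 w2).
  have e1 := en_ge0 lam0 (wder_h1l2 w1); have e2 := en_ge0 lam0 (wder_h1l2 w2).
  have zero (a b c : R) : 0 <= a -> 0 <= b -> 0 <= c -> (a = 0 -> b = 0 -> c = 0 -> False) -> 0 < a + b + c.
    move=> a0 b0 c0 abc; rewrite lt_def; apply/andP; split; last by apply: addr_ge0 => //; exact: addr_ge0.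
    apply/negP; rewrite paddr_eq0 ?addr_ge0// paddr_eq0// => /andP[/andP[/eqP ? /eqP ?] /eqP ?]; exact: abc.
  apply: (zero _ _ _ e1 e2 (Aq q1 q2)) => z1 z2 /eqP; rewrite mulf_eq0 (gt_eqF A0)/= paddr_eq0 ?sqr_ge0// !sqrf_eq0.
  move=> /andP[/eqP q10 /eqP q20]; apply: nu; apply/aezeroP.
  have N0 f q k : q = 0 -> wder (fun x => f x - q * Gr x) k -> en lam (fun x => f x - q * Gr x) k (fun x => f x - q * Gr x) k = 0 -> {ae mu, forall x, f x = 0}.
    move=> -> [sf _] z; have Nz : N (fun x => f x - 0 * Gr x) = 0.
      apply/eqP; rewrite eq_le N_ge0 andbT.
      by have := en_ge_mass lam (fun x => f x - 0 * Gr x) k; rewrite z pmulr_rle0.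
    by apply: (ae_imp (sq_ae0 sf Nz)) => x; rewrite mul0r subr0.
  by split; [exact: N0 q10 w1 z1|exact: N0 q20 w2 z2].
- pose g4 := I (fun x => Gr x ^+ 4).
  have f4 f : (fun x => f x ^+ 4) = (fun x => (f x ^+ 2) ^+ 2) by apply/funext => x; rewrite -exprM.
  have iG : intble mu (fun x => Gr x ^+ 4) by rewrite f4; exact: (green_L4 lam0 gGr).2.
  have g40 : 0 <= g4 by apply: Rint_ge0 => x; rewrite -[4%N]/(2 * 2)%N exprM sqr_ge0.
  (* 1/lam comes from Gagliardo-Nirenberg for the regular part, g4 / A^2 from the charge, with q^2
     at most the form divided by A. The factor 32 combines (a + b)^4 <= 8 (a^4 + b^4), the two real
     components and the 2 in [n4_le]. *)
  exists (32 * (lam^-1 + g4 / A ^+ 2)) => u hu.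
  have [Lu [q1 [q2 [g [h [w1 w2]]]]]] := H1alpha_decomp lam0 hu.
  have Qge := ge _ _ _ _ _ Lu w1 w2.
  apply: le_trans (n4_le (good _ hu)) _.
  have e1 := en_ge0 lam0 (wder_h1l2 w1); have e2 := en_ge0 lam0 (wder_h1l2 w2).
  have qA q : q ^+ 2 <= q1 ^+ 2 + q2 ^+ 2 -> q ^+ 2 <= point_form alpha lam om u / A.
    move=> qq; rewrite ler_pdivlMr// mulrC; apply: le_trans (ler_wpM2l (ltW A0) qq) _.
    by apply: le_trans Qge; rewrite lerDr; exact: addr_ge0.
  have Q0 : 0 <= point_form alpha lam om u.
    by apply: le_trans Qge; apply: addr_ge0; [exact: addr_ge0|exact: Aq].
  have part f q k : wder (fun x => f x - q * Gr x) k -> q ^+ 2 <= point_form alpha lam om u / A ->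
      en lam (fun x => f x - q * Gr x) k (fun x => f x - q * Gr x) k <= point_form alpha lam om u ->
      I (fun x => f x ^+ 4) <= 8 * (lam^-1 + g4 / A ^+ 2) * point_form alpha lam om u ^+ 2.
    move=> w qle ele; have [[_ r2] b] := gagliardo_nirenberg lam0 w; have [_ [_ f2]] := green_part_L4 lam0 w.
    have i1 : intble mu (fun x => (f x - q * Gr x) ^+ 4) by rewrite f4.
    have i2 := intbleZ (q ^+ 4) iG; have i3 := intbleD i1 i2.
    apply: (@le_trans _ _ (8 * (I (fun x => (f x - q * Gr x) ^+ 4) + q ^+ 4 * g4))).
      rewrite /g4 -RintZ// -RintD// -RintZ//; apply: Rint_le; [by rewrite f4|exact: intbleZ|].
      move=> x; have -> : q ^+ 4 * Gr x ^+ 4 = (q * Gr x) ^+ 4 by rewrite exprMn.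
      move: (q * Gr x) => b0; have -> : f x ^+ 4 = ((f x - b0) + b0) ^+ 4 by rewrite subrK.
      move: (f x - b0) => a; rewrite -subr_ge0.
      have -> : 8 * (a ^+ 4 + b0 ^+ 4) - (a + b0) ^+ 4 = (a - b0) ^+ 2 * (5 * (a + b0) ^+ 2 + 2 * (a ^+ 2 + b0 ^+ 2)) by ring.
      by apply: mulr_ge0; [exact: sqr_ge0|apply: addr_ge0; apply: mulr_ge0 => //; [exact: sqr_ge0|apply: addr_ge0; exact: sqr_ge0]].
    rewrite -mulrA ler_wpM2l// mulrDl; apply: lerD.
      apply: le_trans b _; rewrite ler_wpM2l ?invr_ge0 ?(ltW lam0)//.
      by rewrite lerXn2r ?nnegrE//; apply: en_ge0 => //; exact: wder_h1l2.
    have -> : g4 / A ^+ 2 * point_form alpha lam om u ^+ 2 = (point_form alpha lam om u / A) ^+ 2 * g4.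
      by rewrite expr_div_n; ring.
    apply: ler_wpM2r => //; rewrite -[4%N]/(2 * 2)%N exprM; apply: lerXn2r => //.
      by rewrite nnegrE sqr_ge0.
    by rewrite nnegrE divr_ge0// ltW.
  have AA := Aq q1 q2.
  have p1 : I (fun x => re u x ^+ 4) <= 8 * (lam^-1 + g4 / A ^+ 2) * point_form alpha lam om u ^+ 2.
    apply: (part _ _ _ w1); first by apply: qA; rewrite lerDl sqr_ge0.
    by apply: le_trans Qge; rewrite -addrA lerDl; exact: addr_ge0.
  have p2 : I (fun x => im u x ^+ 4) <= 8 * (lam^-1 + g4 / A ^+ 2) * point_form alpha lam om u ^+ 2.
    apply: (part _ _ _ w2); first by apply: qA; rewrite lerDr sqr_ge0.
    by apply: le_trans Qge; rewrite addrAC lerDr; exact: addr_ge0.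
  have aux (a b k p : R) : a <= 8 * k * p -> b <= 8 * k * p -> 2 * (a + b) <= 32 * k * p.
    move=> ha hb; have -> : 32 * k * p = 2 * (8 * k * p + 8 * k * p) by ring.
    by rewrite ler_wpM2l// lerD.
  exact: aux p1 p2.
move=> u hu; split; first exact: (H1_sub_H1alpha lam0 hu).
exact: (point_form_H1 lam0).
Qed.

End Point.

(** If f vanishes almost everywhere, so does the integral of f against k - Delta k, where k = f -
    Delta f. By symmetry this integral is the squared norm of k, which controls f 0 through
    [H2_estimate]. *)
Lemma test_not_ae0 (f : plane -> R) : testf f -> f 0 != 0 -> ~ {ae mu, forall x, f x = 0}.
Proof.
move=> tf f0 z; have [C C0 HC] := H2_estimate (ltr01 : (0 : R) < 1).
pose k x := 1 * f x - lap f x.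
have tk : testf k by apply: testfB; [exact: testfZ|exact: testf_lap].
have tk2 : testf (fun x => 1 * k x - lap k x) by apply: testfB; [exact: testfZ|exact: testf_lap].
have Nk : N k = 0.
  rewrite -Rint_mulself; apply: etrans (wder_helmholtz 1 (wder_test tk) tf) _.
  rewrite enC; apply: etrans (esym (wder_helmholtz 1 (wder_test tf) tk)) _.
  apply: ae0_Rint; first exact: intble_meas (testfM_intble tf tk2).
  by apply: (ae_imp z) => x ->; rewrite mul0r.
have := HC f tf; rewrite -/k Nk mulr0 => h; move: f0; rewrite -sqrf_eq0.
by rewrite eq_le h sqr_ge0.
Qed.

Lemma H1_nonzero : exists u, H1 u /\ ~ aezero u.
Proof.
have [f tf f1] := test_at0 R; pose u : cfun := fun x => (f x +i* 0)%C.
have w0 : wder (fun=> 0 : R) (fun _ (_ : plane) => 0 : R).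
  have := wderZ 0 (wder_test tf); congr wder; first by apply/funext => x; rewrite mul0r.
  by apply/funext => i; apply/funext => x; rewrite mul0r.
exists u; split; first by apply/H1P; exists (grad f), (fun _ _ => 0); split => //; exact: wder_test.
move=> /aezeroP[h _]; apply: (test_not_ae0 tf _ h); by rewrite f1 oner_eq0.
Qed.

Lemma zero_form : H1 czero /\ forall om, free_form om czero = 0.
Proof.
have [u [hu _]] := H1_nonzero; have /H1P[g [h [w1 w2]]] := hu.
have w0 : wder (fun=> 0 : R) (fun _ (_ : plane) => 0 : R).
  have := wderZ 0 w1; congr wder; first by apply/funext => x; rewrite mul0r.
  by apply/funext => i; apply/funext => x; rewrite mul0r.
have [r0 i0] : wder (re czero) (fun _ _ => 0) /\ wder (im czero) (fun _ _ => 0) by [].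
split; first by apply/H1P; do 2 eexists; split; eassumption.
move=> om; rewrite (free_formE om r0 i0) !en_self.
have N0 : N (fun=> 0 : R) = 0 by under eq_Rintegral do rewrite expr0n; exact: Rint_cst0.
by rewrite !N0; ring.
Qed.

Lemma n4_czero : n4 czero = 0.
Proof.
rewrite n4E; last by apply: H1_good4; case: zero_form.
rewrite (_ : modsq czero = fun=> 0); last by apply/funext => x; rewrite /modsq /re /im /= expr0n addr0.
by under eq_Rintegral do rewrite expr0n; exact: Rint_cst0.
Qed.

Lemma coupling_czerol v : coupling czero v = 0.
Proof.
rewrite couplingE2 (_ : modsq czero = fun=> 0); last by apply/funext => x; rewrite /modsq /re /im /= expr0n addr0.
by under eq_Rintegral do rewrite mul0r; exact: Rint_cst0.
Qed.

Lemma couplingC u v : coupling u v = coupling v u.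
Proof. by rewrite !couplingE2; apply: eq_Rintegral => x _; rewrite mulrC. Qed.

Lemma coupling_self u : good4 u -> coupling u u = n4 u.
Proof. by move=> gu; rewrite couplingE2 n4E// Rint_mulself. Qed.

Definition total4 (be : R) u v := n4 u + n4 v + 2 * be * coupling u v.

Section Levels.
Variables (X : set cfun) (Q : cfun -> R) (om tom : R).
Hypothesis adm : admissible X Q om.
Hypothesis tom0 : 0 < tom.
Local Notation F := (@free_form R tom).
Let admF : admissible (@H1 R) F tom := free_admissible tom0.

Let D (p : cfun * cfun) := X p.1 /\ H1 p.2.
Let nz (p : cfun * cfun) := ~ (aezero p.1 /\ aezero p.2).
Let QQ (p : cfun * cfun) := Q p.1 + F p.2.
Let sc t (p : cfun * cfun) := (csc t p.1, csc t p.2).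

Let nzP p : nz p -> ~ aezero p.1 \/ ~ aezero p.2.
Proof. by move=> n; have [z|] := pselect (aezero p.1); [right => z2; exact: n|left]. Qed.

Let QQpos p : D p -> nz p -> 0 < QQ p.
Proof.
move=> [d1 d2] /nzP[n|n].
  by apply: ltr_wpDr; [exact: (adm_ge0 admF d2)|exact: (adm_gt0 adm d1)].
by apply: ltr_wpDl; [exact: (adm_ge0 adm d1)|exact: (adm_gt0 admF d2)].
Qed.

Let good1 u : X u -> good4 u := adm_good adm (u := u).

Let NNpos be p : 0 <= be -> D p -> nz p -> 0 < total4 be p.1 p.2.
Proof.
move=> be0 [d1 d2] n; have cp : 0 <= 2 * be * coupling p.1 p.2 by apply: mulr_ge0; [exact: mulr_ge0|exact: coupling_ge0].
have a1 := n4_ge0 (good1 d1); have a2 := n4_ge0 (H1_good4 d2).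
apply: ltr_wpDr => //; case: (nzP n) => m.
  by apply: ltr_wpDr => //; exact: n4_gt0 (good1 d1) m.
by apply: ltr_wpDl => //; exact: n4_gt0 (H1_good4 d2) m.
Qed.

Lemma total4_csc be t u v : X u -> H1 v -> total4 be (csc t u) (csc t v) = t ^+ 4 * total4 be u v.
Proof.
move=> /good1 d1 /H1_good4 d2; rewrite /total4 (n4_csc t d1) (n4_csc t d2) (coupling_csc t d1 d2); ring.
Qed.

Let scP be t p : 0 < t -> D p -> nz p -> [/\ D (sc t p), nz (sc t p), QQ (sc t p) = t ^+ 2 * QQ p &
  total4 be (sc t p).1 (sc t p).2 = t ^+ 4 * total4 be p.1 p.2].
Proof.
move=> t0 [d1 d2] n; have [x1 q1] := adm_csc adm t0 d1; have [x2 q2] := adm_csc admF t0 d2.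
split=> //.
- by move=> [/(aezero_csc t0) z1 /(aezero_csc t0) z2]; exact: n.
- exact: etrans (congr2 +%R q1 q2) (esym (mulrDr _ _ _)).
- exact: total4_csc.
Qed.

Let ne : exists p, D p /\ nz p.
Proof.
have [u [hu nu]] := H1_nonzero; have [z0 _] := zero_form.
by exists (czero, u); split; [split => //; case: (adm_H1 adm z0)|move=> [_]].
Qed.

Let levelE be : level X Q F be = inf [set 2^-1 * QQ p - 4^-1 * total4 be p.1 p.2 |
  p in [set p | D p /\ nz p /\ QQ p = total4 be p.1 p.2]].
Proof.
have alg (q1 q2 a b k : R) : 2^-1 * (q1 + q2) - 4^-1 * (a + b + 2 * be * k) =
    2^-1 * (q1 + q2) - 4^-1 * (a + b) - be / 2 * k by field.
have alg2 (q a k : R) : q - a - 2 * be * k = q - (a + 2 * be * k) by ring.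
rewrite /level; congr inf; apply/seteqP; split => y [p].
  move=> [x1 x2 n nf] <-; exists p; last exact: alg.
  split => //; split => //; apply/eqP; rewrite -subr_eq0; apply/eqP.
  by apply: etrans nf; exact: esym (alg2 _ _ _).
move=> [[x1 x2] [n nf]] <-; exists p; last exact: esym (alg _ _ _ _ _).
by split => //; apply: etrans (alg2 _ _ _) _; apply/eqP; rewrite subr_eq0; apply/eqP.
Qed.

(** The null pair is included, its quartic part being 0, so that perturbed pairs can be inserted
    without checking that they are nonzero. *)
Lemma level_le be u v : 0 <= be -> X u -> H1 v ->
  4 * level X Q F be * total4 be u v <= (Q u + F v) ^+ 2.
Proof.
move=> be0 x1 x2; have [[z1 z2]|n] := pselect (aezero u /\ aezero v).
  have n0 w : good4 w -> aezero w -> {ae mu, forall x, modsq w x = 0}.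
    by move=> _ /aezeroP[h1 h2]; apply: (ae_imp2 h1 h2) => x; rewrite /modsq => -> ->; rewrite expr0n addr0.
  have [gu gv] := (good1 x1, H1_good4 x2).
  have nn w : good4 w -> aezero w -> n4 w = 0.
    move=> gw zw; rewrite n4E//; have [[mm _] z] := (modsq_sqint gw, n0 w gw zw).
    by apply: ae0_Rint; [exact: measurable_funX|apply: (ae_imp z) => x ->; rewrite expr0n].
  have cp : coupling u v = 0.
    apply/eqP; rewrite eq_le coupling_ge0 andbT; apply: le_trans (coupling_young ltr01 gu gv) _.
    by rewrite !nn// !mulr0 addr0.
  by rewrite /total4 !nn// cp !(mulr0, addr0) sqr_ge0.
rewrite levelE; have dp : D (u, v) by [].
exact: (@nehari_level_le R _ D nz QQ (fun p => total4 be p.1 p.2) sc QQpos (fun p => @NNpos be p be0) (scP be) ne (u, v) dp n).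
Qed.

Lemma level_ge be b : 0 <= be -> (forall u v, X u -> H1 v -> ~ (aezero u /\ aezero v) ->
  4 * b * total4 be u v <= (Q u + F v) ^+ 2) -> b <= level X Q F be.
Proof.
move=> be0 h; rewrite levelE.
apply: (@nehari_level_ge R _ D nz QQ (fun p => total4 be p.1 p.2) sc QQpos (fun p => @NNpos be p be0) (scP be) ne).
by move=> p [d1 d2] n; exact: h.
Qed.

Let ne1 : exists u, X u /\ ~ aezero u.
Proof. by have [u [hu nu]] := H1_nonzero; exists u; split => //; case: (adm_H1 adm hu). Qed.

Let level1E : level1 X Q = inf [set 2^-1 * Q u - 4^-1 * n4 u | u in [set u | X u /\ ~ aezero u /\ Q u = n4 u]].
Proof.
rewrite /level1; congr inf; apply/seteqP; split => y [u].
  by move=> [x1 n nf] <-; exists u.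
by move=> [x1 [n nf]] <-; exists u.
Qed.

Let n4pos u : X u -> ~ aezero u -> 0 < n4 u.
Proof. by move=> /good1 gv nv; exact: n4_gt0. Qed.

Let scP1 t u : 0 < t -> X u -> ~ aezero u ->
  [/\ X (csc t u), ~ aezero (csc t u), Q (csc t u) = t ^+ 2 * Q u & n4 (csc t u) = t ^+ 4 * n4 u].
Proof.
move=> t0 xv nv; have [x1 q1] := adm_csc adm t0 xv; split => //.
  by move=> /(aezero_csc t0).
exact: n4_csc (good1 xv).
Qed.

Lemma level1_le u : X u -> ~ aezero u -> 4 * level1 X Q * n4 u <= Q u ^+ 2.
Proof. by move=> x n; rewrite level1E; exact: (nehari_level_le (adm_gt0 adm) n4pos scP1 ne1 x n). Qed.

Lemma level1_ge b : (forall u, X u -> ~ aezero u -> 4 * b * n4 u <= Q u ^+ 2) -> b <= level1 X Q.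
Proof. by move=> h; rewrite level1E; exact: (nehari_level_ge (adm_gt0 adm) n4pos scP1 ne1 h). Qed.

End Levels.

End Admissible.

(** * Comparison of the levels *)

Section Comparison.
Variable R : realType.
Local Notation plane := (R * R)%type.
Local Notation cfun := (R * R -> R[i]).
Local Notation mu := (leb2 R).
Local Notation I f := (\int[leb2 R]_x f x).
Implicit Types (u v : cfun) (X : set cfun) (Q : cfun -> R).

Lemma total4E (be : R) u v : good4 u -> good4 v ->
  total4 be u v = Nq mu be (re u) (im u) (re v) (im v).
Proof.
move=> gu gv; have [su sv] := (modsq_sqint gu, modsq_sqint gv).
have i1 := intbleD su.2 sv.2; have i2 := sqint_intbleM su sv; have i3 := intbleZ (2 * be) i2.
rewrite /total4 !n4E// couplingE2 -(RintD su.2 sv.2) -(RintZ _ i2) -(RintD i1 i3).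
by [].
Qed.

Lemma n4_aezero (w : cfun) : good4 w -> aezero w -> n4 w = 0.
Proof.
move=> gw /aezeroP[z1 z2]; have [ms _] := modsq_sqint gw.
rewrite n4E//; apply: ae0_Rint; first exact: measurable_funX.
by apply: (ae_imp2 z1 z2) => x; rewrite /modsq => -> ->; rewrite expr0n addr0 expr0n.
Qed.

Lemma level1_le_all X Q (om : R) w : admissible X Q om -> X w -> 4 * level1 X Q * n4 w <= Q w ^+ 2.
Proof.
move=> a xw; have [z|n] := pselect (aezero w); last exact: (level1_le a xw n).
by rewrite (n4_aezero (adm_good a xw) z) mulr0 sqr_ge0.
Qed.

Section Levels.
Variables (X : set cfun) (Q : cfun -> R) (om tom : R).
Hypothesis adm : admissible X Q om.
Hypothesis tom0 : 0 < tom.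
Local Notation F := (@free_form R tom).
Let admF : admissible (@H1 R) F tom := free_admissible tom0.

Let Q0 u : X u -> 0 <= Q u := adm_ge0 adm (u := u).
Let F0 u : H1 u -> 0 <= F u := adm_ge0 admF (u := u).

Lemma coupling_le u v : good4 u -> good4 v -> 2 * coupling u v <= n4 u + n4 v.
Proof.
move=> gu gv; have := coupling_young ltr01 gu gv; rewrite mulr1.
by move: (coupling u v) (n4 u) (n4 v) => a b c h; lra.
Qed.

Lemma level_gt0 be : 0 <= be -> 0 < level X Q F be.
Proof.
move=> be0; have [K1 HK1] := adm_gn adm; have [K2 HK2] := adm_gn admF.
(* The coupling is absorbed by 2 |u|^2 |v|^2 <= |u|^4 + |v|^4, whence 1 + be; the summand 1 keeps K
   positive. The quartic part is then at most K times the squared form, and the level is at least 1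
   / (4 K). *)
pose K := (1 + be) * (`|K1| + `|K2| + 1); have K0 : 0 < K.
  by apply: mulr_gt0; [rewrite ltr_wpDr|rewrite ltr_wpDl// addr_ge0].
apply: (@lt_le_trans _ _ (4 * K)^-1); first by rewrite invr_gt0 mulr_gt0.
apply: (level_ge adm tom0 be0) => u v x1 x2 _.
have gu := adm_good adm x1; have gv := H1_good4 x2.
have E : 4 * (4 * K)^-1 = K^-1 by field; rewrite gt_eqF.
rewrite E ler_pdivrMl//.
have h1 : n4 u <= `|K1| * Q u ^+ 2.
  by apply: le_trans (HK1 u x1) _; rewrite ler_wpM2r ?sqr_ge0// ler_norm.
have h2 : n4 v <= `|K2| * F v ^+ 2.
  by apply: le_trans (HK2 v x2) _; rewrite ler_wpM2r ?sqr_ge0// ler_norm.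
have sq (a b : R) : 0 <= a -> 0 <= b -> a ^+ 2 <= (a + b) ^+ 2 /\ b ^+ 2 <= (a + b) ^+ 2.
  by move=> a0 b0; have := mulr_ge0 a0 b0; have := sqr_ge0 a; have := sqr_ge0 b; split; nra.
have [s1 s2] := sq _ _ (Q0 x1) (F0 x2).
have h3 : n4 u + n4 v <= (`|K1| + `|K2| + 1) * (Q u + F v) ^+ 2.
  apply: (@le_trans _ _ ((`|K1| + `|K2|) * (Q u + F v) ^+ 2)).
    rewrite mulrDl; apply: lerD.
      by apply: le_trans h1 _; rewrite ler_wpM2l.
    by apply: le_trans h2 _; rewrite ler_wpM2l.
  by rewrite ler_wpM2r ?sqr_ge0// lerDl.
apply: (@le_trans _ _ ((1 + be) * (n4 u + n4 v))).
  have aux (n c : R) : 2 * c <= n -> n + 2 * be * c <= (1 + be) * n.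
    by move=> h; have := ler_wpM2l be0 h; lra.
  exact: aux (coupling_le gu gv).
by rewrite /K -mulrA ler_wpM2l// addr_ge0.
Qed.

Lemma level_mono b b' : 0 <= b -> b <= b' -> level X Q F b' <= level X Q F b.
Proof.
move=> b0 bb; have b'0 := le_trans b0 bb.
apply: (level_ge adm tom0 b0) => u v x1 x2 _.
apply: le_trans (level_le adm tom0 b'0 x1 x2).
apply: ler_wpM2l; first by rewrite mulr_ge0// ltW// level_gt0.
by rewrite /total4 lerD2l; apply: ler_wpM2r; [exact: coupling_ge0|rewrite ler_wpM2l].
Qed.

(** Semitrivial pairs (u, 0) are inserted in the quotient; pairs (0, v) give the next bound. *)
Lemma level_le_level1 be : 0 <= be -> level X Q F be <= level1 X Q.
Proof.
move=> be0; apply: (level1_ge adm) => u x1 _.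
have [z0 fz] := zero_form R; have := level_le adm tom0 be0 x1 z0.
by rewrite /total4 n4_czero couplingC coupling_czerol mulr0 !addr0 fz addr0.
Qed.

Lemma level_le_free be : 0 <= be -> level X Q F be <= level1 (@H1 R) F.
Proof.
move=> be0; apply: (level1_ge admF) => v x2 _.
have [z0 fz] := zero_form R; have [zx qz] := adm_H1 adm z0.
have := level_le adm tom0 be0 zx x2.
by rewrite /total4 n4_czero coupling_czerol mulr0 addr0 add0r qz fz add0r.
Qed.

(** Without coupling the quartic part splits, so 4 b N <= Q(u)^2 + F(v)^2 <= (Q(u) + F(v))^2. *)
Lemma le_level0 b : 0 <= b -> b <= level1 X Q -> b <= level1 (@H1 R) F -> b <= level X Q F 0.
Proof.
move=> b0 b1 b2; apply: (level_ge adm tom0 (lexx 0)) => u v x1 x2 _.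
have single X' Q' om' w : admissible X' Q' om' -> b <= level1 X' Q' -> X' w -> 4 * b * n4 w <= Q' w ^+ 2.
  move=> a bl xw; apply: le_trans (level1_le_all a xw); apply: ler_wpM2r; first exact: n4_ge0 (adm_good a xw).
  by rewrite ler_wpM2l.
have h1 := single _ _ _ _ adm b1 x1; have h2 := single _ _ _ _ admF b2 x2.
rewrite /total4 mulr0 mul0r addr0 mulrDr; apply: le_trans (lerD h1 h2) _.
by have := mulr_ge0 (Q0 x1) (F0 x2); move: (Q u) (F v) => p q pq; nra.
Qed.

(** The plateau is bounded because a nonzero pair (w, w) has positive coupling. Its supremum belongs
    to it because, for each pair, the quotient inequality with constant c_0 is affine in b and so
    survives the limit. *)
Lemma level_plateau_max : exists m, [set b | 0 <= b /\ level X Q F b = level X Q F 0] m /\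
  ubound [set b | 0 <= b /\ level X Q F b = level X Q F 0] m.
Proof.
set S := [set b | _]; pose c0 := level X Q F 0.
have c00 : 0 < c0 by exact: level_gt0.
have [w [hw nw]] := H1_nonzero R; have [xw qw] := adm_H1 adm hw.
have gw := H1_good4 hw; have nw4 := n4_gt0 gw nw.
have S0 : S 0 by [].
have SB : ubound S ((Q w + F w) ^+ 2 / (8 * c0 * n4 w)).
  move=> b [b0 cb]; rewrite ler_pdivlMr; last by apply: mulr_gt0 => //; exact: mulr_gt0.
  have := level_le adm tom0 b0 xw hw; rewrite cb -/c0; apply: le_trans.
  rewrite /total4 coupling_self//.
  have -> : b * (8 * c0 * n4 w) = 4 * c0 * (2 * b * n4 w) by ring.
  apply: ler_wpM2l; first by rewrite mulr_ge0// ltW.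
  by rewrite lerDr addr_ge0// ltW.
have hS : has_sup S by split; [exists 0|eexists; exact: SB].
pose m := sup S; have mS : ubound S m by move=> b Sb; apply: ub_le_sup => //; case: hS.
have m0 : 0 <= m by exact: mS.
exists m; split=> //; split=> //; apply/eqP; rewrite eq_le level_mono//=.
apply: (level_ge adm tom0 m0) => u v x1 x2 _; rewrite -/c0 leNgt; apply/negP => lt.
pose gap := 4 * c0 * total4 m u v - (Q u + F v) ^+ 2; have gap0 : 0 < gap by rewrite subr_gt0.
have cp := coupling_ge0 u v; have d0 : 0 < 8 * c0 * coupling u v + 1.
  by apply: ltr_wpDl => //; apply: mulr_ge0 => //; rewrite mulr_ge0// ltW.
(* Going from m to b changes 4 c0 N by 8 c0 (m - b) times the coupling. This distance makes the
   change smaller than the gap, contradicting the inequality at b; the summand 1 covers a zero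
   coupling. *)
have [|b Sb mb] := @sup_adherent _ S (gap / (8 * c0 * coupling u v + 1)) _ hS; first exact: divr_gt0.
have [b0 cb] := Sb; have := level_le adm tom0 b0 x1 x2; rewrite cb -/c0.
have E : total4 b u v = total4 m u v - 2 * (m - b) * coupling u v by rewrite /total4; ring.
rewrite E => h; have h1 : gap <= 8 * c0 * coupling u v * (m - b).
  rewrite /gap; move: h; move: (total4 m u v) ((Q u + F v) ^+ 2) (coupling u v) => t q c h.
  have -> : 8 * c0 * c * (m - b) = 4 * c0 * (2 * (m - b) * c) by ring.
  by move: h; rewrite mulrBr; lra.
move: mb; rewrite -/m ltrBlDl -ltrBlDr ltr_pdivlMr//.
have mb0 : 0 <= m - b by rewrite subr_ge0; exact: mS.
move=> h2; have : (m - b) * (8 * c0 * coupling u v) <= (m - b) * (8 * c0 * coupling u v + 1).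
  by rewrite ler_wpM2l// lerDl.
rewrite [(m - b) * (8 * c0 * coupling u v)]mulrC => h3.
by have := lt_le_trans (le_lt_trans h3 h2) h1; rewrite ltxx.
Qed.

End Levels.

(** * Strict inequality between the levels with and without point interaction *)

Section Key.
Variables (alpha lam om tom be : R).
Hypotheses (hlam : omega_min alpha < lam) (lam_om : lam <= om) (tom0 : 0 < tom) (be0 : 0 <= be).
Let lam0 : 0 < lam. Proof. by have [] := omega_theta hlam. Qed.
Let om0 : 0 < om := lt_le_trans lam0 lam_om.
Let admP := point_admissible hlam lam_om.
Let admH := free_admissible om0.
Let admF := free_admissible tom0.
Local Notation F := (@free_form R tom).
Let cc := c_free om tom be.
Let cc0 : 0 < cc. Proof. exact: (level_gt0 admH tom0 be0). Qed.

Lemma c_point_le_c_free : c_point alpha lam om tom be <= cc.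
Proof.
apply: (level_ge admH tom0 be0) => u v x1 x2 _.
by have [xu <-] := adm_H1 admP x1; exact: (level_le admP tom0 be0 xu x2).
Qed.

(** Otherwise every pair, rescaled to unit form, would satisfy the quotient inequality with the
    larger constant cc / (1 - tau^2), which would then be a lower bound for the infimum cc. *)
Let near_optimizer tau : 0 < tau -> tau < 1 -> exists u v,
  [/\ H1 u, H1 v, free_form om u + F v = 1 & 1 - tau ^+ 2 <= 4 * cc * total4 be u v].
Proof.
move=> tau0 tau1; apply: contrapT => none.
have t2 : 0 < 1 - tau ^+ 2 by rewrite subr_gt0 expr_lt1// ltW.
have : cc / (1 - tau ^+ 2) <= cc.
  apply: (level_ge admH tom0 be0) => u v x1 x2 n.
  have q0 : 0 < free_form om u + F v.
    have q1 := adm_ge0 admH x1; have q2 := adm_ge0 admF x2.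
    have [z|nu] := pselect (aezero u).
      by apply: ltr_wpDl => //; apply: (adm_gt0 admF x2) => z2; exact: n.
    by apply: ltr_wpDr => //; exact: (adm_gt0 admH x1 nu).
  pose t := (Num.sqrt (free_form om u + F v))^-1; have t0 : 0 < t by rewrite invr_gt0 sqrtr_gt0.
  have tt : t ^+ 2 = (free_form om u + F v)^-1 by rewrite exprVn sqr_sqrtr// ltW.
  have [y1 e1] := adm_csc admH t0 x1; have [y2 e2] := adm_csc admF t0 x2.
  have small : 4 * cc * (t ^+ 4 * total4 be u v) < 1 - tau ^+ 2.
    rewrite ltNge; apply/negP => h; apply: none; exists (csc t u), (csc t v); split => //.
      by rewrite e1 e2 -mulrDr tt mulVf// gt_eqF.
    by rewrite (total4_csc admH).
  have t4 : t ^+ 4 = ((free_form om u + F v) ^+ 2)^-1 by rewrite -[4%N]/(2 * 2)%N exprM tt exprVn.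
  have -> : 4 * (cc / (1 - tau ^+ 2)) * total4 be u v = 4 * cc * total4 be u v / (1 - tau ^+ 2) by ring.
  rewrite ler_pdivrMr// -ler_pdivrMl ?exprn_gt0//; apply/ltW; apply: le_lt_trans small.
  by rewrite t4 mulrCA.
rewrite ler_pdivrMr// ler_pMr// => h; have : 0 < tau ^+ 2 by rewrite exprn_gt0.
by move: h; move: (tau ^+ 2) => a; lra.
Qed.

(* If the two levels agreed, near optimizers of the free problem would nearly
   satisfy the Euler-Lagrange inequality in the direction of the Green
   function, which forces their first component to vanish in L^4. *)
Lemma c_point_lt_c_free : cc < d_free tom -> c_point alpha lam om tom be < cc.
Proof.
move=> ccd; rewrite lt_neqAle c_point_le_c_free andbT; apply/eqP => cE.
have [A0 _] := (proj2 (omega_theta hlam), lam0).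
have [gG _] := greenP lam0; set Gr := re (green lam) in gG.
(* The assumed equality of the levels enters here: the first component u1 + t G + i u2 has the real
   charge t, and the point level is replaced by [cc]. *)
have HJ (t : R) (u1 : plane -> R) g1 (u2 : plane -> R) g2 (v1 : plane -> R) h1 (v2 : plane -> R) h2 : wder u1 g1 -> wder u2 g2 -> wder v1 h1 -> wder v2 h2 ->
    4 * cc * Nq mu be (fun x => u1 x + t * Gr x) u2 v1 v2 <=
    Qreal lam om tom (alpha + theta lam) Gr t u1 g1 u2 g2 v1 h1 v2 h2 ^+ 2.
  move=> wu1 wu2 wv1 wv2.
  pose u : cfun := fun x => ((u1 x + t * Gr x) +i* u2 x)%C; pose v : cfun := fun x => (v1 x +i* v2 x)%C.
  have sG : sqint mu Gr by case: gG.
  have Lu : L2 u by apply/L2P; split; [apply: sqintD; [case: wu1|exact: sqintZ]|case: wu2].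
  have e1 : (fun x => re u x - t * Gr x) = u1 by apply/funext => x; rewrite /re /= addrK.
  have e2 : (fun x => im u x - 0 * Gr x) = u2 by apply/funext => x; rewrite /im /= mul0r subr0.
  have w1 : wder (fun x => re u x - t * Gr x) g1 by rewrite e1.
  have w2 : wder (fun x => im u x - 0 * Gr x) g2 by rewrite e2.
  have xu := H1alpha_comp lam0 Lu w1 w2.
  have hv : H1 v by apply/H1P; exists h1, h2.
  have := level_le admP tom0 be0 xu hv; rewrite -/(c_point alpha lam om tom be) cE.
  rewrite (total4E be (adm_good admP xu) (H1_good4 hv)).
  rewrite (point_formE lam0 alpha om Lu w1 w2) -/Gr e1 e2.
  have wv1' : wder (re v) h1 by []. have wv2' : wder (im v) h2 by [].
  by rewrite (free_formE tom wv1' wv2') expr0n addr0.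
have [C C0 HC] := concentration lam0 lam_om tom0 be0 cc0 A0 gG HJ.
have d0 : 0 < d_free tom := lt_trans cc0 ccd.
(* a, b and k stand for the quartic integrals of u and v and for the coupling. Young's inequality
   with weight 1/tau makes the coupling O(tau): the integral of u is O(tau^2) and gains 1/tau, that
   of v is bounded and gains tau. *)
have arith (tau a b k : R) : 0 < tau -> tau <= 1 -> a <= 4 * C * tau ^+ 2 -> 4 * d_free tom * b <= 1 ->
    k <= tau^-1 / 2 * a + (2 * tau^-1)^-1 * b ->
    4 * cc * (a + b + 2 * be * k) <= cc / d_free tom + tau * (16 * cc * C + 16 * cc * be * C + cc * be / d_free tom).
  move=> tau0 tau1 ha hb hk; move: (d_free tom) d0 hb => d d0 hb.
  have hb1 : b <= 1 / (4 * d) by rewrite ler_pdivlMr ?mulr_gt0// mulrC.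
  have ha1 : a <= 4 * C * tau.
    apply: le_trans ha _; apply: ler_wpM2l; first exact: mulr_ge0.
    by rewrite expr2 ler_piMl// ltW.
  have hk1 : k <= 2 * C * tau + tau / (8 * d).
    apply: le_trans hk _; apply: lerD.
      have -> : tau^-1 / 2 * a = a / (2 * tau) by field; rewrite gt_eqF.
      by rewrite ler_pdivrMr ?mulr_gt0//; apply: le_trans ha _; rewrite le_eqVlt; apply/orP; left; apply/eqP; ring.
    have -> : (2 * tau^-1)^-1 * b = tau / 2 * b by field; rewrite gt_eqF.
    have -> : tau / (8 * d) = tau / 2 * (1 / (4 * d)) by field; rewrite gt_eqF.
    by apply: ler_wpM2l => //; rewrite divr_ge0// ltW.
  have h2 := lerD (lerD ha1 hb1) (ler_wpM2l (mulr_ge0 (ler0n R 2) be0) hk1).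
  apply: le_trans (ler_wpM2l (mulr_ge0 (ler0n R 4) (ltW cc0)) h2) _.
  by rewrite le_eqVlt; apply/orP; left; apply/eqP; field; rewrite gt_eqF.
pose M := 16 * cc * C + 16 * cc * be * C + cc * be / d_free tom.
have M0 : 0 <= M.
  have c0 := ltW cc0; have d0' := ltW d0.
  by apply: addr_ge0; [apply: addr_ge0; do !apply: mulr_ge0|apply: divr_ge0 => //; exact: mulr_ge0].
have bound tau : 0 < tau -> tau < 1 -> 1 - tau ^+ 2 <= cc / d_free tom + tau * M.
  move=> tau0 tau1; have [u [v [hu hv q1 n1]]] := near_optimizer tau0 tau1.
  have gu := H1_good4 hu; have gv := H1_good4 hv.
  have /H1P[g1 [g2 [wu1 wu2]]] := hu; have /H1P[h1 [h2 [wv1 wv2]]] := hv.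
  have q1' := q1; rewrite (free_formE om wu1 wu2) (free_formE tom wv1 wv2) in q1'.
  have n1' := n1; rewrite total4E// in n1'.
  have b1 := HC tau _ _ _ _ _ _ _ _ tau0 (ltW tau1) wu1 wu2 wv1 wv2 (etrans (Qreal0 _ _ _ _ _ _ _ _ _ _ _ _ _) q1') n1'.
  (* Exchanging the real and imaginary parts of the first component changes neither the form nor the
     quartic part, so [concentration] also controls the imaginary part. *)
  have sw : Nq mu be (im u) (re u) (re v) (im v) = Nq mu be (re u) (im u) (re v) (im v).
    by apply: eq_Rintegral => x _; rewrite /quartic [im u x ^+ 2 + _]addrC.
  have q2' : en om (im u) g2 (im u) g2 + en om (re u) g1 (re u) g1 +
      (en tom (re v) h1 (re v) h1 + en tom (im v) h2 (im v) h2) = 1.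
    by rewrite -q1'; congr (_ + _); rewrite addrC.
  have n2' : 1 - tau ^+ 2 <= 4 * cc * Nq mu be (im u) (re u) (re v) (im v) by rewrite sw.
  have b2 := HC tau _ _ _ _ _ _ _ _ tau0 (ltW tau1) wu2 wu1 wv1 wv2 (etrans (Qreal0 _ _ _ _ _ _ _ _ _ _ _ _ _) q2') n2'.
  have nu4 : n4 u <= 4 * C * tau ^+ 2.
    apply: le_trans (n4_le gu) _; have := lerD b1 b2.
    move: (I (fun x => re u x ^+ 4)) (I (fun x => im u x ^+ 4)) (tau ^+ 2) => p q t pq; lra.
  have nv4 : 4 * d_free tom * n4 v <= 1.
    apply: le_trans (level1_le_all admF hv) _; rewrite expr_le1//; last exact: (adm_ge0 admF hv).
    by rewrite -q1 lerDr; exact: (adm_ge0 admH hu).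
  have ti0 : 0 < tau^-1 by rewrite invr_gt0.
  apply: le_trans n1 _; rewrite /total4 /M.
  exact: (arith _ _ _ _ tau0 (ltW tau1) nu4 nv4 (coupling_young ti0 gu gv)).
(* [bound] reads delta <= tau^2 + tau M <= tau (1 + M); the tau chosen below makes the right side
   delta / 2. *)
pose delta := 1 - cc / d_free tom; have de0 : 0 < delta.
  by rewrite subr_gt0 ltr_pdivrMr// mul1r.
have de1 : delta <= 1 by rewrite gerBl divr_ge0// ltW.
pose tau := delta / (2 * (1 + M)); have M1 : 0 < 1 + M by rewrite ltr_wpDr.
have tau0 : 0 < tau by rewrite divr_gt0// mulr_gt0.
have tauM : tau * (1 + M) = delta / 2 by rewrite /tau; field; rewrite gt_eqF.
have tau1 : tau < 1.
  have : tau * 1 <= tau * (1 + M) by rewrite ler_wpM2l ?(ltW tau0)// lerDl.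
  by rewrite tauM mulr1 => h; lra.
have := bound tau tau0 tau1; have t2 : tau ^+ 2 <= tau by rewrite expr2 ler_piMl// ltW.
have : delta + cc / d_free tom = 1 by rewrite subrK.
move: tauM; rewrite mulrDr mulr1; move: (tau * M) (tau ^+ 2) t2 (cc / d_free tom) => a b t2 c; lra.
Qed.

End Key.

End Comparison.

(** * Combination of the level comparisons into the equivalence *)

Lemma set_maxP (R : realType) (A : set R) : (exists m, A m /\ ubound A m) ->
  A (set_max A) /\ ubound A (set_max A).
Proof. exact: (@xgetPex _ 0 [set b | A b /\ ubound A b]). Qed.

Local Close Scope classical_set_scope.

Theorem corollary1p13 (R : realType) (alpha omega tomega beta lambda : R)
    (homega : omega_min alpha < omega) (htomega : 0 < tomega)
    (hbeta : 0 <= beta)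
    (hlambda : omega_min alpha < lambda) (hlambda_le : lambda <= omega) :
  c_point alpha lambda omega tomega beta < c_free omega tomega beta <->
  (d_point alpha lambda omega < d_free tomega \/
   beta_star alpha lambda omega tomega < beta).
Proof.
have adm := point_admissible hlambda hlambda_le.
have om0 : 0 < omega by have [l0 _] := omega_theta hlambda; exact: lt_le_trans hlambda_le.
have [[b0 bE] bmax] := set_maxP (level_plateau_max adm htomega).
rewrite -/(beta_star alpha lambda omega tomega) in b0 bE bmax.
have mono := level_mono adm htomega.
have free_le : c_free omega tomega beta <= d_free tomega.
  exact: (level_le_free (free_admissible om0) htomega hbeta).
(* Strict inequality with d^0 is enough: either c^0_beta < d^0 and the strict comparison applies, or
   c^0_beta >= d^0 and the conclusion is immediate. *)
have key d : c_point alpha lambda omega tomega beta <= d -> d < d_free tomega ->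
    c_point alpha lambda omega tomega beta < c_free omega tomega beta.
  move=> cd dd; have [ccd|dcc] := ltP (c_free omega tomega beta) (d_free tomega).
    exact: c_point_lt_c_free.
  exact: lt_le_trans (le_lt_trans cd dd) dcc.
split=> [lt|[dd|bb]].
- have [dd|dd] := ltP (d_point alpha lambda omega) (d_free tomega); first by left.
  (* If d >= d^0 and beta <= beta^*, then c_beta >= c_{beta^*} = c_0 >= d^0 >= c^0_beta, against the
     hypothesis. *)
  right; rewrite ltNge; apply/negP => bb.
  have d0 : 0 <= d_free tomega.
    by apply: le_trans free_le; apply/ltW/(level_gt0 (free_admissible om0)).
  have h := le_level0 adm htomega d0 dd (lexx _).
  have := lt_le_trans lt free_le; rewrite ltNge; move/negP; apply.
  by apply: le_trans h _; rewrite -bE; exact: mono.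
- by apply: key dd; exact: (level_le_level1 adm htomega hbeta).
(* Beyond the end of the plateau c_beta < c_0, and c_0 <= d^0 by the pairs (0, v). *)
- have : c_point alpha lambda omega tomega beta < c_point alpha lambda omega tomega 0.
    rewrite lt_neqAle; apply/andP; split; last exact: mono.
    by apply/eqP => cE; have := bmax _ (conj hbeta cE); rewrite leNgt bb.
  move=> lt0; have [z|z] := ltP (c_free omega tomega beta) (d_free tomega); first exact: c_point_lt_c_free.
  apply: (lt_le_trans lt0); apply: le_trans z.
  exact: (level_le_free adm htomega (lexx 0)).
Qed.
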